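(* Let $G$ be a noncompact amenable locally compact group, and let $\kappa$ be the least cardinal such that $G$ is the union of a family of $\kappa$ compact subsets. Then $|\operatorname{TIM}(G)| = |\operatorname{TLIM}(G)| = 2^{2^\kappa}$.
   Context: $L_\infty(G)$ is the dual of $L_1(G)$ (left Haar measure). $\mathcal P_1(G) = \{f\in L_1(G) : f\ge 0, \|f\|_1 = 1\}$. For $T\in L_\infty(G)$ and $f,g\in L_1(G)$, define $fT, Tf\in L_\infty(G)$ by $\langle fT,g\rangle = \langle T, f*g\rangle$ and $\langle Tf,g\rangle = \langle T,g*f\rangle$. A mean is a positive unital linear functional on $L_\infty(G)$. A mean $m$ is topologically left invariant if $\langle m,fT\rangle = \langle m,T\rangle$ for all $f\in\mathcal P_1(G)$, $T\in L_\infty(G)$; topologically right invariant if $\langle m,Tf\rangle = \langle m,T\rangle$ for all such $f,T$; topologically two-sided invariant if both. $\operatorname{TLIM}(G)$ and $\operatorname{TIM}(G)$ denote the sets of topologically left invariant and topologically two-sided invariant means on $L_\infty(G)$. $|\cdot|$ denotes cardinality here. *)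

(* Defs.v *)
From HB Require Import structures.
From mathcomp Require Import all_boot all_order all_algebra.
From mathcomp Require Import all_classical all_reals all_analysis measurable_realfun.
From mathcomp Require Import complex ring lra.

Set Implicit Arguments.
Unset Strict Implicit.
Unset Printing Implicit Defensive.

Import Order.TTheory GRing.Theory Num.Theory.
Import numFieldNormedType.Exports.

Local Open Scope classical_set_scope.
Local Open Scope card_scope.
Local Open Scope ring_scope.

(* The base point inherited from [PointedTopological] carries no information;
   it is required by the library's measurable types. *)
HB.structure Definition PreTopologicalGroup :=
  {G of PointedTopological G & Group G}.

HB.mixin Record PreTopologicalGroup_isTopologicalGroup G
    & PreTopologicalGroup G := {
  mulg_continuous : continuous (fun p : G * G => (p.1 * p.2)%g) ;
  invg_continuous : continuous (fun x : G => (x^-1)%g) ;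
}.

#[short(type="topologicalGroupType")]
HB.structure Definition TopologicalGroup :=
  {G of PreTopologicalGroup G & PreTopologicalGroup_isTopologicalGroup G}.

Notation borel G := (g_sigma_algebraType (@open G)).

(* When [G] is not sigma-compact the regularity convention matters: outer
   regular on all Borel sets, inner regular on open sets only. *)
HB.mixin Record isLeftHaar (G : topologicalGroupType) (R : realType)
    (mu : set (borel G) -> \bar R) := {
  haar_neq0 : mu setT != 0%E ;
  haar_compact : forall A : set G, compact A -> (mu A < +oo)%E ;
  haar_outer : forall A : set G, measurable (A : set (borel G)) ->
    mu A = ereal_inf [set mu U | U in [set U : set G | open U /\ A `<=` U]] ;
  haar_inner : forall U : set G, open U ->
    mu U = ereal_sup [set mu A | A in [set A : set G | compact A /\ A `<=` U]] ;
  haar_invariant : forall (x : G) (A : set G), measurable (A : set (borel G)) ->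
    mu [set (x * y)%g | y in A] = mu A ;
}.

#[short(type="leftHaarMeasure")]
HB.structure Definition LeftHaar (G : topologicalGroupType) (R : realType) :=
  {mu of @Measure _ (borel G) R mu & isLeftHaar G R mu}.

Section L1.
Context (G : topologicalGroupType) (R : realType) (mu : leftHaarMeasure G R).
Local Notation C := R[i].
Implicit Types (f g : G -> C).

Definition cintegral f : C :=
  Complex (\int[mu]_x complex.Re (f x)) (\int[mu]_x complex.Im (f x)).

Definition cintegrable f :=
  mu.-integrable setT (fun x : borel G => (complex.Re (f x))%:E) /\
  mu.-integrable setT (fun x : borel G => (complex.Im (f x))%:E).

(* Functions are not identified when they agree a.e.; since the elements of
   [Linf] below are bounded for the seminorm [L1norm], they are exactly the
   bounded functionals on the quotient. *)
Definition L1pred : {pred G -> C} := mem [set f | cintegrable f].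

Record L1 := MkL1 { L1val :> G -> C ; _ : L1val \in L1pred }.

HB.instance Definition _ := [isSub for L1val].
HB.instance Definition _ := [Choice of L1 by <:].

Lemma L1P (f : L1) : cintegrable f.
Proof. by have := valP f; rewrite inE. Qed.

Lemma L1pred_submod_closed : submod_closed L1pred.
Proof.
split.
  by rewrite inE /=; split; exact: integrable0.
move=> a f g; rewrite !inE /= => -[fr fi] [gr gi]; split.
  apply: (@eq_integrable _ _ _ mu setT measurableT
    ((fun x => (complex.Re a)%:E * (complex.Re (f x))%:E) \+
     ((fun x => (- complex.Im a)%:E * (complex.Im (f x))%:E) \+
      (fun x => (complex.Re (g x))%:E)))%E); last first.
    by do ![apply: integrableD => //; try exact: integrableZl].
  move=> x _ /=; rewrite -!EFinM -!EFinD; congr EFin.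
  rewrite /= !fctE /=; case: a (f x) (g x) => [a b] [c d] [e h] /=; ring.
apply: (@eq_integrable _ _ _ mu setT measurableT
  ((fun x => (complex.Re a)%:E * (complex.Im (f x))%:E) \+
   ((fun x => (complex.Im a)%:E * (complex.Re (f x))%:E) \+
    (fun x => (complex.Im (g x))%:E)))%E); last first.
  by do ![apply: integrableD => //; try exact: integrableZl].
move=> x _ /=; rewrite -!EFinM -!EFinD; congr EFin.
rewrite /= !fctE /=; case: a (f x) (g x) => [a b] [c d] [e h] /=; ring.
Qed.

HB.instance Definition _ := GRing.isSubmodClosed.Build _ _ L1pred
  L1pred_submod_closed.
HB.instance Definition _ := [SubChoice_isSubLmodule of L1 by <:].

Lemma L1E (a : C) (f g : L1) (x : G) : (a *: f + g) x = a * f x + g x.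
Proof. by []. Qed.

Definition L1norm (f : L1) : R := \int[mu]_x complex.Re `|f x|.

End L1.

Section convolution.
Context (G : topologicalGroupType) (R : realType) (mu : leftHaarMeasure G R).
Local Notation C := R[i].
Local Notation L1 := (L1 mu).

(* By Tonelli's theorem for Radon measures, the pointwise formula (whose real and
   imaginary parts are set to 0 where the integral diverges, a null set) defines
   an element of [L1] when [G] is locally compact Hausdorff; the default 0 of
   [insubd] is not reached. *)
Definition conv (f g : L1) : L1 :=
  insubd (0 : L1) (fun x : G => cintegral mu (fun y => f y * g (y^-1 * x)%g)).

Definition P1 : set L1 :=
  [set f : L1 | {ae mu, forall x, 0 <= f x} /\ L1norm f = 1].

Lemma measurable_mulgl (x : G) :
  measurable_fun setT ((fun y => x * y)%g : borel G -> borel G).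
Proof.
apply: (@measurability _ _ (borel G) (borel G) _ _ (@open G)) => //.
move=> _ [B oB <-]; rewrite setTI; apply: sub_sigma_algebra => /=.
move: B oB; apply/continuousP => z.
apply: (@continuous_comp _ _ _ (fun y => (x, y)) (fun p : G * G => p.1 * p.2)%g).
  by apply: cvg_pair => //=; exact: cvg_cst.
exact: mulg_continuous.
Qed.

Lemma ge0_integral_mulgl (x : G) (h : borel G -> \bar R) :
  measurable_fun setT h -> (forall y, 0 <= h y)%E ->
  (\int[mu]_y h (x * y)%g = \int[mu]_y h y)%E.
Proof.
move=> mh h0.
pose mphi := measurable_mulgl x.
have -> : (\int[mu]_y h (x * y)%g =
           \int[pushforward mu (fun y : borel G => (x * y)%g : borel G)]_y h y)%E.
  rewrite (@ge0_integral_pushforward _ _ (borel G) (borel G) R _ mphi mu setT h)//.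
apply: eq_measure_integral => A mA _.
rewrite /pushforward; apply: etrans (haar_invariant (s := mu) x^-1%g A mA).
congr (mu _).
apply/seteqP; split=> [y /= Ay|_ [y Ay <-]] /=.
  by exists (x * y)%g => //; rewrite mulKg.
by rewrite mulVKg.
Qed.

Lemma translate_subproof (x : G) (f : L1) :
  (fun y => f (x * y)%g) \in L1pred mu.
Proof.
suff H (h : borel G -> R) : mu.-integrable setT (EFin \o h) ->
    mu.-integrable setT (fun y => (h (x * y)%g)%:E).
  by have [fr fi] := L1P f; rewrite inE; split;
    [exact: (H (fun y => complex.Re (f y)))|
     exact: (H (fun y => complex.Im (f y)))].
move=> /integrableP[mh hoo]; apply/integrableP; split.
  exact: (measurableT_comp mh (measurable_mulgl x)).
rewrite (@ge0_integral_mulgl x (fun y => `|(h y)%:E|%E))//.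
exact: measurableT_comp.
Qed.

Definition translate (x : G) (f : L1) : L1 := MkL1 (translate_subproof x f).

Lemma measurable_normL1 (f : L1) :
  measurable_fun setT (fun y : borel G => complex.Re `|f y|).
Proof.
have [/integrableP[fr _] /integrableP[fi _]] := L1P f.
rewrite (_ : (fun _ => _) = (fun y : borel G =>
    Num.sqrt (complex.Re (f y) ^+ 2 + complex.Im (f y) ^+ 2))); last first.
  by apply/funext => y; rewrite normc_def.
apply: (measurableT_comp (continuous_measurable_fun (@sqrt_continuous R))).
apply: measurable_funD; apply: measurable_funX; exact/measurable_EFinP.
Qed.

Lemma normL1_ge0 (f : L1) y : 0 <= complex.Re `|f y|.
Proof. by rewrite normc_def /= sqrtr_ge0. Qed.

Lemma L1norm_translate (x : G) (f : L1) : L1norm (translate x f) = L1norm f.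
Proof.
rewrite /L1norm /Rintegral; congr fine.
rewrite -(@ge0_integral_mulgl x (fun y => (complex.Re `|f y|)%:E))//.
  by apply/measurable_EFinP; exact: (measurable_normL1 f).
by move=> y; rewrite lee_fin normL1_ge0.
Qed.

End convolution.

Section Linf.
Context (G : topologicalGroupType) (R : realType) (mu : leftHaarMeasure G R).
Local Notation C := R[i].
Local Notation L1 := (L1 mu).

Definition Linfpred : {pred L1 -> C} :=
  mem [set T : L1 -> C | linear T /\
    exists M : R, forall f, `|T f| <= (M * L1norm f)%:C%C].

Record Linf := MkLinf { Linfval :> L1 -> C ; _ : Linfval \in Linfpred }.

HB.instance Definition _ := [isSub for Linfval].
HB.instance Definition _ := [Choice of Linf by <:].

Lemma Linfpred_submod_closed : submod_closed Linfpred.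
Proof.
split.
  rewrite inE /=; split; first by move=> a f g /=; rewrite scaler0 addr0.
  by exists 0 => f; rewrite mul0r normr0.
move=> a S T; rewrite !inE /= => -[lS [M bS]] [lT [N bT]]; split.
  move=> b f g; rewrite !fctE /= lS lT /=.
  rewrite /GRing.scale /=; ring.
exists (complex.Re `|a| * M + N) => f; rewrite !fctE.
rewrite (le_trans (ler_normD _ _))// mulrDl rmorphD lerD//.
rewrite normrM -mulrA rmorphM.
rewrite [X in _ <= X * _](_ : _ = `|a|); last exact/RRe_real/normr_real.
exact: ler_wpM2l.
Qed.

HB.instance Definition _ := GRing.isSubmodClosed.Build _ _ Linfpred
  Linfpred_submod_closed.
HB.instance Definition _ := [SubChoice_isSubLmodule of Linf by <:].

Lemma one_subproof : (fun f : L1 => cintegral mu f) \in Linfpred.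
Proof.
have Lre (f : L1) : mu.-integrable setT (fun x : borel G => (complex.Re (f x))%:E).
  by have [] := L1P f.
have Lim (f : L1) : mu.-integrable setT (fun x : borel G => (complex.Im (f x))%:E).
  by have [] := L1P f.
have Lnorm (f : L1) :
    mu.-integrable setT (fun x : borel G => (complex.Re `|f x|)%:E).
  apply: (@le_integrable _ _ _ mu setT measurableT _
    (fun x => `|(complex.Re (f x))%:E| + `|(complex.Im (f x))%:E|)%E).
  - by apply/measurable_EFinP; exact: (measurable_normL1 f).
  - move=> x _ /=; rewrite lee_fin; case: (f x) => u v /=.
    rewrite [leLHS]ger0_norm ?sqrtr_ge0// -sqrtr_sqr ler_sqrt ?sqr_ge0//.
    by rewrite sqrrD !real_normK ?num_real// lerD2r lerDl mulrn_wge0// mulr_ge0.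
  - by apply: integrableD => //; apply: integrable_abse.
rewrite inE /=; split.
  move=> a f g.
  have ZD (b c : R) (u v w : borel G -> R) : mu.-integrable setT (EFin \o u) ->
      mu.-integrable setT (EFin \o v) -> mu.-integrable setT (EFin \o w) ->
      \int[mu]_x (b * u x + c * v x + w x) =
      b * (\int[mu]_x u x) + c * (\int[mu]_x v x) + \int[mu]_x w x.
    move=> iu iv iw.
    have ibu : mu.-integrable setT (EFin \o (fun x => b * u x)).
      exact: (integrableZl measurableT b iu).
    have icv : mu.-integrable setT (EFin \o (fun x => c * v x)).
      exact: (integrableZl measurableT c iv).
    rewrite RintegralD//; last exact: (integrableD measurableT ibu icv).
    by rewrite RintegralD// !RintegralZl.
  apply/eqP; rewrite eq_complex; apply/andP; split; apply/eqP.
    rewrite [LHS](_ : _ = \int[mu]_x (complex.Re a * complex.Re (f x) +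
        - complex.Im a * complex.Im (f x) + complex.Re (g x))); last first.
      apply: eq_Rintegral => x _; rewrite L1E.
      by case: a (f x) (g x) => [? ?] [? ?] [? ?] /=; ring.
    rewrite ZD; [|exact: Lre|exact: Lim|exact: Lre].
    by rewrite /GRing.scale /=; case: a => [? ?] /=; ring.
  rewrite [LHS](_ : _ = \int[mu]_x (complex.Re a * complex.Im (f x) +
      complex.Im a * complex.Re (f x) + complex.Im (g x))); last first.
    apply: eq_Rintegral => x _; rewrite L1E.
    by case: a (f x) (g x) => [? ?] [? ?] [? ?] /=; ring.
  rewrite ZD; [|exact: Lim|exact: Lre|exact: Lim].
  by rewrite /GRing.scale /=; case: a => [? ?] /=; ring.
exists 2 => f; rewrite normc_def lecR.
have bound (u : borel G -> R) : mu.-integrable setT (EFin \o u) ->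
    (forall x, `|u x| <= complex.Re `|f x|) ->
    (\int[mu]_x u x) ^+ 2 <= L1norm f ^+ 2.
  move=> iu ub; rewrite -real_normK ?num_real// lerXn2r ?nnegrE//.
    by apply: Rintegral_ge0 => x _; exact: normL1_ge0.
  apply: (le_trans (le_normr_Rintegral _ _)) => //.
  apply: le_Rintegral => //; first exact: (integrable_norm iu).
  exact: Lnorm.
have nf0 : 0 <= L1norm f by apply: Rintegral_ge0 => x _; exact: normL1_ge0.
rewrite -[leRHS]ger0_norm ?mulr_ge0// -sqrtr_sqr ler_sqrt ?sqr_ge0//.
have hre := bound _ (Lre f); have him := bound _ (Lim f).
have n20 : 0 <= L1norm f ^+ 2 by exact: sqr_ge0.
rewrite exprMn /=; apply: (le_trans (lerD (hre _) (him _))); last by lra.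
- move=> x; rewrite normc_def /= -sqrtr_sqr ler_sqrt ?addr_ge0 ?sqr_ge0//.
  by rewrite lerDl sqr_ge0.
- move=> x; rewrite normc_def /= -sqrtr_sqr ler_sqrt ?addr_ge0 ?sqr_ge0//.
  by rewrite lerDr sqr_ge0.
Qed.

Definition Linf_one : Linf := MkLinf one_subproof.

Definition Linf_nonneg (T : Linf) :=
  forall f : L1, {ae mu, forall x, 0 <= f x} -> 0 <= T f.

Lemma Linf_translate_subproof (x : G) (T : Linf) :
  (fun f => T (translate x f)) \in Linfpred.
Proof.
have := valP T; rewrite !inE /= => -[lT [M bT]]; split.
  move=> a f g; rewrite -lT; congr (Linfval T _).
  by apply: val_inj; exact: erefl.
by exists M => f; rewrite -(L1norm_translate x) bT.
Qed.

Definition Linf_translate (x : G) (T : Linf) : Linf :=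
  MkLinf (Linf_translate_subproof x T).

(* [lmodact f T] is fT and [rmodact T f] is Tf. As |f * g|_1 <= |f|_1 |g|_1,
   these functionals are bounded when [G] is locally compact Hausdorff; the
   default 0 of [insubd] is not reached. *)
Definition lmodact (f : L1) (T : Linf) : Linf :=
  insubd (0 : Linf) (fun g => T (conv f g)).

Definition rmodact (T : Linf) (f : L1) : Linf :=
  insubd (0 : Linf) (fun g => T (conv g f)).

Implicit Types m : Linf -> C.

Definition is_mean m :=
  [/\ linear m, forall T, Linf_nonneg T -> 0 <= m T & m Linf_one = 1].

Definition top_left_invariant m :=
  forall f T, P1 f -> m (lmodact f T) = m T.

Definition top_right_invariant m :=
  forall f T, P1 f -> m (rmodact T f) = m T.

Definition TLIM : set (Linf -> C) :=
  [set m | is_mean m /\ top_left_invariant m].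

Definition TIM : set (Linf -> C) :=
  [set m | [/\ is_mean m, top_left_invariant m & top_right_invariant m]].

(* Invariance under translations by points, not the topological invariance
   entering [TLIM]; [Linf_translate x T] represents y |-> T (x^-1 y). *)
Definition amenable :=
  exists2 m, is_mean m & forall x T, m (Linf_translate x T) = m T.

End Linf.

Arguments TLIM {G R} mu m.
Arguments TIM {G R} mu m.
Arguments amenable {G R} mu.

Definition compact_covering (G : topologicalType) (I : Type) :=
  exists2 A : I -> set G, (forall i, compact (A i)) & \bigcup_i A i = setT.

(* The cardinality of [K] is the least cardinal of a compact covering of [G]. *)
Definition compact_covering_number (G : topologicalType) (K : Type) :=
  compact_covering G K /\
  forall I : Type, compact_covering G I -> [set: K] #<= [set: I].

(* Main.v *)
Require Import Defs.
From HB Require Import structures.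
From mathcomp Require Import all_boot all_order all_algebra.
From mathcomp Require Import all_classical all_reals all_analysis.
From mathcomp Require Import measurable_realfun complex ring lra.

Set Implicit Arguments.
Unset Strict Implicit.
Unset Printing Implicit Defensive.

Import Order.TTheory GRing.Theory Num.Theory.
Import numFieldNormedType.Exports.

Local Open Scope classical_set_scope.
Local Open Scope card_scope.

Local Open Scope ring_scope.

(* Amenability gives Reiter's condition: by Hahn-Banach, for every compact C and
   e > 0 there is a compactly supported density F with |F(c .) - F|_1 <= e on C.
   Then f = F * (F^* translated by z) is nearly invariant on both sides, for every z,
   and choosing z by transfinite recursion over an index set of cardinality K (no
   union of fewer than K compact sets covers G) makes the supports of such a net
   f_i pairwise disjoint. An independent family of 2^K subsets of the index set
   yields 2^(2^K) ultrafilters finer than the net; the limits along them are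
   topologically two-sided invariant means, and disjointness of the supports
   separates them.
   Conversely, for a fixed density f, a topologically left invariant mean is
   determined by its values on the functionals fT, and fT is determined by the values
   of T at K many elements of L_1, since right translation is continuous on L_1.
   So TLIM embeds in the functions from C^K to C.
   G need not be sigma-compact: Tonelli's theorem is proved for functions
   vanishing off S * S with S sigma-compact, which is enough because every
   integrable function vanishes off a sigma-compact set. *)

(** Two obstacles shape the analysis. The Borel sets of [G * G] may exceed the product sigma-algebra
    and Haar measure need not be sigma-finite, so Tonelli's theorem, on which convolution rests, has
    to come from the regularity of the measure. And an element of [Linf] is a functional, not a
    function: an identity between bounded functionals of [g] is proved by letting [g] live near one
    point, where [g * h] is close to a multiple of a translate of [h]. Amenability is invariance
    under points; it enters through the fact that for such a mean [m] the functional [h |-> m (hT)]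
    takes one value on all densities. In the lower bound the parameter [z] moves the support
    [Q z Q^-1] without touching the estimates, so the values of [z] that would make a support meet
    an earlier one form a compact set. An index is a pair: a list of pieces of the compact cover,
    which directs the net, and a list of such lists, which carries the independent family. As [K] is
    infinite, such pairs are no more numerous than [K]. *)

(** * Products, sigma-compact sets and subgroups in a topological group *)

Section topological_group.
Context {G : topologicalGroupType}.
Implicit Types (A B S U : set G) (x y : G).

Definition mulset A B : set G := [set (a * b)%g | a in A & b in B].
Definition invset A : set G := [set (a^-1)%g | a in A].

Lemma continuous_mulg {T : topologicalType} (f g : T -> G) :
  continuous f -> continuous g -> continuous (fun t => f t * g t)%g.
Proof.
move=> cf cg t.
apply: (@continuous_comp _ _ _ (fun t => (f t, g t)) (fun p : G * G => p.1 * p.2)%g).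
  by apply: cvg_pair => //=; [exact: cf|exact: cg].
exact: mulg_continuous.
Qed.

Lemma continuous_invg {T : topologicalType} (f : T -> G) :
  continuous f -> continuous (fun t => (f t)^-1)%g.
Proof. by move=> cf t; apply: continuous_comp; [exact: cf|exact: invg_continuous]. Qed.

Lemma compact_mulset A B : compact A -> compact B -> compact (mulset A B).
Proof.
move=> cA cB; rewrite (_ : mulset A B = (fun p : G * G => p.1 * p.2)%g @` (A `*` B)).
  apply: continuous_compact; last exact: compact_setX.
  by apply: continuous_subspaceT; exact: mulg_continuous.
apply/seteqP; split => [_ [a Aa [b Bb <-]]|_ [[a b] /= [Aa Bb] <-]].
  by exists (a, b).
by exists a => //; exists b.
Qed.

Lemma compact_invset A : compact A -> compact (invset A).
Proof.
move=> cA; apply: continuous_compact => //.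
by apply: continuous_subspaceT; exact: invg_continuous.
Qed.

Lemma open_preimage {T T' : topologicalType} (f : T -> T') (U : set T') : continuous f ->
  open U -> open (f @^-1` U).
Proof. by move=> cf oU; move/continuousP : cf; exact. Qed.

Lemma open_mull x U : open U -> open [set y | U (x * y)%g].
Proof.
apply: open_preimage; apply: continuous_mulg; first by move=> t; exact: cvg_cst.
by move=> t; exact: cvg_id.
Qed.

Lemma open_mulr x U : open U -> open [set y | U (y * x)%g].
Proof.
apply: open_preimage; apply: continuous_mulg; first by move=> t; exact: cvg_id.
by move=> t; exact: cvg_cst.
Qed.

Lemma open_inv U : open U -> open [set y | U (y^-1)%g].
Proof. by apply: open_preimage; exact: invg_continuous. Qed.

Lemma open_mulset_r A U : open U -> open (mulset A U).
Proof.
move=> oU; rewrite (_ : mulset A U = \bigcup_(a in A) [set y | U (a^-1 * y)%g]).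
  by apply: bigcup_open => a _; exact: open_mull.
apply/seteqP; split => [_ [a Aa [u Uu <-]]|y [a Aa /= Uy]].
  by exists a => //=; rewrite mulKg.
by exists a => //; exists (a^-1 * y)%g => //; rewrite mulVKg.
Qed.

Lemma open_mulset_l A U : open U -> open (mulset U A).
Proof.
move=> oU; rewrite (_ : mulset U A = \bigcup_(a in A) [set y | U (y * a^-1)%g]).
  by apply: bigcup_open => a _; exact: open_mulr.
apply/seteqP; split => [_ [u Uu [a Aa <-]]|y [a Aa /= Uy]].
  by exists a => //=; rewrite mulgK.
by exists (y * a^-1)%g => //; exists a => //; rewrite mulgVK.
Qed.

Definition sigma_compact S :=
  exists2 A : nat -> set G, (forall n, compact (A n)) & S = \bigcup_n A n.

Lemma compact_sigma_compact A : compact A -> sigma_compact A.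
Proof.
by move=> cA; exists (fun=> A) => //; rewrite bigcup_const//; exists 0%N.
Qed.

Lemma sigma_compact_bigcup (S : nat -> set G) :
  (forall n, sigma_compact (S n)) -> sigma_compact (\bigcup_n S n).
Proof.
move=> sS.
have /choice[A AP] n : exists A : nat -> set G,
    (forall m, compact (A m)) /\ S n = \bigcup_m A m.
  by have [A cA SA] := sS n; exists A.
have [g gP] : exists g : nat -> nat * nat, forall p, exists n, g n = p.
  exists (fun n => odflt (0, 0)%N (unpickle n)) => p.
  by exists (pickle p); rewrite pickleK.
exists (fun n => A (g n).1 (g n).2) => [n|]; first exact: (AP _).1.
apply/seteqP; split => [y [n _]|y [n _ Ay]].
  rewrite (AP n).2 => -[m _ Ay]; have [k gk] := gP (n, m).
  by exists k => //; rewrite gk.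
by exists (g n).1 => //; rewrite (AP _).2; exists (g n).2.
Qed.

Lemma sigma_compactU S1 S2 : sigma_compact S1 -> sigma_compact S2 ->
  sigma_compact (S1 `|` S2).
Proof.
move=> s1 s2; rewrite (_ : _ `|` _ = \bigcup_n (if n == 0%N then S1 else S2)).
  by apply: sigma_compact_bigcup => -[].
apply/seteqP; split => [y [?|?]|y [[|n] _ ?]]; [by exists 0%N|by exists 1%N|left|right] => //.
Qed.

Lemma sigma_compact_mulset S1 S2 : sigma_compact S1 -> sigma_compact S2 ->
  sigma_compact (mulset S1 S2).
Proof.
move=> [A cA ->] [B cB ->].
rewrite (_ : mulset _ _ = \bigcup_n \bigcup_m mulset (A n) (B m)).
  apply: sigma_compact_bigcup => n; apply: sigma_compact_bigcup => m.
  by apply: compact_sigma_compact; exact: compact_mulset.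
apply/seteqP; split => [_ [a [n _ Aa] [b [m _ Bb] <-]]|].
  by exists n => //; exists m => //; exists a => //; exists b.
move=> _ [n _ [m _ [a Aa [b Bb <-]]]].
by exists a; [exists n|exists b => //; exists m].
Qed.

Lemma sigma_compact_invset S : sigma_compact S -> sigma_compact (invset S).
Proof.
move=> [A cA ->]; exists (fun n => invset (A n)); first by move=> n; exact: compact_invset.
by rewrite /invset image_bigcup.
Qed.

Definition is_subgroup S := [/\ S 1%g, forall x y, S x -> S y -> S (x * y)%g
  & forall x, S x -> S (x^-1)%g].

(** The subgroup consists of the words in 1, [S] and the inverses of [S]. Supports are enlarged to
    subgroups because these are stable under the shears [(x, y) |-> (y^-1 * x, y)] of convolution;
    and a subgroup that contains a neighbourhood of 1 is open. *)
Lemma sigma_compact_subgroup S : sigma_compact S ->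
  exists H, [/\ S `<=` H, sigma_compact H & is_subgroup H].
Proof.
move=> sS; pose T := [set 1%g] `|` (S `|` invset S).
have sT : sigma_compact T.
  apply: sigma_compactU; first exact/compact_sigma_compact/compact_set1.
  by apply: sigma_compactU => //; exact: sigma_compact_invset.
have TV x : T x -> T (x^-1)%g.
  move=> [->|[Sx|[y Sy <-]]].
  - by left; rewrite /= invg1.
  - by right; right; exists x.
  - by right; left; rewrite invgK.
pose P := fix P n := if n is m.+1 then mulset (P m) T else [set 1%g].
have PD m n x y : P m x -> P n y -> P (m + n)%N (x * y)%g.
  move=> Px; elim: n y => [|n IH] y /=; first by move=> ->; rewrite addn0 mulg1.
  move=> [a Pa [t Tt <-]]; rewrite addnS /=; exists (x * a)%g; first exact: IH.
  by exists t => //; rewrite mulgA.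
have PT x : T x -> P 1%N x by move=> Tx; exists 1%g => //; exists x => //; rewrite mul1g.
have PV n x : P n x -> P n (x^-1)%g.
  elim: n x => [|n IH] x /=; first by move=> ->; rewrite invg1.
  move=> [a Pa [t Tt <-]]; rewrite invgM; apply: (PD 1%N n).
    by apply: PT; exact: TV.
  exact: IH.
exists (\bigcup_n P n); split.
- by move=> x Sx; exists 1%N => //; apply: PT; right; left.
- apply: sigma_compact_bigcup; elim => [|n IH] /=.
    exact/compact_sigma_compact/compact_set1.
  exact: sigma_compact_mulset.
- split; first by exists 0%N.
    by move=> x y [n _ Px] [m _ Py]; exists (n + m)%N => //; exact: PD.
  by move=> x [n _ Px]; exists n => //; exact: PV.
Qed.

Lemma open_subgroup S U : is_subgroup S -> open U -> U 1%g -> U `<=` S -> open S.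
Proof.
move=> [S1 SM SV] oU U1 US; rewrite (_ : S = mulset S U); first exact: open_mulset_r.
apply/seteqP; split => [x Sx|_ [x Sx [u Uu <-]]].
  by exists x => //; exists 1%g => //; rewrite mulg1.
by apply: SM => //; exact: US.
Qed.

End topological_group.

Lemma compact_cover_seq (T : ptopologicalType) (I : choiceType) (K : set T)
    (D : set I) (f : I -> set T) : compact K -> (forall i, D i -> open (f i)) ->
  (forall x, K x -> exists2 i, D i & f i x) ->
  exists2 s : seq I, (forall i, i \in s -> D i) &
    forall x, K x -> exists2 i, i \in s & f i x.
Proof.
rewrite compact_cover => cK of_ Kf; have [//|s sD Ks] := cK I D f of_.
exists (finmap.enum_fset s) => [i /sD /set_mem//|x /Ks [i si fix_]].
by exists i.
Qed.

(** * Haar measure *)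

Section haar.
Context (G : topologicalGroupType) (R : realType) (mu : leftHaarMeasure G R).
Hypothesis hG : hausdorff_space G.
Hypothesis lcG : locally_compact [set: G].
Implicit Types (A B E K O U S : set G) (x y z : G).
Local Notation mbl A := (measurable (A : set (borel G))).

Lemma open_mbl U : open U -> mbl U.
Proof. by move=> oU; exact: sub_sigma_algebra. Qed.

Lemma closed_mbl A : closed A -> mbl A.
Proof.
by move=> cA; rewrite -(setCK A); apply: measurableC; apply: open_mbl; exact: closed_openC.
Qed.

Lemma compact_mbl K : compact K -> mbl K.
Proof. by move=> cK; apply: closed_mbl; exact: compact_closed. Qed.

Lemma sigma_compact_mbl S : sigma_compact S -> mbl S.
Proof.
by move=> [A cA ->]; apply: bigcupT_measurable => n; exact: compact_mbl.
Qed.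

Lemma le_haar A B : mbl A -> mbl B -> A `<=` B -> (mu A <= mu B)%E.
Proof. by move=> mA mB AB; apply: le_measure; rewrite ?inE. Qed.

Lemma haar_null_sub A B : mbl A -> mbl B -> A `<=` B -> mu B = 0%E -> mu A = 0%E.
Proof. by move=> mA mB AB B0; apply/eqP; rewrite -measure_le0 -B0; exact: le_haar. Qed.

Lemma haarU_le A B : mbl A -> mbl B -> (mu (A `|` B) <= mu A + mu B)%E.
Proof. exact: measureU2. Qed.

Lemma compact_nbhs1 : exists U Q : set G,
  [/\ open U, U 1%g, compact Q & U `<=` Q].
Proof.
have [Q] := lcG (x := 1%g) I; rewrite withinET => nQ [cQ _].
by move: nQ; rewrite nbhsE => -[U [oU U1] UQ]; exists U, Q.
Qed.

Lemma compact_open_nbhs K W : compact K -> open W -> W 1%g ->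
  exists O Q, [/\ open O, K `<=` O, compact Q, O `<=` Q & O `<=` mulset K W].
Proof.
move=> cK oW W1; have [U [Q [oU U1 cQ UQ]]] := compact_nbhs1.
exists (mulset K (U `&` W)), (mulset K Q); split.
- by apply: open_mulset_r; exact: openI.
- by move=> x Kx; exists x => //; exists 1%g => //; rewrite mulg1.
- exact: compact_mulset.
- by move=> _ [k Kk [u [Uu _] <-]]; exists k => //; exists u => //; exact: UQ.
- by move=> _ [k Kk [u [_ Wu] <-]]; exists k => //; exists u.
Qed.

Lemma measurable_mulgr x :
  measurable_fun setT ((fun y => y * x)%g : borel G -> borel G).
Proof.
apply: (@measurability _ _ (borel G) (borel G) _ _ (@open G)) => //.
by move=> _ [B oB <-]; rewrite setTI; apply: open_mbl; exact: open_mulr.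
Qed.

Lemma measurable_invg : measurable_fun setT ((fun y => y^-1)%g : borel G -> borel G).
Proof.
apply: (@measurability _ _ (borel G) (borel G) _ _ (@open G)) => //.
by move=> _ [B oB <-]; rewrite setTI; apply: open_mbl; exact: open_inv.
Qed.

Lemma mbl_mull x A : mbl A -> mbl [set y | A (x * y)%g].
Proof. by move=> mA; have := measurable_mulgl x measurableT mA; rewrite setTI. Qed.

Lemma haar_mull x A : mbl A -> mu [set y | A (x * y)%g] = mu A.
Proof.
move=> mA; rewrite -(haar_invariant (s := mu) (x^-1)%g A mA); congr (mu _).
apply/seteqP; split => [y /= Axy|_ [y Ay <-]] /=; last by rewrite mulVKg.
by exists (x * y)%g => //; rewrite mulKg.
Qed.

Lemma haar_inner_gt U (r : \bar R) : open U -> (r < mu U)%E ->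
  exists K, [/\ compact K, K `<=` U & (r < mu K)%E].
Proof.
move=> oU; rewrite (haar_inner (s := mu) U oU) => /ereal_sup_gt[_ [K [cK KU] <-] rK].
by exists K.
Qed.

Lemma haar_outer_lt E (r : \bar R) : mbl E -> (mu E < r)%E ->
  exists O, [/\ open O, E `<=` O & (mu O < r)%E].
Proof.
move=> mE; rewrite (haar_outer (s := mu) E mE) => /ereal_inf_lt[_ [K [cK KU] <-] rK].
by exists K.
Qed.

Lemma haar_compact_fin K : compact K -> mu K \is a fin_num.
Proof. by move=> cK; rewrite ge0_fin_numE//; exact: haar_compact. Qed.

(** Finitely many translates of [U] cover a given compact set. If [U] were null, so would be every
    compact set, and then [G] by inner regularity. *)
Lemma haar_open_gt0 U x : open U -> U x -> (0 < mu U)%E.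
Proof.
move=> oU Ux; rewrite lt0e measure_ge0 andbT; apply/eqP => U0.
have K0 K : compact K -> mu K = 0%E.
  move=> cK; have [|k Kk|D _ KD] := compact_cover_seq (D := K) (f := fun k => [set y | U (x * k^-1 * y)%g]) cK.
  - by move=> k _; exact: open_mull.
  - by exists k => //=; rewrite mulgVK.
  apply: measure_negligible; first exact: compact_mbl.
  apply: (@negligibleS _ _ _ mu (\big[setU/set0]_(k <- D) [set y | U (x * k^-1 * y)%g])).
    by move=> y /KD[k kD Uk]; rewrite -bigcup_seq; exists k.
  elim/big_ind : _ => [|A B nA nB|k _]; [exact: negligible_set0|exact: negligibleU|].
  apply/negligibleP; first by apply: mbl_mull; exact: open_mbl.
  by apply: etrans (haar_mull (x * k^-1)%g (open_mbl oU)) _.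
have := haar_neq0 (s := mu); rewrite (haar_inner (s := mu) setT openT).
rewrite (_ : [set _ | _ in _] = [set 0%E]) ?ereal_sup1 ?eqxx//.
apply/seteqP; split => [_ [K [cK _] <-]|_ ->]; first exact: K0.
by exists set0; [split => //; exact: compact0|rewrite measure0].
Qed.

Lemma haar_open_sigma_compact O : open O -> (mu O < +oo)%E ->
  exists2 P, sigma_compact P & P `<=` O /\ mu (O `\` P) = 0%E.
Proof.
move=> oO Ooo; have Of : mu O \is a fin_num by rewrite ge0_fin_numE.
have /choice[K KP] n : exists K, [/\ compact K, K `<=` O & (mu O - (n.+1%:R^-1)%:E < mu K)%E].
  by apply: haar_inner_gt => //; rewrite lteBlDr// lteDl// lte_fin invr_gt0.
exists (\bigcup_n K n); first by exists K => // n; have [] := KP n.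
split; first by move=> x [n _]; have [_ + _] := KP n; exact.
have mK n : mbl (K n) by have [cK _ _] := KP n; exact: compact_mbl.
have mKs : mbl (\bigcup_n K n) by exact: bigcupT_measurable.
have mO := open_mbl oO.
apply/eqP; rewrite -measure_le0; apply/lee_addgt0Pr => e e0; rewrite add0e.
have [n ne] : exists n, n.+1%:R^-1 < e.
  by exists (Num.truncn e^-1); rewrite invf_plt ?posrE// truncnS_gt.
apply: (@le_trans _ _ (mu (O `\` K n))).
  apply: le_haar; [exact: measurableD|exact: measurableD|].
  by apply: setDS; exact: bigcup_sup.
have [_ KO lK] := KP n; rewrite measureD// setIidr//.
have Kf : mu (K n) \is a fin_num by apply: haar_compact_fin; have [] := KP n.
apply: ltW; rewrite lteBlDr// addeC -lteBlDr//; apply: le_lt_trans lK.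
by rewrite leeB// lee_fin ltW.
Qed.

(** Inner regularity is assumed for open sets only. Choose an open [O] around [E] and a compact [K0]
    in [O], each tight up to [e / 2], and an open [W] around [O \ E] of measure below [e / 2]. Then
    [K0 \ W] is a compact subset of [E] and misses at most [O \ K0] and [W]. *)
Lemma haar_inner_fin E (e : R) : mbl E -> (mu E < +oo)%E -> 0 < e ->
  exists K, [/\ compact K, K `<=` E & (mu (E `\` K) <= e%:E)%E].
Proof.
move=> mE Eoo e0; have Ef : mu E \is a fin_num by rewrite ge0_fin_numE.
have [ O [oO EO Oe]] : exists O, [/\ open O, E `<=` O & (mu O < mu E + (e / 2)%:E)%E].
  by apply: haar_outer_lt => //; rewrite lteDl// lte_fin divr_gt0.
have Ooo : (mu O < +oo)%E by apply: (lt_trans Oe); rewrite -(fineK Ef) -EFinD ltry.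
have Of : mu O \is a fin_num by rewrite ge0_fin_numE.
have mO := open_mbl oO.
have [K0 [cK0 K0O K0e]] : exists K, [/\ compact K, K `<=` O & (mu O - (e / 2)%:E < mu K)%E].
  by apply: haar_inner_gt => //; rewrite lteBlDr// lteDl// lte_fin divr_gt0.
have mOE : mbl (O `\` E) by exact: measurableD.
have OEe : (mu (O `\` E) < (e / 2)%:E)%E.
  by rewrite measureD// setIidr// lteBlDl.
have [W [oW OEW We]] := haar_outer_lt mOE OEe.
have mK0 := compact_mbl cK0; have mW := open_mbl oW.
have cK : compact (K0 `\` W) by rewrite setDE; apply: compact_closedI => //; exact: open_closedC.
exists (K0 `\` W); split => //.
  by move=> x [K0x nWx]; apply: contrapT => nEx; apply/nWx/OEW; split => //; exact: K0O.
apply: (@le_trans _ _ (mu ((O `\` K0) `|` W))).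
  apply: le_haar; [by apply: measurableD => //; exact: compact_mbl|by apply: measurableU => //; exact: measurableD|].
  move=> x [Ex nKx]; have [Wx|nWx] := pselect (W x); [by right|left; split; first exact: EO].
  by move=> K0x; apply: nKx.
apply: (le_trans (haarU_le _ mW)); first exact: measurableD.
rewrite [e in leRHS]splitr EFinD leeD//; last exact: ltW.
rewrite measureD// setIidr// leeBlDr ?haar_compact_fin// addeC -leeBlDr//.
exact: ltW.
Qed.

(** Let [P] be sigma-compact and conull in an open [O] around [E], and [H] an open sigma-compact
    subgroup. A coset [x H] with [x] in [O] must meet [P]: otherwise [O] would intersect it in a
    nonempty open null set. So [O] lies in [P H]. *)
Lemma haar_fin_sub_sigma_compact E : mbl E -> (mu E < +oo)%E ->
  exists2 S, sigma_compact S & E `<=` S.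
Proof.
move=> mE Eoo; have [ O [oO EO Ooo]] := haar_outer_lt mE Eoo.
have [P sP [PO OP0]] := haar_open_sigma_compact oO Ooo.
have [U [Q [oU U1 cQ UQ]]] := compact_nbhs1.
have [H [QH sH [H1 HM HV]]] := sigma_compact_subgroup (compact_sigma_compact cQ).
have UH : U `<=` H by move=> u /UQ /QH.
exists (mulset P H); first exact: sigma_compact_mulset.
apply: (subset_trans EO) => x Ox; apply: contrapT => nPHx.
have oH : open H by exact: (@open_subgroup _ H U).
pose V := O `&` [set y | H (x^-1 * y)%g].
have oV : open V by apply: openI => //; exact: open_mull.
have Vx : V x by split => //=; rewrite mulVg.
have := haar_open_gt0 oV Vx; rewrite (@haar_null_sub V (O `\` P)) ?ltxx//.
- exact: open_mbl.
- by apply: measurableD; [exact: open_mbl|exact: sigma_compact_mbl].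
- move=> y [Oy /= Hxy]; split => // Py; apply: nPHx; exists y => //.
  by exists (y^-1 * x)%g; rewrite ?mulVKg//; have := HV _ Hxy; rewrite invgM invgK.
Qed.

End haar.

(** * Tonelli's theorem *)

Section tonelli.
Context (G : topologicalGroupType) (R : realType) (mu : leftHaarMeasure G R).
Hypothesis hG : hausdorff_space G.
Hypothesis lcG : locally_compact [set: G].
Implicit Types (A B K O U S : set G) (x y z : G) (E : set (G * G)).
Local Notation mbl A := (measurable (A : set (borel G))).
Local Notation mbl2 E := (measurable (E : set (borel (G * G)%type))).
Local Open Scope ereal_scope.

Lemma tube_lemma E x K : open E -> compact K -> (forall y, K y -> E (x, y)) ->
  exists V W, [/\ open V, V x, open W, K `<=` W & forall a b, V a -> W b -> E (a, b)].
Proof.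
move=> oE cK xKE.
have /choice[f fP] y : exists VW : set G * set G, K y ->
    [/\ open VW.1, VW.1 x, open VW.2, VW.2 y & forall a b, VW.1 a -> VW.2 b -> E (a, b)].
  have [Ky|] := pselect (K y); last by exists (set0, set0).
  have : nbhs (x, y) E by apply: open_nbhs_nbhs; split => //; exact: xKE.
  case=> -[A B] [/= nA nB] sAB; move: nA nB; rewrite !nbhsE.
  move=> [A' [oA' A'x] sA] [B' [oB' B'y] sB]; exists (A', B') => _; split => //=.
  by move=> a b /sA Aa /sB Bb; exact: (sAB (a, b)).
have [|y Ky|D DK KD] := compact_cover_seq (D := K) (f := fun y => (f y).2) cK.
- by move=> y Ky; have [] := fP _ Ky.
- by exists y => //; have [] := fP _ Ky.
exists (\big[setI/setT]_(y <- D) (f y).1), (\bigcup_(y in [set` D]) (f y).2); split.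
- rewrite big_seq; elim/big_ind : _ => [|A B oA oB|y /DK /fP[]//]; [exact: openT|exact: openI].
- by rewrite big_seq; elim/big_ind : _ => // y /DK /fP[].
- by apply: bigcup_open => y /DK /fP[].
- by move=> y /KD[z zD fz]; exists z.
- move=> a b Va [y yD Wb]; have [_ _ _ _ +] := fP _ (DK _ yD); apply => //.
  by move: Va; rewrite -bigcap_seq; exact.
Qed.

Lemma open_section E x : open E -> open [set y | E (x, y)].
Proof.
move=> oE; apply: (@open_preimage _ _ (fun y => (x, y))) => // y.
by apply: cvg_pair; [exact: cvg_cst|exact: cvg_id].
Qed.

Lemma open_swap E : open E -> open [set p | E (p.2, p.1)].
Proof.
move=> oE; apply: (@open_preimage _ _ (fun p : G * G => (p.2, p.1))) => // p.
by apply: cvg_pair; [exact: cvg_snd|exact: cvg_fst].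
Qed.

Lemma measurable_fun_generated (T T' : pointedType) (H : set (set T)) (H' : set (set T'))
    (f : T -> T') : (forall D, H' D -> H (f @^-1` D)) ->
  measurable_fun setT (f : g_sigma_algebraType H -> g_sigma_algebraType H').
Proof.
move=> HH'; apply: (@measurability _ _ (g_sigma_algebraType H) (g_sigma_algebraType H') _ _ H') => //.
by move=> _ [D /HH' HD <-]; rewrite setTI; exact: sub_sigma_algebra.
Qed.

Lemma measurable_pairl x :
  measurable_fun setT ((fun y => (x, y)) : borel G -> borel (G * G)%type).
Proof. by apply: measurable_fun_generated => B oB; exact: open_section. Qed.

Lemma measurable_pairr x :
  measurable_fun setT ((fun y => (y, x)) : borel G -> borel (G * G)%type).
Proof.
apply: measurable_fun_generated => B oB.
by apply: (@open_section [set p | B (p.2, p.1)]); exact: open_swap.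
Qed.

Lemma mbl2_section E x : mbl2 E -> mbl [set y | E (x, y)].
Proof. by move=> mE; have := measurable_pairl x measurableT mE; rewrite setTI. Qed.

Lemma borel_measurable_swap : measurable_fun setT
  ((fun p => (p.2, p.1)) : borel (G * G)%type -> borel (G * G)%type).
Proof. by apply: measurable_fun_generated => B; exact: open_swap. Qed.

Lemma mbl2_swap E : mbl2 E -> mbl2 [set p | E (p.2, p.1)].
Proof. by move=> mE; have := borel_measurable_swap measurableT mE; rewrite setTI. Qed.

(** A compact part of the section at [x] with measure above [r] is, by the tube lemma, still
    contained in the sections at nearby points. *)
Lemma lsc_section E O (r : R) : open E -> open O ->
  open [set x | r%:E < mu ([set y | E (x, y)] `&` O)].
Proof.
move=> oE oO; rewrite openE => x /= rx.
have oEx : open ([set y | E (x, y)] `&` O) by apply: openI => //; exact: open_section.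
have [K [cK KE rK]] := haar_inner_gt oEx rx.
have [|V [W [oV Vx oW KW VWE]]] := @tube_lemma E x K oE cK; first by move=> y /KE[].
apply: (filterS _ (open_nbhs_nbhs (conj oV Vx))) => x' Vx' /=.
apply: (lt_le_trans rK); apply: le_haar.
- exact: compact_mbl.
- by apply: open_mbl; apply: openI => //; exact: open_section.
- by move=> y Ky; split; [exact: VWE (KW _ Ky)|have [] := KE _ Ky].
Qed.

Lemma measurable_lsc (f : G -> \bar R) : (forall r : R, open [set x | r%:E < f x]) ->
  measurable_fun setT (f : borel G -> \bar R).
Proof.
move=> of_; apply: (measurability _ (ErealGenOInfty.measurableE R)).
move=> /= _ [_ [a ->]] <-; rewrite setTI preimage_itvoy; apply: open_mbl; exact: of_.
Qed.

(** Dynkin's theorem, starting from open sets, whose section measures are lower semicontinuous. The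
    finite measure of [O] permits the subtraction at complements. *)
Lemma measurable_section_fin E O : mbl2 E -> open O -> mu O < +oo ->
  measurable_fun setT (fun x : borel G => mu ([set y | E (x, y)] `&` O)).
Proof.
move=> mE oO Ooo; have mO := open_mbl oO.
apply: (@dynkin_induction _ (borel (G * G)%type) (@open (G * G)%type)
  (fun E => measurable_fun setT (fun x : borel G => mu ([set y | E (x, y)] `&` O)))) => //.
- exact: openI.
- rewrite (_ : (fun _ => _) = cst (mu O)); first exact: measurable_cst.
  by apply/funext => x /=; rewrite [X in X `&` _](_ : _ = setT) ?setTI.
- by move=> E' oE'; apply: measurable_lsc => r; exact: lsc_section.
- move=> S mS IH.
  rewrite (_ : (fun _ => _) = (fun x => mu O - mu ([set y | S (x, y)] `&` O))).
    by apply: emeasurable_funB => //; exact: measurable_cst.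
  apply/funext => x; transitivity (mu (O `\` [set y | S (x, y)])).
    by congr (mu _); apply/seteqP; split => y [].
  by rewrite measureD//; [rewrite setIC|exact: mbl2_section].
- move=> F mF tF IH.
  rewrite (_ : (fun _ => _) = (fun x => \sum_(0 <= k <oo) mu ([set y | F k (x, y)] `&` O))).
    exact: ge0_emeasurable_sum.
  apply/funext => x; transitivity (mu (\bigcup_k ([set y | F k (x, y)] `&` O))).
    by congr (mu _); rewrite -setI_bigcupl.
  rewrite measure_bigcup//; first by apply: eq_eseriesl => i; exact: in_setT.
  + by move=> k _; apply: measurableI => //; exact: mbl2_section.
  + apply/trivIsetP => i j _ _ ij.
    move/trivIsetP : tF => /(_ i j I I ij); rewrite -!subset0 => FF y [[Fi _] [Fj _]].
    exact: (FF (x, y)).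
Qed.

End tonelli.

Section tonelli_fin.
Context (G : topologicalGroupType) (R : realType) (mu : leftHaarMeasure G R).
Hypothesis hG : hausdorff_space G.
Hypothesis lcG : locally_compact [set: G].
Implicit Types (A B K U S : set G) (x y z : G) (E : set (G * G)).
Local Notation mbl A := (measurable (A : set (borel G))).
Local Notation mbl2 E := (measurable (E : set (borel (G * G)%type))).
Local Open Scope ereal_scope.

Variables (O : set G) (oO : open O) (Ooo : mu O < +oo).
Let mO : mbl O := open_mbl oO.
Let nu := mfrestr mO Ooo.

Let measurable_nu E : mbl2 E ->
  measurable_fun setT (fun x : borel G => nu [set y | E (x, y)]).
Proof. by move=> mE; exact: measurable_section_fin. Qed.

Let nu_fin A : mbl A -> nu A \is a fin_num.
Proof. exact: fin_num_measure. Qed.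

(* The inner regularity of the open sets [{x | q < nu (E_x)}], for rational [q],
   reduces [E] to countably many open rectangles. *)
Lemma open_countable_rectangles E : open E -> exists V W : rat * nat * nat -> set G,
  [/\ forall i, open (V i), forall i, open (W i),
      forall i a b, V i a -> W i b -> E (a, b) &
      nu.-negligible [set x | nu [set y | E (x, y)] !=
                              nu [set y | exists2 i, V i x & W i y]]].
Proof.
move=> oE; pose EO := [set p : G * G | E p /\ O p.2].
have oEO : open EO.
  rewrite (_ : EO = E `&` snd @^-1` O)//; apply: openI => //.
  by apply: open_preimage => // p; exact: cvg_snd.
have nuE x : nu [set y | E (x, y)] = mu [set y | EO (x, y)] by [].
pose Wq (q : rat) := [set x | (ratr q)%:E < nu [set y | E (x, y)]] `&` O.
have oW q : open (Wq q) by apply: openI => //; exact: lsc_section.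
have Wfin q : mu (Wq q) < +oo.
  apply: le_lt_trans Ooo; apply: le_haar; [exact: open_mbl|exact: mO|by move=> ? []].
have /choice[P PP] (q : rat) : exists P : nat -> set G, [/\ forall n, compact (P n),
    forall n, P n `<=` Wq q & mu (Wq q `\` \bigcup_n P n) = 0].
  have [_ [P cP ->] [PW W0]] := haar_open_sigma_compact hG (oW q) (Wfin q).
  by exists P; split => // n; apply: subset_trans PW; exact: bigcup_sup.
pose rect (q : rat) (r : set G * set G) := [/\ open r.1, open r.2,
  forall a b, r.1 a -> r.2 b -> EO (a, b) & (ratr q)%:E < nu r.2].
have /choice[s sP] (qn : rat * nat) : exists s : seq (set G * set G),
    (forall r, r \in s -> rect qn.1 r) /\
    forall x, P qn.1 qn.2 x -> exists2 r, r \in s & r.1 x.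
  have [cP PW _] := PP qn.1.
  have [|x Px|s sR sP] := compact_cover_seq (D := rect qn.1) (f := fst) (cP qn.2).
  - by move=> r [].
  - have [qx Ox] := PW _ _ Px.
    have [K [cK KE qK]] : exists K, [/\ compact K, K `<=` [set y | EO (x, y)] &
        (ratr qn.1)%:E < mu K] by apply: haar_inner_gt; first exact: open_section.
    have [V [W [oV Vx oW' KW VWE]]] := tube_lemma oEO cK KE.
    exists (V, W) => //; split => //=; apply: (lt_le_trans qK).
    apply: le_haar; [exact: compact_mbl|by apply: measurableI => //; exact: open_mbl|].
    by move=> y Ky; split; [exact: KW|have [] := KE _ Ky].
  - by exists s.
(* Positions beyond the end of a list yield the empty rectangle, so that one countable index type
   serves for all the lists. *)
pose r (i : rat * nat * nat) := nth (set0, set0) (s (i.1.1, i.1.2)) i.2.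
have rP i : (r i \in s (i.1.1, i.1.2)) \/ r i = (set0, set0).
  rewrite /r; have [/mem_nth|/(nth_default (set0, set0))] := ltnP i.2 (size (s (i.1.1, i.1.2))).
    by left.
  by right.
exists (fun i => (r i).1), (fun i => (r i).2); split.
- by move=> i; have [/(sP _).1[]//|->] := rP i; exact: open0.
- by move=> i; have [/(sP _).1[]//|->] := rP i; exact: open0.
- by move=> i a b; have [/(sP _).1[_ _ EOr _] /EOr /[apply] -[]|->] := rP i.
have mWP q : mbl (Wq q `\` \bigcup_n P q n).
  apply: measurableD; first exact: open_mbl.
  by apply: bigcupT_measurable => n; apply: compact_mbl => //; have [+ _ _] := PP q; exact.
have mN : mbl (\bigcup_q (Wq q `\` \bigcup_n P q n)) by exact: bigcupT_measurable_rat.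
have N0 : mu (\bigcup_q (Wq q `\` \bigcup_n P q n)) = 0.
  apply: measure_negligible => //.
  have -> : \bigcup_q (Wq q `\` \bigcup_n P q n) = \bigcup_k
      (if unpickle k is Some q then Wq q `\` \bigcup_n P q n else set0).
    apply/seteqP; split => [x [q _ xq]|x [k _]].
      by exists (pickle q); [exact: I|rewrite pickleK; exact: xq].
    by case: unpickle => // q xq; exists q.
  apply: negligible_bigcup => k; case: unpickle => [q|]; last exact: negligible_set0.
  by apply/negligibleP => //; have [] := PP q.
have nuN : nu.-negligible ((~` O) `|` \bigcup_q (Wq q `\` \bigcup_n P q n)).
  apply: negligibleU; apply/negligibleP => //.
  - exact: measurableC.
  - by have : mu (~` O `&` O) = 0 by rewrite setICl measure0.
  - by apply: (haar_null_sub _ mN) N0; [exact: measurableI|exact: subIsetl].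
apply: negligibleS nuN => x /= /eqP nE; apply: contrapT => /not_orP[/contrapT Ox nN].
have mE1 : mbl [set y | E (x, y)] by apply: open_mbl; exact: open_section.
have mE2 : mbl [set y | exists2 i, (r i).1 x & (r i).2 y].
  rewrite (_ : [set _ | _] = \bigcup_(i in [set i | (r i).1 x]) (r i).2).
    apply: open_mbl; apply: bigcup_open => i _.
    by have [/(sP _).1[]//|->] := rP i; exact: open0.
  by apply/seteqP; split => y [i Vi Wi]; exists i.
apply: nE; apply/eqP; rewrite eq_le; apply/andP; split; last first.
  apply: le_measure; rewrite ?inE// => y [i Vi Wi]; move: Vi Wi.
  by have [/(sP _).1[_ _ EOr _] /EOr /[apply] -[]|->] := rP i.
(* A rational [q] strictly between the two measures puts [x] in [Wq q], hence in some [P q n]; the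
   rectangle chosen over [x] then has a fibre of measure above [q] inside the union. *)
rewrite leNgt; apply/negP => lt.
have [q /andP[q1 q2]] : exists q : rat,
    nu [set y | exists2 i, (r i).1 x & (r i).2 y] < (ratr q)%:E < nu [set y | E (x, y)].
  move: lt; rewrite -(fineK (nu_fin mE1)) -(fineK (nu_fin mE2)) lte_fin.
  by move=> /rat_in_itvoo[q]; rewrite in_itv/= => qq; exists q; rewrite !lte_fin.
have [n _ Pqn] : (\bigcup_n P q n) x.
  by apply: contrapT => nP; apply: nN; exists q.
have [rr rs rx] := (sP (q, n)).2 _ Pqn.
have [_ r2 rE qr] := (sP (q, n)).1 _ rs; suff : (ratr q)%:E < nu [set y | exists2 i, (r i).1 x & (r i).2 y].
  by move=> /(lt_trans q1); rewrite ltxx.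
apply: (lt_le_trans qr); apply: le_measure; rewrite ?inE//; first exact: open_mbl.
move=> y ry; exists (q, n, index rr (s (q, n))); by rewrite /r /= nth_index.
Qed.

(** The union [E'] of the rectangles belongs to the product sigma-algebra, where the usual Tonelli
    theorem holds. It fills almost every section of [E] in one direction but is only known to be
    contained in [E] in the other, whence an inequality. *)
Lemma open_section_fubini_le E : open E ->
  \int[nu]_x nu [set y | E (x, y)] <= \int[nu]_y nu [set x | E (x, y)].
Proof.
move=> oE; have [V [W [oV oW VWE nE]]] := open_countable_rectangles oE.
have mE : mbl2 E by exact: sub_sigma_algebra.
pose E' : set (borel G * borel G) := \bigcup_i (V i `*` W i).
have mE' : measurable E'.
  apply: countable_bigcupT_measurable => // i.
  by apply: measurableX; apply: open_mbl; [exact: oV|exact: oW].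
have xE' x : xsection E' x = [set y | exists2 i, V i x & W i y].
  by apply/seteqP; split => y; rewrite /xsection /= inE => -[j]; [move=> _ []|]; exists j.
have yE' y : ysection E' y = [set x | exists2 i, V i x & W i y].
  by apply/seteqP; split => x; rewrite /ysection /= inE => -[j]; [move=> _ []|]; exists j.
have -> : \int[nu]_x nu [set y | E (x, y)] = \int[nu]_x (nu \o xsection E') x.
  apply: ge0_ae_eq_integral => //; [exact: measurable_nu|exact: measurable_fun_xsection|].
  case: nE => N [mN N0 NE]; exists N; split => // x /= nE; apply: NE => /=.
  by apply/eqP => nEE; apply: nE => _; rewrite xE'.
have -> : \int[nu]_x (nu \o xsection E') x = \int[nu]_y (nu \o ysection E') y.
  rewrite -indic_fubini_tonelli_FE// -indic_fubini_tonelli_GE//.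
  exact: indic_fubini_tonelli.
apply: ge0_le_integral => //; [exact: measurable_fun_ysection| |].
  by apply: (measurable_nu (E := [set p | E (p.2, p.1)])); exact: mbl2_swap.
move=> y _ /=; rewrite yE'; apply: le_measure; rewrite ?inE//.
- rewrite (_ : [set _ | _] = \bigcup_(i in [set i | W i y]) V i).
    by apply: open_mbl; apply: bigcup_open.
  by apply/seteqP; split => x [i Vi Wi]; exists i.
- by apply: (mbl2_section (E := [set p | E (p.2, p.1)])); exact: mbl2_swap.
- by move=> x [i Vi Wi]; exact: VWE Vi Wi.
Qed.

(** For an open set, apply the inequality to it and to its mirror image. Dynkin's theorem does the
    rest, all the integrals being finite. *)
Lemma section_fubini E : mbl2 E ->
  \int[nu]_x nu [set y | E (x, y)] = \int[nu]_y nu [set x | E (x, y)].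
Proof.
have mnu2 D : mbl2 D -> measurable_fun setT (fun y : borel G => nu [set x | D (x, y)]).
  by move=> mD; apply: (measurable_nu (E := [set p | D (p.2, p.1)])); exact: mbl2_swap.
have ms2 D y : mbl2 D -> mbl [set x | D (x, y)].
  by move=> mD; apply: (mbl2_section (E := [set p | D (p.2, p.1)])); exact: mbl2_swap.
have nuT : nu setT \is a fin_num by exact: nu_fin.
have intT : \int[nu]_x nu setT \is a fin_num.
  by rewrite integral_cst// fin_numM.
move: E; apply: (@dynkin_induction _ (borel (G * G)%type) (@open (G * G)%type)) => //=.
- exact: openI.
- move=> E oE; apply/eqP; rewrite eq_le open_section_fubini_le//=.
  exact: (open_section_fubini_le (open_swap oE)).
- move=> E mE IH.
  have mC : mbl2 (~` E) by exact: measurableC.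
  have C1 x : nu [set y | (~` E) (x, y)] + nu [set y | E (x, y)] = nu setT.
    rewrite -measureU//; [|exact: (mbl2_section (E := ~` E))|exact: mbl2_section|exact: (setICl [set y | E (x, y)])].
    by apply: congr1; exact: setUCl.
  have C2 y : nu [set x | (~` E) (x, y)] + nu [set x | E (x, y)] = nu setT.
    rewrite -measureU//; [|exact: (ms2 (~` E))|exact: ms2|exact: (setICl [set x | E (x, y)])].
    by apply: congr1; exact: setUCl.
  have I1 : \int[nu]_x nu [set y | (~` E) (x, y)] + \int[nu]_x nu [set y | E (x, y)]
      = \int[nu]_x nu setT.
    rewrite -ge0_integralD//; [|exact: measurable_nu|exact: measurable_nu].
    by apply: eq_integral => x _; exact: C1.
  have I2 : \int[nu]_y nu [set x | (~` E) (x, y)] + \int[nu]_y nu [set x | E (x, y)]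
      = \int[nu]_x nu setT.
    rewrite -ge0_integralD//; [|exact: mnu2|exact: mnu2].
    by apply: eq_integral => x _; exact: C2.
  have Ef : \int[nu]_y nu [set x | E (x, y)] \is a fin_num.
    move: intT; rewrite -I2 fin_numD => /andP[] //.
  by rewrite -[LHS](addeK _ Ef) -{1}IH I1 -I2 addeK.
- move=> F mF tF IH.
  have F1 x : nu [set y | (\bigcup_k F k) (x, y)] = \sum_(k <oo) nu [set y | F k (x, y)].
    transitivity (nu (\bigcup_k [set y | F k (x, y)])) => //.
    apply: etrans (@measure_bigcup _ _ _ nu setT _ _ _) _; last first.
    - by apply: eq_eseriesl => i; exact: in_setT.
    - apply/trivIsetP => i j _ _ ij.
      move/trivIsetP : tF => /(_ i j I I ij); rewrite -!subset0 => FF y [Fi Fj].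
      exact: (FF (x, y)).
    - by move=> k _; exact: mbl2_section.
  have F2 y : nu [set x | (\bigcup_k F k) (x, y)] = \sum_(k <oo) nu [set x | F k (x, y)].
    transitivity (nu (\bigcup_k [set x | F k (x, y)])) => //.
    apply: etrans (@measure_bigcup _ _ _ nu setT _ _ _) _; last first.
    - by apply: eq_eseriesl => i; exact: in_setT.
    - apply/trivIsetP => i j _ _ ij.
      move/trivIsetP : tF => /(_ i j I I ij); rewrite -!subset0 => FF x [Fi Fj].
      exact: (FF (x, y)).
    - by move=> k _; exact: ms2.
  under eq_integral do rewrite F1; under [RHS]eq_integral do rewrite F2.
  rewrite !integral_nneseries//; first exact: eq_eseriesr.
    by move=> n; exact: mnu2.
  by move=> n; exact: measurable_nu.
Qed.

End tonelli_fin.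

(** * Iterated integrals as measures on the Borel sets of the square *)

Section slice_kernel.
Context (G : topologicalGroupType) (R : realType) (mu : leftHaarMeasure G R).
Context (O : set G) (oO : open O) (Ooo : (mu O < +oo)%E).
Local Notation mbl2 E := (measurable (E : set (borel (G * G)%type))).
Local Open Scope ereal_scope.
Let mO : measurable (O : set (borel G)) := open_mbl oO.
Local Notation nu := (mfrestr mO Ooo).
Variable phi : G -> G -> G * G.
Hypothesis mphi : forall x, measurable_fun setT (phi x : borel G -> borel (G * G)%type).

(** The image of Haar measure on [O] under [phi x]. With [phi x y] equal to [(x, y)] or to [(y, x)],
    both orders of integration become composed kernels. The hypotheses are arguments so that the
    measure structure can be declared on [slice] itself. *)
Definition slice of (forall x, measurable_fun setT (phi x : borel G -> borel (G * G)%type))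
    & open O & mu O < +oo :=
  fun (p : unit * borel G) (E : set (borel (G * G)%type)) => mu ([set y | E (phi p.2 y)] `&` O).
Local Notation k := (slice mphi oO Ooo).

Let mslice x E : mbl2 E -> measurable ([set y | E (phi x y)] : set (borel G)).
Proof. by move=> mE; have := mphi x measurableT mE; rewrite setTI. Qed.

Let k0 p : k p set0 = 0.
Proof. by rewrite /slice set0I measure0. Qed.

Let k_ge0 p E : 0 <= k p E.
Proof. exact: measure_ge0. Qed.

Let k_sigma_additive p : semi_sigma_additive (k p).
Proof.
move=> F mF tF mUF.
apply: (@measure_semi_sigma_additive _ _ _ nu (fun n => [set y | F n (phi p.2 y)])).
- by move=> n; exact: mslice.
- apply/trivIsetP => i j _ _ ij.
  move/trivIsetP : tF => /(_ i j I I ij); rewrite -!subset0 => FF y [Fi Fj].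
  exact: (FF (phi p.2 y)).
- exact: (mslice p.2 mUF).
Qed.

HB.instance Definition _ p := isMeasure.Build _ _ _ (k p) (k0 p) (k_ge0 p)
  (@k_sigma_additive p).

Definition slicek : unit * borel G -> {measure set (borel (G * G)%type) -> \bar R} := k.

Hypothesis mk : forall E, mbl2 E ->
  measurable_fun setT (fun x : borel G => mu ([set y | E (phi x y)] `&` O)).

Definition slice_ker of (forall E, mbl2 E -> measurable_fun setT
  (fun x : borel G => mu ([set y | E (phi x y)] `&` O))) := slicek.
Definition cst_ker of open O & mu O < +oo :=
  fun _ : unit => (nu : {measure set (borel G) -> \bar R}).

Let measurable_slice_ker E : mbl2 E -> measurable_fun setT ((slice_ker mk) ^~ E).
Proof.
move=> mE; apply: (measurableT_comp (mk mE) (f := fun x : borel G => _)).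
exact: measurable_snd.
Qed.

HB.instance Definition _ := isKernel.Build _ _ _ _ R (slice_ker mk) measurable_slice_ker.

Let slice_ker_uub : measure_fam_uub (slice_ker mk).
Proof.
exists (fine (mu O) + 1)%R => p; rewrite /slice_ker /slicek /= /slice.
rewrite [X in mu (X `&` _)](_ : _ = setT) ?setTI//.
by rewrite EFinD fineK ?ge0_fin_numE// lteDl// ?lte01// ge0_fin_numE.
Qed.

HB.instance Definition _ := Kernel_isFinite.Build _ _ _ _ R (slice_ker mk) slice_ker_uub.

Let measurable_cst_ker E : measurable E -> measurable_fun setT ((cst_ker oO Ooo) ^~ E).
Proof. by move=> mE; exact: measurable_cst. Qed.

HB.instance Definition _ := isKernel.Build _ _ _ _ R (cst_ker oO Ooo) measurable_cst_ker.

Let cst_ker_uub : measure_fam_uub (cst_ker oO Ooo).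
Proof.
exists (fine (mu O) + 1)%R => p; rewrite /cst_ker /= /mfrestr /mrestr setTI.
by rewrite EFinD fineK ?ge0_fin_numE// lteDl// ?lte01// ge0_fin_numE.
Qed.

HB.instance Definition _ := Kernel_isFinite.Build _ _ _ _ R (cst_ker oO Ooo) cst_ker_uub.

Lemma integral_slice (f : borel (G * G)%type -> \bar R) :
  measurable_fun setT f -> (forall p, 0 <= f p) ->
  \int[kcomp (cst_ker oO Ooo) (slice_ker mk) tt]_p f p = \int[nu]_x \int[nu]_y f (phi x y).
Proof.
move=> mf f0; rewrite integral_kcomp//; apply: eq_integral => x _.
rewrite -[RHS](ge0_integral_pushforward (mphi x) nu (D := setT))//.
Qed.

Lemma measurable_integral_slice (f : borel (G * G)%type -> \bar R) :
  measurable_fun setT f -> (forall p, 0 <= f p) ->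
  measurable_fun setT (fun x : borel G => \int[nu]_y f (phi x y)).
Proof.
move=> mf f0.
rewrite (_ : (fun _ => _) = (fun x : borel G => \int[slicek (tt, x)]_p f p)).
  by apply: measurable_fun_integral_kernel => // E mE; exact: mk.
apply/funext => x; rewrite -[LHS](ge0_integral_pushforward (mphi x) nu (D := setT))//.
Qed.

End slice_kernel.

Section tonelli.
Context (G : topologicalGroupType) (R : realType) (mu : leftHaarMeasure G R).
Hypothesis hG : hausdorff_space G.
Hypothesis lcG : locally_compact [set: G].
Implicit Types (A B K O U S : set G) (x y z : G) (E : set (G * G)).
Implicit Type f : borel (G * G)%type -> \bar R.
Local Notation mbl A := (measurable (A : set (borel G))).
Local Notation mbl2 E := (measurable (E : set (borel (G * G)%type))).
Local Open Scope ereal_scope.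

Lemma integral_mfrestr A (mA : mbl A) (Aoo : mu A < +oo) (f : borel G -> \bar R) :
  measurable_fun setT f -> (forall x, 0 <= f x) ->
  \int[mfrestr mA Aoo]_x f x = \int[mu]_(x in A) f x.
Proof.
move=> mf f0; rewrite (ge0_negligible_integral (N := ~` (A : set (borel G))))//; last 2 first.
- exact: measurableC.
- by have : mu (~` A `&` A) = 0 by rewrite setICl measure0.
rewrite setTD setCK; apply: eq_measure_integral => B mB BA.
exact: (congr1 mu (setIidl BA)).
Qed.

Lemma measurable_fun_pairl f x : measurable_fun setT f ->
  measurable_fun setT (fun y : borel G => f (x, y)).
Proof. by move=> mf; exact: (measurableT_comp mf (measurable_pairl x)). Qed.

Lemma measurable_fun_pairr f y : measurable_fun setT f ->
  measurable_fun setT (fun x : borel G => f (x, y)).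
Proof. by move=> mf; exact: (measurableT_comp mf (measurable_pairr y)). Qed.

Section finite.
Variables (O : set G) (oO : open O) (Ooo : mu O < +oo).

Lemma measurable_integral_section_fin f : measurable_fun setT f -> (forall p, 0 <= f p) ->
  measurable_fun setT (fun x : borel G => \int[mu]_(y in O) f (x, y)).
Proof.
move=> mf f0.
rewrite (_ : (fun _ => _) = (fun x : borel G => \int[mfrestr (open_mbl oO) Ooo]_y f (x, y))).
  apply: (measurable_integral_slice oO Ooo (@measurable_pairl G)) => //.
  by move=> E mE; exact: measurable_section_fin.
by apply/funext => x; rewrite integral_mfrestr//; exact: measurable_fun_pairl.
Qed.

Lemma tonelli_fin f : measurable_fun setT f -> (forall p, 0 <= f p) ->
  \int[mu]_(x in O) \int[mu]_(y in O) f (x, y) =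
  \int[mu]_(y in O) \int[mu]_(x in O) f (x, y).
Proof.
move=> mf f0; pose nu := mfrestr (open_mbl oO) Ooo.
have mfs : measurable_fun setT (fun p : borel (G * G)%type => f (p.2, p.1)).
  exact: (measurableT_comp mf (@borel_measurable_swap G)).
have m1 E : mbl2 E -> measurable_fun setT (fun x : borel G => mu ([set y | E (x, y)] `&` O)).
  by move=> mE; exact: measurable_section_fin.
have m2 E : mbl2 E -> measurable_fun setT (fun y : borel G => mu ([set x | E (x, y)] `&` O)).
  by move=> mE; apply: (@measurable_section_fin _ _ mu hG [set p | E (p.2, p.1)]) => //; exact: mbl2_swap.
have -> : \int[mu]_(x in O) \int[mu]_(y in O) f (x, y) = \int[nu]_x \int[nu]_y f (x, y).
  rewrite -(integral_mfrestr (open_mbl oO) Ooo); [|exact: measurable_integral_section_fin|by move=> ?; exact: integral_ge0].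
  by apply: eq_integral => x _; rewrite integral_mfrestr//; exact: measurable_fun_pairl.
have -> : \int[mu]_(y in O) \int[mu]_(x in O) f (x, y) = \int[nu]_y \int[nu]_x f (x, y).
  rewrite -(integral_mfrestr (open_mbl oO) Ooo); last by move=> ?; exact: integral_ge0.
    by apply: eq_integral => x _; rewrite integral_mfrestr//; exact: measurable_fun_pairr.
  exact: (measurable_integral_section_fin mfs).
rewrite -(integral_slice oO Ooo (@measurable_pairl G) m1)//.
rewrite -(integral_slice oO Ooo (@measurable_pairr G) m2)//.
(* Both sides are now integrals against measures on the Borel sets of [G * G], and these measures
   agree on sets. *)
by apply: eq_measure_integral => E mE _; exact: (section_fubini hG oO Ooo mE).
Qed.

End finite.

Section exhaustion.
Variables (U : nat -> set G) (oU : forall n, open (U n)) (Uoo : forall n, mu (U n) < +oo)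
  (ndU : nondecreasing_seq U).

Lemma tonelli_cvg f : measurable_fun setT f -> (forall p, 0 <= f p) ->
  (forall x y, f (x, y) != 0 -> (\bigcup_n U n) x /\ (\bigcup_n U n) y) ->
  measurable_fun setT (fun x : borel G => \int[mu]_y f (x, y)) /\
  \int[mu]_(x in U n) \int[mu]_(y in U n) f (x, y) @[n --> \oo] -->
    \int[mu]_x \int[mu]_y f (x, y).
Proof.
move=> mf f0 fU; have mU n := open_mbl (oU n).
pose h n x := \int[mu]_(y in U n) f (x, y).
have ndh x : nondecreasing_seq (h ^~ x).
  apply: ge0_nondecreasing_set_nondecreasing_integral => //.
  by move=> n; apply: measurable_funTS; exact: measurable_fun_pairl.
have hE x : \int[mu]_y f (x, y) = \int[mu]_(y in \bigcup_n U n) f (x, y).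
  rewrite [RHS]integral_mkcond; apply: eq_integral => y _; rewrite patchE.
  by case: ifPn => // yU; apply/eqP; apply: contraNT yU => /fU[_ ?]; exact: mem_set.
have hcvg x : h n x @[n --> \oo] --> \int[mu]_y f (x, y).
  rewrite hE; apply: ge0_nondecreasing_set_cvg_integral => //.
  by move=> n; apply: measurable_funTS; exact: measurable_fun_pairl.
have mh n : measurable_fun setT (h n : borel G -> \bar R).
  exact: measurable_integral_section_fin.
have h0 n x : 0 <= h n x by exact: integral_ge0.
split; first by apply: (@emeasurable_fun_cvg _ (borel G) R setT h) => // x _; exact: hcvg.
(* Cutting off in [x] as well turns integrals over growing sets into integrals over [G] of an
   increasing sequence, ready for monotone convergence. *)
pose g n := h n \_ (U n).
have gh n x : g n x <= h n x by rewrite /g patchE; case: ifPn.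
have g_lim x : limn (g ^~ x) = \int[mu]_y f (x, y).
  apply/cvg_lim => //.
  have [[N _ UNx]|nU] := pselect ((\bigcup_n U n) x); last first.
    have fx0 y : f (x, y) = 0 by apply/eqP; apply: contrapT => /negP /fU[].
    rewrite (_ : g ^~ x = cst 0); first by rewrite (eq_integral (cst 0))// integral0; exact: cvg_cst.
    apply/funext => n; apply/eqP; rewrite eq_le erestrict_ge0 ?andbT//.
    by rewrite (le_trans (gh _ _))// /h (eq_integral (cst 0))// integral0.
  apply: cvg_trans (hcvg x); apply: near_eq_cvg.
  near=> n; rewrite /g patchE mem_set//.
  have : (N <= n)%N by near: n; exists N.
  by move=> /ndU /subsetPset; exact.
under eq_fun do rewrite integral_mkcond.
have -> : \int[mu]_x \int[mu]_y f (x, y) = \int[mu]_x limn (g ^~ x).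
  by apply: eq_integral => x _; rewrite g_lim.
apply: cvg_monotone_convergence => //.
- move=> n; apply: (measurable_restrictT (h n : borel G -> \bar R) (mU n)).1.
  exact: measurable_funTS (mh n).
- by move=> n x _; exact: erestrict_ge0.
- move=> x _ m n mn; rewrite /g !patchE; case: ifPn => [Um|_].
    by rewrite mem_set; [exact: ndh|move/subsetPset : (ndU mn); apply; exact: set_mem].
  by case: ifPn.
Unshelve. all: by end_near. Qed.

End exhaustion.

Lemma sigma_compact_exhaustion S : sigma_compact S -> exists U : nat -> set G,
  [/\ forall n, open (U n), forall n, mu (U n) < +oo, nondecreasing_seq U &
      S `<=` \bigcup_n U n].
Proof.
move=> [A cA ->].
have /choice[V VP] n : exists V : set G, [/\ open V, A n `<=` V & mu V < +oo].
  have [V [Q [oV AV cQ VQ _]]] := compact_open_nbhs lcG (cA n) openT I.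
  exists V; split => //; apply: (le_lt_trans (le_haar mu _ _ VQ)); [exact: open_mbl|exact: compact_mbl|].
  exact: haar_compact.
exists (fun n => \big[setU/set0]_(k < n.+1) V k); split.
- by move=> n; elim/big_ind : _ => [|? ? ? ?|k _]; [exact: open0|exact: openU|have [] := VP k].
- move=> n; apply: (le_lt_trans (Boole_inequality _ _)).
    by move=> k _; apply: open_mbl; have [] := VP k.
  by apply/lte_sum_pinfty => k _; have [] := VP k.
- by move=> i j ij; exact/subsetPset/subset_bigsetU.
- move=> x [n _ Anx]; exists n => //; rewrite big_ord_recr /=; right.
  by have [_ + _] := VP n; exact.
Qed.

(** Both iterated integrals are limits of the integrals over the squares of an increasing sequence
    of open sets [U n] of finite measure that covers [S]. *)
Theorem radon_tonelli S f : sigma_compact S -> measurable_fun setT f -> (forall p, 0 <= f p) ->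
  (forall x y, f (x, y) != 0 -> S x /\ S y) ->
  [/\ measurable_fun setT (fun x : borel G => \int[mu]_y f (x, y)),
      measurable_fun setT (fun y : borel G => \int[mu]_x f (x, y)) &
      \int[mu]_x \int[mu]_y f (x, y) = \int[mu]_y \int[mu]_x f (x, y)].
Proof.
move=> sS mf f0 fS; have [U [oU Uoo ndU SU]] := sigma_compact_exhaustion sS.
have mfs : measurable_fun setT (fun p : borel (G * G)%type => f (p.2, p.1)).
  exact: (measurableT_comp mf (@borel_measurable_swap G)).
have [|m1 c1] := tonelli_cvg oU Uoo ndU mf f0; first by move=> x y /fS[/SU ? /SU].
have [//||m2 c2] := tonelli_cvg oU Uoo ndU mfs; first by move=> x y /fS[/SU ? /SU].
split; [exact: m1|exact: m2|].
apply: (cvg_unique _ c1 _); first exact: ereal_hausdorff.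
rewrite (_ : (fun n => _) = (fun n => \int[mu]_(x in U n) \int[mu]_(y in U n) f (y, x))).
  exact: c2.
by apply/funext => n; rewrite tonelli_fin.
Qed.

End tonelli.

Lemma measurable_funV_gt0 d (T : measurableType d) (R : realType) (u : T -> R) :
  (forall x, 0 < u x) -> measurable_fun setT u -> measurable_fun setT (fun x => (u x)^-1).
Proof.
move=> u0 mu; apply: (measurability _ (RGenOInfty.measurableE R)) => /= _ [_ [a ->]] <-.
rewrite setTI; have [a0|a0] := leP a 0.
  rewrite (_ : _ @^-1` _ = setT)//; apply/seteqP; split => x //= _.
  by rewrite in_itv /= andbT (le_lt_trans a0)// invr_gt0.
rewrite (_ : _ @^-1` _ = u @^-1` `]-oo, a^-1[).
  by rewrite -[X in measurable X]setTI; exact: mu.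
apply/seteqP; split => x /=; rewrite !in_itv /= andbT.
  by move=> ax; rewrite -[ltLHS]invrK ltf_pV2// posrE ?invr_gt0.
by move=> ua; rewrite -[ltLHS]invrK ltf_pV2// posrE ?invr_gt0.
Qed.

(** * The modular function *)

Section modular.
Context (G : topologicalGroupType) (R : realType) (mu : leftHaarMeasure G R).
Hypothesis hG : hausdorff_space G.
Hypothesis lcG : locally_compact [set: G].
Implicit Types (A B K O U S : set G) (x y z : G) (E : set (G * G)).
Implicit Type h : borel G -> \bar R.
Local Notation mbl A := (measurable (A : set (borel G))).
Local Open Scope ereal_scope.

Definition sigma_supp h := exists2 S, sigma_compact S & forall x, h x != 0 -> S x.

Lemma measurable_fun_continuous2 (f : G * G -> G) : continuous f ->
  measurable_fun setT (f : borel (G * G)%type -> borel G).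
Proof. by move=> cf; apply: measurable_fun_generated => B; exact: open_preimage. Qed.

Lemma continuous_mul21 : continuous (fun p : G * G => p.2 * p.1)%g.
Proof. by apply: continuous_mulg => p; [exact: cvg_snd|exact: cvg_fst]. Qed.

Lemma continuous_div21 : continuous (fun p : G * G => p.2^-1 * p.1)%g.
Proof.
apply: continuous_mulg; first by apply: continuous_invg => p; exact: cvg_snd.
by move=> p; exact: cvg_fst.
Qed.

Lemma continuous_shear : continuous (fun p : G * G => (p.2^-1 * p.1, p.2)%g).
Proof.
by move=> p; apply: cvg_pair; [exact: continuous_div21|exact: cvg_snd].
Qed.

Section translate_measure.
Variables (V Q : set G) (oV : open V) (cQ : compact Q) (VQ : V `<=` Q) (v : G) (Vv : V v).

Let D x := mu [set y | V (y * x)%g].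

Let D_fin x : D x \is a fin_num.
Proof.
rewrite ge0_fin_numE//; apply: (@le_lt_trans _ _ (mu (mulset Q [set x^-1]%g))).
  apply: le_haar.
  - by apply: open_mbl; exact: open_mulr.
  - by apply: compact_mbl => //; apply: compact_mulset => //; exact: compact_set1.
  - by move=> y /VQ Qyx; exists (y * x)%g => //; exists (x^-1)%g => //; rewrite mulgK.
by apply: haar_compact; apply: compact_mulset => //; exact: compact_set1.
Qed.

Let D_gt0 x : 0 < D x.
Proof.
by apply: (@haar_open_gt0 _ _ mu hG _ (v * x^-1)%g) => /=; [exact: open_mulr|rewrite mulgVK].
Qed.

Lemma right_translate_fin_gt0 x : (0 < fine (D x))%R /\ (fine (D x))%:E = D x.
Proof. by split; [rewrite fine_gt0// D_gt0 -ge0_fin_numE// D_fin|rewrite fineK]. Qed.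

Lemma measurable_right_translate : measurable_fun setT (fun x : borel G => fine (D x)).
Proof.
apply/measurable_EFinP; rewrite (_ : _ \o _ = D); last first.
  by apply/funext => x /=; rewrite fineK.
apply: measurable_lsc => r; rewrite (_ : [set _ | _] = [set x | r%:E <
    mu ([set y | [set p : G * G | V (p.2 * p.1)%g] (x, y)] `&` setT)]).
  apply: lsc_section => //; last exact: openT.
  by apply: open_preimage => //; exact: continuous_mul21.
by apply/seteqP; split => x /=; rewrite setIT.
Qed.

(** Write [h x] as the integral over [y] of [h x / D x] times the indicator of [y * x] in [V].
    Exchanging the integrals twice, with the left translations [x := y^-1 * x] and then
    [y := x * y], separates the variables. The modular function is obtained from this formula rather
    than from the uniqueness of Haar measure. *)
Lemma integral_inv_translate h : measurable_fun setT h -> (forall x, 0 <= h x) ->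
  sigma_supp h ->
  \int[mu]_x h x = mu V * \int[mu]_y (h (y^-1)%g * ((fine (D (y^-1)%g))^-1)%:E).
Proof.
move=> mh h0 [S0 sS0 hS0].
have [S [S0S sS [S1 SM SV]]] := sigma_compact_subgroup (sigma_compactU sS0 (compact_sigma_compact cQ)).
have hS x : h x != 0 -> S x by move=> /hS0 ?; apply: S0S; left.
have VS x : V x -> S x by move=> /VQ ?; apply: S0S; right.
pose k (p : borel (G * G)%type) := h p.1 * ((fine (D p.1))^-1 * \1_V (p.2 * p.1)%g)%:E.
have mfst : measurable_fun setT (fst : borel (G * G)%type -> borel G).
  by apply: measurable_fun_continuous2 => p; exact: cvg_fst.
have mk : measurable_fun setT k.
  apply: emeasurable_funM.
    exact: (measurableT_comp mh mfst).
  apply/measurable_EFinP; apply: measurable_funM.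
    apply: measurable_funV_gt0 => [p|]; first by have [] := right_translate_fin_gt0 p.1.
    exact: (measurableT_comp measurable_right_translate mfst).
  apply: (measurableT_comp (f := (\1_V : borel G -> R))).
    by apply: measurable_indic; exact: open_mbl.
  exact: measurable_fun_continuous2 continuous_mul21.
have k0 p : 0 <= k p.
  apply: mule_ge0 => //; rewrite lee_fin mulr_ge0 ?invr_ge0//.
  by have [/ltW] := right_translate_fin_gt0 p.1.
have kS x y : k (x, y) != 0 -> S x /\ S y.
  rewrite /k /= mule_eq0 negb_or => /andP[/hS Sx].
  rewrite eqe mulf_eq0 negb_or indicE => /andP[_].
  rewrite pnatr_eq0 eqb0 negbK => /set_mem /VS Syx; split => //.
  by rewrite -(mulgK x y); apply: SM => //; exact: SV.
have kint x : \int[mu]_y k (x, y) = h x.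
  rewrite /k /=.
  have mV : measurable_fun setT (fun y : borel G => (\1_V (y * x)%g : R)%:E).
    apply/measurable_EFinP; apply: (measurableT_comp (f := (\1_V : borel G -> R))).
      by apply: measurable_indic; exact: open_mbl.
    exact: measurable_mulgr.
  under eq_integral do rewrite EFinM muleA.
  rewrite ge0_integralZl//; last first.
    apply: mule_ge0 => //; rewrite lee_fin invr_ge0.
    by have [/ltW] := right_translate_fin_gt0 x.
  rewrite (eq_integral (fun y : borel G => (\1_[set y | V (y * x)%g] y)%:E)); last first.
    by move=> y _; rewrite !indicE; congr (_%:R%:E); congr nat_of_bool; apply/idP/idP; rewrite !inE.
  rewrite integral_indic//; last by apply: open_mbl; exact: open_mulr.
  have [D0 DE] := right_translate_fin_gt0 x.
  by rewrite setIT -/(D x) -[X in _ * X = _]DE -muleA -EFinM mulVf ?mule1// gt_eqF.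
have [m1 m2 T1] := radon_tonelli mu hG lcG sS mk k0 kS.
transitivity (\int[mu]_x \int[mu]_y k (x, y)); first by apply: eq_integral => x _; rewrite kint.
rewrite T1; pose k2 (p : borel (G * G)%type) := k (p.2^-1 * p.1, p.2)%g.
have mk2 : measurable_fun setT k2.
  apply: (measurableT_comp mk (g := (fun p => (p.2^-1 * p.1, p.2)%g) :
    borel (G * G)%type -> borel (G * G)%type)).
  by apply: measurable_fun_generated => B; apply: open_preimage; exact: continuous_shear.
have k2S x y : k2 (x, y) != 0 -> S x /\ S y.
  by move=> /kS[Syx Sy]; split; [rewrite -(mulVKg y x); exact: SM|exact: Sy].
have [_ _ T2] := radon_tonelli mu hG lcG sS mk2 (fun=> k0 _) k2S.
transitivity (\int[mu]_y \int[mu]_x k2 (x, y)).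
  apply: eq_integral => y _.
  have mky : measurable_fun setT (fun x : borel G => k (x, y)) by exact: measurable_fun_pairr.
  exact: (esym (@ge0_integral_mulgl _ _ mu (y^-1)%g _ mky (fun=> k0 _))).
rewrite -T2.
have hmeas : measurable_fun setT (fun y : borel G => h (y^-1)%g * (fine (D (y^-1)%g))^-1%:E).
  apply: emeasurable_funM; first exact: (measurableT_comp mh (@measurable_invg G)).
  apply/measurable_EFinP.
  apply: measurable_funV_gt0 => [y|]; first by have [] := right_translate_fin_gt0 (y^-1)%g.
  exact: (measurableT_comp measurable_right_translate (@measurable_invg G)).
have hge0 y : 0 <= h (y^-1)%g * (fine (D (y^-1)%g))^-1%:E.
  have [/ltW D0 _] := right_translate_fin_gt0 (y^-1)%g.
  by apply: mule_ge0; [exact: h0|rewrite lee_fin invr_ge0; exact: D0].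
transitivity (\int[mu]_x ((\1_V x)%:E *
    \int[mu]_y (h (y^-1)%g * ((fine (D (y^-1)%g))^-1)%:E))).
  apply: eq_integral => x _.
  have mkx : measurable_fun setT (fun y : borel G => k2 (x, y)) by exact: measurable_fun_pairl.
  apply: etrans (esym (@ge0_integral_mulgl _ _ mu x _ mkx (fun=> k0 _))) _.
  clear k0 kS kint m1 m2 T1 T2 k2S.
  rewrite -ge0_integralZl//.
  apply: eq_integral => y _; rewrite /k2 /k /=.
  by rewrite invgM mulgVK mulgK EFinM muleA muleC.
clear k0 kS kint m1 m2 T1 T2 k2S.
rewrite ge0_integralZr//; last 2 first.
- by apply/measurable_EFinP; apply: measurable_indic; exact: open_mbl.
- exact: integral_ge0.
by rewrite integral_indic ?setIT//; exact: open_mbl.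
Qed.

End translate_measure.

(* With this normalization [mu (A z) = Delta z * mu A] and [f^*(x) = f(x^-1) / Delta x]
   is an isometry of [L1]; no continuity of [Delta] is needed. *)
Record modular_function (Delta : G -> R) : Prop := {
  modular_gt0 : forall x, (0 < Delta x)%R ;
  modularM : forall x y, Delta (x * y)%g = (Delta x * Delta y)%R ;
  measurable_modular : measurable_fun setT (Delta : borel G -> R) ;
  haar_integral_inv : forall h, measurable_fun setT h -> (forall x, 0 <= h x) ->
    sigma_supp h -> \int[mu]_x (h (x^-1)%g * ((Delta x)^-1)%:E) = \int[mu]_x h x ;
  haar_integral_mulgr : forall z h, measurable_fun setT h -> (forall x, 0 <= h x) ->
    sigma_supp h -> \int[mu]_x h (x * z)%g = ((Delta z)^-1)%:E * \int[mu]_x h x }.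

Lemma sigma_supp_mulr h z : sigma_supp h -> sigma_supp (fun x => h (x * z)%g).
Proof.
move=> [S sS hS]; exists (mulset S [set z^-1]%g).
  by apply: sigma_compact_mulset => //; exact/compact_sigma_compact/compact_set1.
by move=> x /hS Sxz; exists (x * z)%g => //; exists (z^-1)%g => //; rewrite mulgK.
Qed.

(** [D (y^-1)] is the measure of [U y], and [Delta y] is its ratio to the measure of [U]. Using
    [integral_inv_translate] with every [U z] computes the same integral in many ways ([key]);
    comparing them gives the effect of right translation ([Rz]), and its value on indicators gives
    multiplicativity ([DM]). *)
Lemma exists_modular_function : exists Delta, modular_function Delta.
Proof.
have [U [Q [oU U1 cQ UQ]]] := compact_nbhs1 lcG.
pose D x := fine (mu [set y | U (y * x)%g]).
have DP x : (0 < D x)%R /\ (D x)%:E = mu [set y | U (y * x)%g].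
  exact: (right_translate_fin_gt0 oU cQ UQ U1).
have D0 x : (0 < D x)%R by have [] := DP x.
have Dn x : D x != 0%R by rewrite gt_eqF.
have DE x : (D x)%:E = mu [set y | U (y * x)%g] by have [] := DP x.
have mD : measurable_fun setT (D : borel G -> R) := measurable_right_translate oU cQ UQ.
have key z h : measurable_fun setT h -> (forall x, 0 <= h x) -> sigma_supp h ->
    \int[mu]_x h x = (D (z^-1)%g)%:E * \int[mu]_y (h (y^-1)%g * ((D (y^-1 * z^-1)%g)^-1)%:E).
  move=> mh h0 sh; rewrite DE.
  have oUz : open [set y | U (y * z^-1)%g] by exact: open_mulr.
  have cQz : compact (mulset Q [set z]) by apply: compact_mulset => //; exact: compact_set1.
  have UQz : [set y | U (y * z^-1)%g] `<=` mulset Q [set z].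
    by move=> y /UQ Qy; exists (y * z^-1)%g => //; exists z => //; rewrite mulgVK.
  have Uz : [set y | U (y * z^-1)%g] z by rewrite /= mulgV.
  rewrite (integral_inv_translate oUz cQz UQz Uz mh h0 sh).
  congr (_ * _); apply: eq_integral => y _; rewrite /D /=.
  by under [X in mu X]eq_set do rewrite -mulgA.
have Rz z h : measurable_fun setT h -> (forall x, 0 <= h x) -> sigma_supp h ->
    \int[mu]_x h (x * z)%g = (D 1%g / D (z^-1)%g)%:E * \int[mu]_x h x.
  move=> mh h0 sh.
  have mhz : measurable_fun setT (fun x : borel G => h (x * z)%g).
    exact: (measurableT_comp mh (@measurable_mulgr _ z)).
  rewrite (key 1%g (fun x : borel G => h (x * z)%g))//; last exact: sigma_supp_mulr.
  rewrite (key z h)// muleA -EFinM invg1 divfK//; congr (_ * _).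
  pose k y := h (y^-1 * z)%g * ((D (y^-1)%g)^-1)%:E.
  have mk : measurable_fun setT (k : borel G -> \bar R).
    apply: emeasurable_funM; first exact: (measurableT_comp mhz (@measurable_invg G)).
    apply/measurable_EFinP; apply: measurable_funV_gt0 => //.
    exact: (measurableT_comp mD (@measurable_invg G)).
  have k0 y : 0 <= k y by rewrite /k mule_ge0// lee_fin invr_ge0 ltW.
  transitivity (\int[mu]_y k y); first by apply: eq_integral => y _; rewrite /k mulg1.
  rewrite -(ge0_integral_mulgl mu z mk k0); apply: eq_integral => y _.
  by rewrite /k invgM mulgVK.
have DM z w : (D (z * w^-1)%g = D 1%g * D (w^-1)%g / D (z^-1)%g)%R.
  have oUw : open [set x | U (x * w^-1)%g] by exact: open_mulr.
  have mUw : mbl [set x | U (x * w^-1)%g] by exact: open_mbl.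
  have m1 : measurable_fun setT (fun x : borel G => (\1_[set x | U (x * w^-1)%g] x : R)%:E).
    by apply/measurable_EFinP; exact: measurable_indic.
  have s1 : sigma_supp (fun x : borel G => (\1_[set x | U (x * w^-1)%g] x : R)%:E).
    exists (mulset Q [set w]).
      by apply/compact_sigma_compact/compact_mulset => //; exact: compact_set1.
    move=> x; rewrite indicE eqe pnatr_eq0 eqb0 negbK => /set_mem /= /UQ ?.
    by exists (x * w^-1)%g => //; exists w => //; rewrite mulgVK.
  have i1 (x : borel G) : 0 <= (\1_[set x | U (x * w^-1)%g] x : R)%:E by rewrite lee_fin.
  have e := Rz z _ m1 i1 s1.
  have I1 v : \int[mu]_x (\1_([set x | U (x * v)%g] : set (borel G)) x : R)%:E = (D v)%:E.
    by rewrite integral_indic ?setIT ?DE//; apply: open_mbl; exact: open_mulr.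
  apply/EFin_inj; rewrite mulrAC EFinM -I1 -(I1 (w^-1)%g) -e; apply: eq_integral => x _.
  rewrite !indicE; congr (_%:R%:E); congr nat_of_bool.
  by apply/idP/idP; rewrite !inE /= mulgA.
exists (fun y => D (y^-1)%g / D 1%g)%R; split.
- by move=> x; rewrite divr_gt0.
- move=> x y; have := DM (y^-1)%g x.
  rewrite -invgM invgK => ->.
  have := DM y 1%g; rewrite invg1 mulg1 => ->.
  by field; rewrite !Dn.
- apply: measurable_funM => //; exact: (measurableT_comp mD (@measurable_invg G)).
- move=> h mh h0 sh; rewrite (key 1%g h)// invg1 -ge0_integralZl//; last 3 first.
  + apply: emeasurable_funM; first exact: (measurableT_comp mh (@measurable_invg G)).
    apply/measurable_EFinP; apply: measurable_funV_gt0 => //.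
    apply: (measurableT_comp mD (g := fun y : borel G => (y^-1 * 1)%g : borel G)).
    under eq_fun do rewrite mulg1; exact: measurable_invg.
  + by move=> y _; rewrite mule_ge0// lee_fin invr_ge0 ltW.
  + by rewrite lee_fin ltW.
  apply: eq_integral => y _; rewrite mulg1 muleCA -EFinM; congr (_ * _%:E).
  by rewrite invf_div.
- by move=> z h mh h0 sh; rewrite Rz// invf_div.
Qed.

End modular.

(** * The space L1 and convolution *)

Section complex_modulus.
Context (R : rcfType).
Implicit Types (z w : R[i]) (r : R).

Definition cmod z : R := complex.Re `|z|.

Lemma cmodE z : (cmod z)%:C%C = `|z|.
Proof. by rewrite /cmod RRe_real// normr_real. Qed.

Lemma cmod_ge0 z : 0 <= cmod z.
Proof. by rewrite /cmod normc_def /= sqrtr_ge0. Qed.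

Lemma cmodM z w : cmod (z * w) = cmod z * cmod w.
Proof. by apply: (@complexI R); rewrite rmorphM /= !cmodE normrM. Qed.

Lemma cmodN z : cmod (- z) = cmod z.
Proof. by rewrite /cmod normrN. Qed.

Lemma cmod0 : cmod 0 = 0.
Proof. by rewrite /cmod normr0. Qed.

Lemma cmodD z w : cmod (z + w) <= cmod z + cmod w.
Proof. by rewrite -lecR rmorphD /= !cmodE ler_normD. Qed.

Lemma cmod_eq0 z : (cmod z == 0) = (z == 0).
Proof. by rewrite -(normr_eq0 z) -cmodE -(inj_eq (@complexI R)). Qed.

Lemma cmod_real r : cmod r%:C%C = `|r|.
Proof. by rewrite /cmod normc_def /= expr0n addr0 sqrtr_sqr. Qed.

Lemma cmod_Re z : `|complex.Re z| <= cmod z.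
Proof.
by rewrite /cmod normc_def /= -sqrtr_sqr ler_sqrt ?addr_ge0 ?sqr_ge0// lerDl sqr_ge0.
Qed.

Lemma cmod_Im z : `|complex.Im z| <= cmod z.
Proof.
by rewrite /cmod normc_def /= -sqrtr_sqr ler_sqrt ?addr_ge0 ?sqr_ge0// lerDr sqr_ge0.
Qed.

Lemma cmod_le z : cmod z <= `|complex.Re z| + `|complex.Im z|.
Proof.
rewrite /cmod normc_def /= -[leRHS]ger0_norm ?addr_ge0// -[leRHS]sqrtr_sqr.
rewrite ler_sqrt ?sqr_ge0// sqrrD !real_normK ?num_real// lerD2r lerDl.
by rewrite mulrn_wge0// mulr_ge0.
Qed.

Lemma cmod_ge0E z : 0 <= z -> (cmod z)%:C%C = z.
Proof. by move=> z0; rewrite cmodE ger0_norm. Qed.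

Lemma complex_ge0P z : 0 <= z <-> (complex.Im z = 0) /\ 0 <= complex.Re z.
Proof. by rewrite lecE /=; split => [/andP[/eqP]|[-> ->]]; rewrite ?eqxx. Qed.

Lemma cReM z w : complex.Re (z * w) = complex.Re z * complex.Re w - complex.Im z * complex.Im w.
Proof. by case: z w => [a b] [c d]. Qed.

Lemma cImM z w : complex.Im (z * w) = complex.Re z * complex.Im w + complex.Im z * complex.Re w.
Proof. by case: z w => [a b] [c d]. Qed.

Lemma cReD z w : complex.Re (z + w) = complex.Re z + complex.Re w.
Proof. by case: z w => [a b] [c d]. Qed.

Lemma cImD z w : complex.Im (z + w) = complex.Im z + complex.Im w.
Proof. by case: z w => [a b] [c d]. Qed.

Lemma cReN z : complex.Re (- z) = - complex.Re z.
Proof. by case: z. Qed.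

Lemma cImN z : complex.Im (- z) = - complex.Im z.
Proof. by case: z. Qed.

End complex_modulus.

Section L1_norm.
Context (G : topologicalGroupType) (R : realType) (mu : leftHaarMeasure G R).
Local Notation C := R[i].
Local Notation L1 := (L1 mu).
Local Notation N := (@L1norm G R mu).
Implicit Types (f g h : L1).

#[global] Instance haar_ae_filter : Filter (almost_everywhere mu).
Proof. exact: (ae_filter_ringOfSetsType mu). Qed.

(** Over an arbitrary generating family, since it is used for the open sets of [G] and for those of
    [G * G]. *)
Definition cmeasurable (T : pointedType) (H : set (set T)) (u : T -> C) :=
  measurable_fun setT (fun x : g_sigma_algebraType H => complex.Re (u x)) /\
  measurable_fun setT (fun x : g_sigma_algebraType H => complex.Im (u x)).
Local Notation cmeas := (@cmeasurable G (@open G)).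

Lemma cmeasurable_cmod (T : pointedType) (H : set (set T)) (u : T -> C) :
  cmeasurable H u -> measurable_fun setT (fun x : g_sigma_algebraType H => cmod (u x)).
Proof.
move=> [mr mi]; rewrite (_ : (fun _ => _) = (fun x : g_sigma_algebraType H =>
    Num.sqrt (complex.Re (u x) ^+ 2 + complex.Im (u x) ^+ 2))); last first.
  by apply/funext => y; rewrite /cmod normc_def.
apply: (measurableT_comp (continuous_measurable_fun (@sqrt_continuous R))).
by apply: measurable_funD; exact: measurable_funX.
Qed.

Lemma cmeasurableM (T : pointedType) (H : set (set T)) (u v : T -> C) :
  cmeasurable H u -> cmeasurable H v -> cmeasurable H (fun x => u x * v x).
Proof.
move=> [ur ui] [vr vi]; split.
  by under eq_fun do rewrite cReM; apply: measurable_funB; exact: measurable_funM.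
by under eq_fun do rewrite cImM; apply: measurable_funD; exact: measurable_funM.
Qed.

Lemma cmeasurableD (T : pointedType) (H : set (set T)) (u v : T -> C) :
  cmeasurable H u -> cmeasurable H v -> cmeasurable H (fun x => u x + v x).
Proof.
move=> [ur ui] [vr vi]; split.
  by under eq_fun do rewrite cReD; exact: measurable_funD.
by under eq_fun do rewrite cImD; exact: measurable_funD.
Qed.

Lemma cmeasurableN (T : pointedType) (H : set (set T)) (u : T -> C) :
  cmeasurable H u -> cmeasurable H (fun x => - u x).
Proof.
move=> [ur ui]; split.
  by under eq_fun do rewrite cReN; apply: (measurableT_comp (f := -%R : R -> R)).
by under eq_fun do rewrite cImN; apply: (measurableT_comp (f := -%R : R -> R)).
Qed.

Lemma cmeasurable_comp (T T' : pointedType) (H : set (set T)) (H' : set (set T'))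
    (u : T' -> C) (phi : T -> T') : cmeasurable H' u ->
  measurable_fun setT (phi : g_sigma_algebraType H -> g_sigma_algebraType H') ->
  cmeasurable H (fun x => u (phi x)).
Proof.
move=> [ur ui] mp; split; [exact: (measurableT_comp ur mp)|exact: (measurableT_comp ui mp)].
Qed.

Lemma L1_cmeasurable f : cmeas f.
Proof.
by have [/integrableP[/measurable_EFinP fr _] /integrableP[/measurable_EFinP fi _]] := L1P f.
Qed.

Lemma L1_measurable_cmod f : measurable_fun setT (fun x : borel G => (cmod (f x))%:E).
Proof. by apply/measurable_EFinP; exact: cmeasurable_cmod (L1_cmeasurable f). Qed.

Lemma L1_cmod_integrable f : mu.-integrable setT (fun x : borel G => (cmod (f x))%:E).
Proof.
have [fr fi] := L1P f; have mf := L1_measurable_cmod f.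
apply: (@le_integrable _ _ _ mu setT measurableT _
  (fun x => `|(complex.Re (f x))%:E| + `|(complex.Im (f x))%:E|)%E) => //.
- move=> x _ /=; rewrite lee_fin ger0_norm ?cmod_ge0// ger0_norm ?addr_ge0//.
  exact: cmod_le.
- by apply: integrableD => //; exact: integrable_abse.
Qed.

Lemma L1normE f : (N f)%:E = (\int[mu]_x (cmod (f x))%:E)%E.
Proof.
rewrite /L1norm /Rintegral fineK//.
exact: (integrable_fin_num measurableT (L1_cmod_integrable f)).
Qed.

Lemma L1pred_le (u : G -> C) (h : borel G -> \bar R) : cmeas u -> measurable_fun setT h ->
  (forall x, (cmod (u x))%:E <= h x)%E -> (\int[mu]_x h x < +oo)%E -> u \in L1pred mu.
Proof.
move=> [ur ui] mh uh hoo.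
have h0 x : (0 <= h x)%E by apply: le_trans (uh x); rewrite lee_fin cmod_ge0.
have hi : mu.-integrable setT h.
  apply/integrableP; split => //.
  by under eq_integral do rewrite gee0_abs//.
rewrite inE; split.
  apply: (le_integrable measurableT _ _ hi) => [|x _]; first exact/measurable_EFinP.
  by rewrite (gee0_abs (h0 x)); apply: le_trans (uh x); rewrite lee_fin cmod_Re.
apply: (le_integrable measurableT _ _ hi) => [|x _]; first exact/measurable_EFinP.
by rewrite (gee0_abs (h0 x)); apply: le_trans (uh x); rewrite lee_fin cmod_Im.
Qed.

Lemma L1pred_cmod (u : G -> C) : cmeas u ->
  (\int[mu]_x (cmod (u x))%:E < +oo)%E -> u \in L1pred mu.
Proof.
move=> mu_; apply: L1pred_le => //; apply/measurable_EFinP; exact: cmeasurable_cmod.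
Qed.

Lemma L1valD f g x : (f + g) x = f x + g x. Proof. by []. Qed.
Lemma L1valN f x : (- f) x = - f x. Proof. by []. Qed.
Lemma L1valB f g x : (f - g) x = f x - g x. Proof. by []. Qed.
Lemma L1valZ (a : C) f x : (a *: f) x = a * f x. Proof. by []. Qed.
Lemma L1norm_ge0 f : 0 <= N f.
Proof. by apply: Rintegral_ge0 => x _; exact: cmod_ge0. Qed.

Lemma L1norm_ae f g : {ae mu, forall x, cmod (f x) = cmod (g x)} -> N f = N g.
Proof.
move=> fg; apply: EFin_inj; rewrite !L1normE; apply: ge0_ae_eq_integral => //.
- exact: L1_measurable_cmod.
- exact: L1_measurable_cmod.
- by move=> x _; rewrite lee_fin cmod_ge0.
- by move=> x _; rewrite lee_fin cmod_ge0.
- by apply: filterS fg => x + _ => ->.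
Qed.

Lemma L1norm_le_integral f (h : borel G -> \bar R) : measurable_fun setT h ->
  {ae mu, forall x, (cmod (f x))%:E <= h x}%E -> (forall x, 0 <= h x)%E ->
  ((N f)%:E <= \int[mu]_x h x)%E.
Proof.
move=> mh fh h0; rewrite L1normE; apply: ae_ge0_le_integral => //.
- by move=> x _; rewrite lee_fin cmod_ge0.
- exact: L1_measurable_cmod.
- by apply: filterS fh => x + _.
Qed.

Lemma L1norm_le f g : {ae mu, forall x, cmod (f x) <= cmod (g x)} -> N f <= N g.
Proof.
move=> fg; rewrite -lee_fin (L1normE g); apply: L1norm_le_integral.
- exact: L1_measurable_cmod.
- by apply: filterS fg => x; rewrite lee_fin.
- by move=> x; rewrite lee_fin cmod_ge0.
Qed.

Lemma L1norm0 : N 0 = 0.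
Proof.
apply: EFin_inj; rewrite L1normE integral0_eq// => x _; by rewrite cmod0.
Qed.

Lemma L1normN f : N (- f) = N f.
Proof. by apply: L1norm_ae; apply: aeW => x; rewrite L1valN cmodN. Qed.

Lemma L1normZ (a : C) f : N (a *: f) = cmod a * N f.
Proof.
rewrite /L1norm; under eq_Rintegral do rewrite L1valZ -/(cmod _) cmodM.
by rewrite RintegralZl//; exact: L1_cmod_integrable.
Qed.

Lemma L1normD f g : N (f + g) <= N f + N g.
Proof.
rewrite -lee_fin EFinD !L1normE -ge0_integralD//; last 4 first.
- by move=> x _; rewrite lee_fin cmod_ge0.
- exact: L1_measurable_cmod.
- by move=> x _; rewrite lee_fin cmod_ge0.
- exact: L1_measurable_cmod.
apply: ge0_le_integral => //.
- by move=> x _; rewrite lee_fin cmod_ge0.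
- exact: L1_measurable_cmod.
- by apply: emeasurable_funD; exact: L1_measurable_cmod.
- by move=> x _; rewrite -EFinD lee_fin L1valD cmodD.
Qed.

Lemma L1norm_distC f g : N (f - g) = N (g - f).
Proof. by rewrite -L1normN opprB. Qed.

Lemma L1norm_triangle g f h : N (f - h) <= N (f - g) + N (g - h).
Proof. by rewrite (le_trans _ (L1normD _ _))// addrA subrK. Qed.

Lemma L1norm_ae0 f : {ae mu, forall x, f x = 0} -> N f = 0.
Proof.
by move=> f0; rewrite -L1norm0; apply: L1norm_ae; apply: filterS f0 => x ->.
Qed.

End L1_norm.

Section L1_kernels.
Context (G : topologicalGroupType) (R : realType) (mu : leftHaarMeasure G R).
Hypothesis hG : hausdorff_space G.
Hypothesis lcG : locally_compact [set: G].
Local Notation C := R[i].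
Local Notation L1 := (L1 mu).
Local Notation N := (@L1norm G R mu).
Local Notation cmeas := (@cmeasurable R G (@open G)).
Local Notation cmeas2 := (@cmeasurable R (G * G)%type (@open (G * G)%type)).
Implicit Types (f g h : L1) (S : set G).

Definition supported {T : Type} (u : T -> C) (S : set T) := forall x, u x != 0 -> S x.

(** By Markov's inequality the set [E n] where [f] has modulus at least [1 / (n + 1)] has finite
    measure, so [haar_fin_sub_sigma_compact] encloses it. Vanishing off [S] holds at every point,
    not just almost everywhere. *)
Lemma L1_sigma_supp f : exists2 S, sigma_compact S & supported f S.
Proof.
pose E n := [set x : borel G | (n.+1%:R^-1%:E <= `|(cmod (f x))%:E|)%E].
have mf := L1_measurable_cmod f.
have mE n : measurable (E n).
  rewrite -[E n]setTI; apply: emeasurable_fun_c_infty => //.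
  exact: measurableT_comp.
have /choice[S SP] n : exists S : set G, sigma_compact S /\ E n `<=` S.
  have n0 : 0 < n.+1%:R^-1 :> R by rewrite invr_gt0.
  have [] := @haar_fin_sub_sigma_compact _ _ mu hG lcG (E n) (mE n); last first.
    by move=> S sS ES; exists S.
  have /integrableP[_] := L1_cmod_integrable f; rewrite ltNge leye_eq => foo.
  have le : (n.+1%:R^-1%:E * mu (E n) <= \int[mu]_x `|(cmod (f x))%:E|)%E.
    by have := le_integral_abse mu measurableT mf n0; rewrite setTI.
  rewrite ltNge leye_eq; apply: contra foo => /eqP Eoo; move: le.
  by rewrite Eoo gt0_muley ?lte_fin// leye_eq.
exists (\bigcup_n S n); first by apply: sigma_compact_bigcup => n; have [] := SP n.
move=> x fx; have cf : 0 < cmod (f x) by rewrite lt0r cmod_eq0 fx cmod_ge0.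
exists (Num.truncn (cmod (f x))^-1) => //; apply: (SP _).2; rewrite /E /=.
rewrite lee_fin ger0_norm ?cmod_ge0// ltW// invf_plt ?posrE//; exact: truncnS_gt.
Qed.

Lemma L1_subgroup_supp f g d : exists S,
  [/\ sigma_compact S, is_subgroup S, S d, supported f S & supported g S].
Proof.
have [S sS fS] := L1_sigma_supp f; have [T sT gT] := L1_sigma_supp g.
have sd : sigma_compact [set d] by exact/compact_sigma_compact/compact_set1.
have [H [STH sH gH]] := sigma_compact_subgroup (sigma_compactU (sigma_compactU sS sT) sd).
exists H; split => //; first by apply: STH; right.
  by move=> x /fS ?; apply: STH; left; left.
by move=> x /gT ?; apply: STH; left; right.
Qed.

Section change_of_variables.
Variables (phi : G -> G) (w : G -> R).
Hypothesis mphi : measurable_fun setT (phi : borel G -> borel G).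
Hypothesis w0 : forall x, 0 < w x.
Hypothesis phiw : forall h : borel G -> \bar R, measurable_fun setT h ->
  (forall x, 0 <= h x)%E -> sigma_supp h ->
  (\int[mu]_x (h (phi x) * (w x)%:E) = \int[mu]_x h x)%E.

Lemma Rintegral_change (u : G -> R) : measurable_fun setT (u : borel G -> R) ->
  (exists2 S, sigma_compact S & forall x, u x != 0 -> S x) ->
  \int[mu]_x (u (phi x) * w x) = \int[mu]_x u x.
Proof.
move=> mu_ [S sS uS]; rewrite /Rintegral; congr fine.
have mE : measurable_fun setT (fun x : borel G => (u x)%:E) by exact/measurable_EFinP.
rewrite integralE [RHS]integralE; congr (_ - _)%E.
  rewrite -[RHS]phiw; last 3 first.
  - exact: measurable_funepos.
  - exact: funepos_ge0.
  - exists S => // x pu; apply: uS.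
    apply: contraNneq pu => u0.
    by rewrite funeposE /= u0 maxxx.
  apply: eq_integral => x _; rewrite !funeposE -!EFin_max -EFinM; congr EFin.
  by rewrite maxr_pMl ?mul0r// ltW.
rewrite -[RHS]phiw; last 3 first.
- exact: measurable_funeneg.
- exact: funeneg_ge0.
- exists S => // x pu; apply: uS.
    apply: contraNneq pu => u0.
  by rewrite funenegE /= u0 oppr0 maxxx.
apply: eq_integral => x _; rewrite !funenegE -!EFinN -!EFin_max -EFinM; congr EFin.
by rewrite maxr_pMl ?mul0r ?mulNr// ltW.
Qed.

Lemma cintegral_change (u : G -> C) : cmeas u ->
  (exists2 S, sigma_compact S & supported u S) ->
  cintegral mu (fun x => u (phi x) * (w x)%:C%C) = cintegral mu u.
Proof.
move=> [ur ui] [S sS uS]; rewrite /cintegral; congr Complex.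
  rewrite -[RHS]Rintegral_change//.
    by apply: eq_Rintegral => x _; rewrite cReM /= mulr0 subr0.
  by exists S => // x ux; apply: uS; apply: contraNneq ux => ->.
rewrite -[RHS]Rintegral_change//.
  by apply: eq_Rintegral => x _; rewrite cImM /= mulr0 add0r.
by exists S => // x ux; apply: uS; apply: contraNneq ux => ->.
Qed.

Hypothesis mw : measurable_fun setT (w : borel G -> R).

Lemma cmeasurable_change (u : G -> C) : cmeas u -> cmeas (fun x => u (phi x) * (w x)%:C%C).
Proof.
move=> mu_; apply: cmeasurableM; first exact: cmeasurable_comp mu_ mphi.
by split => //=; exact: measurable_cst.
Qed.

Lemma integral_cmod_change f :
  (\int[mu]_x (cmod (f (phi x) * (w x)%:C%C))%:E = (N f)%:E)%E.
Proof.
rewrite L1normE -[RHS]phiw.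
- by apply: eq_integral => x _; rewrite cmodM cmod_real gtr0_norm.
- exact: L1_measurable_cmod.
- by move=> x; rewrite lee_fin cmod_ge0.
- have [S sS fS] := L1_sigma_supp f; exists S => // x.
  by rewrite eqe cmod_eq0; exact: fS.
Qed.

Lemma L1pred_change f : (fun x => f (phi x) * (w x)%:C%C) \in L1pred mu.
Proof.
apply: L1pred_cmod; first by apply: cmeasurable_change; exact: L1_cmeasurable.
by rewrite integral_cmod_change ltry.
Qed.

(** Instances: inversion with weight [1 / Delta], and right translation by [z] with constant weight
    [Delta z]; both are isometries. *)
Definition L1change f : L1 := MkL1 (L1pred_change f).

Lemma L1norm_change f : N (L1change f) = N f.
Proof. by apply: EFin_inj; rewrite L1normE integral_cmod_change. Qed.

End change_of_variables.

End L1_kernels.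

Section kernel.
Context (G : topologicalGroupType) (R : realType) (mu : leftHaarMeasure G R).
Hypothesis hG : hausdorff_space G.
Hypothesis lcG : locally_compact [set: G].
Local Notation C := R[i].
Local Notation cmeas := (@cmeasurable R G (@open G)).
Local Notation cmeas2 := (@cmeasurable R (G * G)%type (@open (G * G)%type)).

Lemma measurable_Rintegral_section (r : G * G -> R) (S : set G) : sigma_compact S ->
  measurable_fun setT (r : borel (G * G)%type -> R) ->
  (forall x y, r (x, y) != 0 -> S x /\ S y) ->
  measurable_fun setT (fun x : borel G => \int[mu]_y r (x, y)).
Proof.
move=> sS mr rS; rewrite /Rintegral.
apply: (measurableT_comp (f := fine)); first exact: fine_measurable.
have mE : measurable_fun setT (fun p : borel (G * G)%type => (r p)%:E) by exact/measurable_EFinP.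
rewrite (_ : (fun _ => _) = (fun x : borel G =>
  \int[mu]_y ((fun p : borel (G * G)%type => (r p)%:E)^\+ (x, y)) -
  \int[mu]_y ((fun p : borel (G * G)%type => (r p)%:E)^\- (x, y)))%E).
  apply: emeasurable_funB.
    have [||m _ _] := radon_tonelli mu hG lcG (S := S) sS (measurable_funepos mE).
    - exact: funepos_ge0.
    - move=> x y pu; apply: rS; apply: contraNneq pu => r0.
      by rewrite funeposE /= r0 maxxx.
    exact: m.
  have [||m _ _] := radon_tonelli mu hG lcG (S := S) sS (measurable_funeneg mE).
  - exact: funeneg_ge0.
  - move=> x y pu; apply: rS; apply: contraNneq pu => r0.
    by rewrite funenegE /= r0 oppr0 maxxx.
  exact: m.
apply/funext => x; rewrite integralE; congr (_ - _)%E;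
  by apply: eq_integral => y _; rewrite ?funeposE ?funenegE.
Qed.

Section complex_kernel.
Variables (k : G * G -> C) (S : set G).
Hypotheses (sS : sigma_compact S) (mk : cmeas2 k).
Hypothesis kS : forall x y, k (x, y) != 0 -> S x /\ S y.

Lemma cmeasurable_cintegral : cmeas (fun x => cintegral mu (fun y => k (x, y))).
Proof.
have [mr mi] := mk; split => /=.
  apply: (measurable_Rintegral_section (r := fun p => complex.Re (k p)) sS mr).
  by move=> x y r0; apply: kS; apply: contraNneq r0 => ->.
apply: (measurable_Rintegral_section (r := fun p => complex.Im (k p)) sS mi).
by move=> x y r0; apply: kS; apply: contraNneq r0 => ->.
Qed.

Lemma cmod_kernel_tonelli :
  [/\ measurable_fun setT (fun x : borel G => \int[mu]_y (cmod (k (x, y)))%:E)%E,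
      measurable_fun setT (fun y : borel G => \int[mu]_x (cmod (k (x, y)))%:E)%E &
      (\int[mu]_x \int[mu]_y (cmod (k (x, y)))%:E =
       \int[mu]_y \int[mu]_x (cmod (k (x, y)))%:E)%E].
Proof.
apply: (radon_tonelli mu hG lcG (S := S) (f := fun p => (cmod (k p))%:E)) => //.
- by apply/measurable_EFinP; exact: cmeasurable_cmod.
- by move=> p; rewrite lee_fin cmod_ge0.
- by move=> x y; rewrite eqe cmod_eq0 => /kS.
Qed.

(** Real and imaginary parts are bounded separately, which is the origin of the factor 2 in the
    later norm estimates. The bound survives divergence, since [fine] never increases the absolute
    value. *)
Lemma cmod_cintegral_le (u : G -> C) : cmeas u ->
  ((cmod (cintegral mu u))%:E <= 2%:E * \int[mu]_y (cmod (u y))%:E)%E.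
Proof.
move=> mu_; have [ur ui] := mu_.
have mc : measurable_fun setT (fun y : borel G => (cmod (u y))%:E).
  by apply/measurable_EFinP; exact: cmeasurable_cmod.
have abs_le (v : borel G -> R) : measurable_fun setT v -> (forall y, `|v y| <= cmod (u y)) ->
    (`|\int[mu]_y v y|%:E <= \int[mu]_y (cmod (u y))%:E)%E.
  move=> mv vu; have mv' : measurable_fun setT (EFin \o v) by exact/measurable_EFinP.
  have fine_le (z : \bar R) : (`|fine z|%:E <= `|z|)%E.
    by case: z => [r| |] /=; rewrite ?normr0 ?leey.
  apply: (le_trans (fine_le _)); apply: (le_trans (le_abse_integral mu measurableT mv')).
  apply: ge0_le_integral => //; first exact: measurableT_comp.
  by move=> y _ /=; rewrite lee_fin.
apply: (@le_trans _ _ (`|\int[mu]_y complex.Re (u y)|%:E + `|\int[mu]_y complex.Im (u y)|%:E)%E).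
  by rewrite -EFinD lee_fin cmod_le.
rewrite (_ : 2%:E = 1 + 1)%E // ge0_muleDl ?lee_fin// mul1e leeD//; apply: abs_le => // y.
  exact: cmod_Re.
exact: cmod_Im.
Qed.

Lemma cmeasurable_section x : cmeas (fun y => k (x, y)).
Proof. exact: (cmeasurable_comp mk (measurable_pairl x)). Qed.

Lemma cmod_kernel_le x :
  ((cmod (cintegral mu (fun y => k (x, y))))%:E <= 2%:E * \int[mu]_y (cmod (k (x, y)))%:E)%E.
Proof. by apply: cmod_cintegral_le; exact: cmeasurable_section. Qed.

Lemma kernel_ae_fin : (\int[mu]_x \int[mu]_y (cmod (k (x, y)))%:E < +oo)%E ->
  {ae mu, forall x, \int[mu]_y (cmod (k (x, y)))%:E < +oo}%E.
Proof.
move=> koo; have [m1 _ _] := cmod_kernel_tonelli.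
have i0 (x : borel G) : (0 <= \int[mu]_y (cmod (k (x, y)))%:E)%E.
  by apply: integral_ge0 => y _; rewrite lee_fin cmod_ge0.
have /(integrable_ae measurableT) : mu.-integrable setT
    (fun x : borel G => \int[mu]_y (cmod (k (x, y)))%:E)%E.
  by apply/integrableP; split => //; under eq_integral do rewrite gee0_abs//.
by apply: filterS => x /(_ I); rewrite ge0_fin_numE.
Qed.

Lemma L1pred_kernel : (\int[mu]_x \int[mu]_y (cmod (k (x, y)))%:E < +oo)%E ->
  (fun x => cintegral mu (fun y => k (x, y))) \in L1pred mu.
Proof.
move=> koo; have [m1 _ _] := cmod_kernel_tonelli.
have i0 (x : borel G) : (0 <= \int[mu]_y (cmod (k (x, y)))%:E)%E.
  by apply: integral_ge0 => y _; rewrite lee_fin cmod_ge0.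
apply: (L1pred_le cmeasurable_cintegral) (cmod_kernel_le) _.
  exact: measurable_funeM.
by rewrite ge0_integralZl// lte_mul_pinfty.
Qed.

End complex_kernel.
End kernel.

Section L1_operators.
Context (G : topologicalGroupType) (R : realType) (mu : leftHaarMeasure G R).
Hypothesis hG : hausdorff_space G.
Hypothesis lcG : locally_compact [set: G].
Context (Delta : G -> R) (mDelta : modular_function mu Delta).
Local Notation C := R[i].
Local Notation L1 := (L1 mu).
Local Notation N := (@L1norm G R mu).
Local Notation conv := (@Defs.conv G R mu).
Local Notation cmeas := (@cmeasurable R G (@open G)).
Local Notation cmeas2 := (@cmeasurable R (G * G)%type (@open (G * G)%type)).
Implicit Types (f g h : L1) (S : set G) (x y z c d : G).

Let Delta_gt0 := modular_gt0 mDelta.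

Lemma modular_neq0 x : Delta x != 0.
Proof. by rewrite gt_eqF. Qed.

Lemma modular1 : Delta 1%g = 1.
Proof.
by apply: (mulfI (modular_neq0 1%g)); rewrite mulr1 -(modularM mDelta) mulg1.
Qed.

Lemma modularV x : Delta (x^-1)%g = (Delta x)^-1.
Proof.
apply: (mulfI (modular_neq0 x)).
by rewrite -(modularM mDelta) mulgV modular1 mulfV// modular_neq0.
Qed.

Lemma L1_ext f g : (forall x, f x = g x) -> f = g.
Proof. by move=> fg; apply: val_inj; apply/funext. Qed.

Let inv_gt0 x : 0 < (Delta x)^-1. Proof. by rewrite invr_gt0. Qed.
Let minv : measurable_fun setT ((fun x => (Delta x)^-1) : borel G -> R).
Proof. by apply: measurable_funV_gt0 => //; exact: (measurable_modular mDelta). Qed.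

Definition L1inv f : L1 :=
  L1change hG lcG (@measurable_invg G) inv_gt0 (haar_integral_inv mDelta) minv f.

Lemma L1invE f x : L1inv f x = f (x^-1)%g * ((Delta x)^-1)%:C%C.
Proof. by []. Qed.

Lemma L1norm_inv f : N (L1inv f) = N f.
Proof. exact: L1norm_change. Qed.

Lemma L1inv_linear : linear L1inv.
Proof.
by move=> a f g; apply: L1_ext => x; rewrite !(L1valD, L1valZ, L1invE) mulrDl mulrA.
Qed.

Lemma L1invK : involutive L1inv.
Proof.
move=> f; apply: L1_ext => x; rewrite !L1invE invgK modularV -mulrA -rmorphM /=.
by rewrite invrK mulfV ?mulr1// modular_neq0.
Qed.

Lemma rt_change z : forall h : borel G -> \bar R, measurable_fun setT h ->
  (forall x, 0 <= h x)%E -> sigma_supp h ->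
  (\int[mu]_x (h (x * z)%g * (Delta z)%:E) = \int[mu]_x h x)%E.
Proof.
move=> h mh h0 sh; rewrite ge0_integralZr//.
- rewrite (haar_integral_mulgr mDelta)// muleAC -EFinM mulVf ?mul1e//.
  exact: modular_neq0.
- exact: (measurableT_comp mh (@measurable_mulgr _ z)).
- by rewrite lee_fin ltW.
Qed.

Definition L1rt z f : L1 :=
  L1change hG lcG (@measurable_mulgr _ z) (fun=> Delta_gt0 z) (rt_change z)
    (measurable_cst _) f.

Lemma L1rtE z f x : L1rt z f x = f (x * z)%g * (Delta z)%:C%C.
Proof. by []. Qed.

Lemma L1norm_rt z f : N (L1rt z f) = N f.
Proof. exact: L1norm_change. Qed.

Lemma translateE z f x : translate z f x = f (z * x)%g.
Proof. by []. Qed.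

Lemma translateM x y f : translate x (translate y f) = translate (y * x)%g f.
Proof. by apply: L1_ext => z; rewrite !translateE mulgA. Qed.

Lemma translate1 f : translate 1%g f = f.
Proof. by apply: L1_ext => z; rewrite translateE mul1g. Qed.

Lemma L1inv_translate z f : L1inv (translate z f) = L1rt (z^-1)%g (L1inv f).
Proof.
apply: L1_ext => x; rewrite !(translateE, L1rtE, L1invE) invgM invgK.
rewrite -mulrA -rmorphM /= (modularM mDelta) modularV; congr (_ * _%:C%C).
by field; rewrite !modular_neq0.
Qed.

Lemma translate_L1rt c z f : translate c (L1rt z f) = L1rt z (translate c f).
Proof. by apply: L1_ext => x; rewrite !(translateE, L1rtE) mulgA. Qed.

Section convolution_kernel.
Variables f g : L1.

Definition conv_kernel (p : G * G) : C := f p.2 * g (p.2^-1 * p.1)%g.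

Lemma cmeasurable_conv_kernel : cmeas2 conv_kernel.
Proof.
apply: cmeasurableM.
  apply: (cmeasurable_comp (L1_cmeasurable f)).
  by apply: measurable_fun_continuous2 => p; exact: cvg_snd.
apply: (cmeasurable_comp (L1_cmeasurable g)).
exact: measurable_fun_continuous2 (@continuous_div21 G).
Qed.

Lemma conv_kernel_supp : exists2 S, sigma_compact S &
  forall x y, conv_kernel (x, y) != 0 -> S x /\ S y.
Proof.
have [S [sS [S1 SM SV] _ fS gS]] := L1_subgroup_supp hG lcG f g 1%g.
exists S => // x y; rewrite /conv_kernel /= mulf_eq0 negb_or => /andP[/fS Sy /gS Syx].
by split => //; rewrite -(mulVKg y x); exact: SM.
Qed.

Lemma integral_translate_cmod y h :
  (\int[mu]_x (cmod (h (y * x)%g))%:E = (N h)%:E)%E.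
Proof.
rewrite L1normE; apply: (ge0_integral_mulgl mu y (L1_measurable_cmod h)).
by move=> x; rewrite lee_fin cmod_ge0.
Qed.

Lemma integral_conv_kernel :
  (\int[mu]_x \int[mu]_y (cmod (conv_kernel (x, y)))%:E = (N f * N g)%:E)%E.
Proof.
have [S sS kS] := conv_kernel_supp.
have [_ _ ->] := cmod_kernel_tonelli mu hG lcG sS cmeasurable_conv_kernel kS.
transitivity (\int[mu]_y ((cmod (f y))%:E * (N g)%:E))%E.
  apply: eq_integral => y _; rewrite -(integral_translate_cmod (y^-1)%g g).
  rewrite -ge0_integralZl//.
  - by apply: eq_integral => x _; rewrite /conv_kernel cmodM EFinM.
  - apply/measurable_EFinP; apply: cmeasurable_cmod.
    exact: (cmeasurable_comp (L1_cmeasurable g) (@measurable_mulgl _ _)).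
  - by move=> x _; rewrite lee_fin cmod_ge0.
  - by rewrite lee_fin cmod_ge0.
rewrite ge0_integralZr//.
- by rewrite -L1normE EFinM.
- exact: L1_measurable_cmod.
- by move=> y _; rewrite lee_fin cmod_ge0.
- by rewrite lee_fin L1norm_ge0.
Qed.

Lemma convE x : conv f g x = cintegral mu (fun y => f y * g (y^-1 * x)%g).
Proof.
have [S sS kS] := conv_kernel_supp.
rewrite /Defs.conv; set u : G -> C := (fun x => _).
suff u1 : u \in L1pred mu by rewrite (insubdK (0 : L1) u1).
apply: (L1pred_kernel hG lcG sS cmeasurable_conv_kernel kS).
by rewrite integral_conv_kernel ltry.
Qed.

Lemma conv_cmod_le x :
  ((cmod (conv f g x))%:E <= 2%:E * \int[mu]_y (cmod (conv_kernel (x, y)))%:E)%E.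
Proof. by rewrite convE; exact: (cmod_kernel_le mu cmeasurable_conv_kernel). Qed.

Lemma conv_ae_fin : {ae mu, forall x, \int[mu]_y (cmod (conv_kernel (x, y)))%:E < +oo}%E.
Proof.
have [S sS kS] := conv_kernel_supp.
apply: (kernel_ae_fin hG lcG sS cmeasurable_conv_kernel kS).
by rewrite integral_conv_kernel ltry.
Qed.

Lemma L1norm_conv : N (conv f g) <= 2 * (N f * N g).
Proof.
have [S sS kS] := conv_kernel_supp.
have [m1 _ _] := cmod_kernel_tonelli mu hG lcG sS cmeasurable_conv_kernel kS.
have i0 (x : borel G) : (0 <= \int[mu]_y (cmod (conv_kernel (x, y)))%:E)%E.
  by apply: integral_ge0 => y _; rewrite lee_fin cmod_ge0.
rewrite -lee_fin EFinM -integral_conv_kernel -ge0_integralZl//.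
apply: L1norm_le_integral; first exact: measurable_funeM.
  by apply: aeW => x; exact: conv_cmod_le.
by move=> x; rewrite mule_ge0.
Qed.

Lemma conv_section x : (\int[mu]_y (cmod (conv_kernel (x, y)))%:E < +oo)%E ->
  (fun y => f y * g (y^-1 * x)%g) \in L1pred mu.
Proof.
move=> fin; apply: L1pred_cmod => //.
exact: (cmeasurable_section cmeasurable_conv_kernel x).
Qed.

End convolution_kernel.
End L1_operators.

(** * Convolution, involution and translations *)

Section convolution_algebra.
Context (G : topologicalGroupType) (R : realType) (mu : leftHaarMeasure G R).
Hypothesis hG : hausdorff_space G.
Hypothesis lcG : locally_compact [set: G].
Context (Delta : G -> R) (mDelta : modular_function mu Delta).
Local Notation C := R[i].
Local Notation L1 := (L1 mu).
Local Notation N := (@L1norm G R mu).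
Local Notation conv := (@Defs.conv G R mu).
Local Notation L1inv := (L1inv hG lcG mDelta).
Local Notation L1rt := (L1rt hG lcG mDelta).
Local Notation cmeas := (@cmeasurable R G (@open G)).
Local Notation cmeas2 := (@cmeasurable R (G * G)%type (@open (G * G)%type)).
Implicit Types (f g h : L1) (S : set G) (x y z c d : G).

(** Equality in the quotient. Convolution is bilinear only up to the null set where the defining
    integrals diverge; bounded functionals do not see it ([Linf_eq]). *)
Definition L1eq f g := N (f - g) = 0.

Lemma L1eq_ae f g : {ae mu, forall x, f x = g x} -> L1eq f g.
Proof.
by move=> fg; apply: L1norm_ae0; apply: filterS fg => x; rewrite L1valB => ->; rewrite subrr.
Qed.

Lemma L1eq_norm f g : L1eq f g -> N f = N g.
Proof.
move=> fg; apply/eqP; rewrite eq_le; apply/andP; split.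
  by have := L1normD (f - g) g; rewrite subrK fg add0r.
by have := L1normD (g - f) f; rewrite subrK L1norm_distC fg add0r.
Qed.

Lemma cintegral_linear (a : C) f g :
  cintegral mu (a *: f + g) = a * cintegral mu f + cintegral mu g.
Proof. by have := one_subproof mu; rewrite inE => -[+ _]; exact. Qed.

Lemma cintegralZ (a : C) f : cintegral mu (a *: f) = a * cintegral mu f.
Proof.
have := cintegral_linear a f 0; rewrite addr0 => ->.
by have := cintegral_linear (-1) 0 0; rewrite scaler0 addr0 mulN1r addNr => ->; rewrite addr0.
Qed.

Lemma cmod_cintegral f : cmod (cintegral mu f) <= 2 * N f.
Proof.
by rewrite -lee_fin EFinM L1normE; apply: cmod_cintegral_le; exact: L1_cmeasurable.
Qed.

Lemma conv_linear_l (a : C) f1 f2 g :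
  L1eq (conv (a *: f1 + f2) g) (a *: conv f1 g + conv f2 g).
Proof.
apply: L1eq_ae; apply: filterS2 (conv_ae_fin hG lcG f1 g) (conv_ae_fin hG lcG f2 g) => x f1x f2x.
rewrite L1valD L1valZ !convE//.
rewrite -(cintegral_linear a (MkL1 (conv_section f1x)) (MkL1 (conv_section f2x))).
by congr cintegral; apply/funext => y; rewrite !(L1valD, L1valZ) /= mulrDl mulrA.
Qed.

Lemma conv_linear_r (a : C) f g1 g2 :
  L1eq (conv f (a *: g1 + g2)) (a *: conv f g1 + conv f g2).
Proof.
apply: L1eq_ae; apply: filterS2 (conv_ae_fin hG lcG f g1) (conv_ae_fin hG lcG f g2) => x f1x f2x.
rewrite L1valD L1valZ !convE//.
rewrite -(cintegral_linear a (MkL1 (conv_section f1x)) (MkL1 (conv_section f2x))).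
by congr cintegral; apply/funext => y; rewrite !(L1valD, L1valZ) /= mulrDr mulrCA.
Qed.

Lemma section_cmeasurable f g x : cmeas (fun y => f y * g (y^-1 * x)%g).
Proof. exact: (cmeasurable_section (cmeasurable_conv_kernel f g) x). Qed.

Lemma section_sigma_supp f g x :
  exists2 S, sigma_compact S & supported (fun y => f y * g (y^-1 * x)%g) S.
Proof.
have [S sS fS] := L1_sigma_supp hG lcG f; exists S => // y.
by rewrite mulf_eq0 negb_or => /andP[/fS].
Qed.

Lemma translate_conv c f g : translate c (conv f g) = conv (translate c f) g.
Proof.
apply: L1_ext => x; rewrite translateE !convE//.
have mull_change (h : borel G -> \bar R) : measurable_fun setT h -> (forall x, 0 <= h x)%E ->
    sigma_supp h -> (\int[mu]_y (h (c * y)%g * 1%:E) = \int[mu]_x h x)%E.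
  by move=> mh h0 _; under eq_integral do rewrite mule1; exact: ge0_integral_mulgl.
rewrite -(cintegral_change (fun=> ltr01) mull_change (section_cmeasurable _ _ _) (section_sigma_supp _ _ _)).
congr cintegral; apply/funext => y.
by rewrite mulr1 translateE invgM mulgA mulgVK.
Qed.

Lemma conv_rt z f g : conv (L1rt z f) g = conv f (translate z g).
Proof.
apply: L1_ext => x; rewrite !convE//.
pose u y := f y * g (z * y^-1 * x)%g.
have mu_ : cmeas u.
  apply: cmeasurableM; first exact: L1_cmeasurable.
  apply: (cmeasurable_comp (L1_cmeasurable g)); apply: measurable_fun_generated => B.
  apply: open_preimage; apply: continuous_mulg => [|y]; last exact: cvg_cst.
  apply: continuous_mulg => [y|]; first exact: cvg_cst.
  by apply: continuous_invg => y; exact: cvg_id.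
have su : exists2 S, sigma_compact S & supported u S.
  have [S sS fS] := L1_sigma_supp hG lcG f; exists S => // y.
  by rewrite mulf_eq0 negb_or => /andP[/fS].
transitivity (cintegral mu u); last first.
  by congr cintegral; apply/funext => y; rewrite translateE mulgA.
rewrite -(cintegral_change (fun=> modular_gt0 mDelta z) (rt_change mDelta z) mu_ su).
congr cintegral; apply/funext => y; rewrite L1rtE /u invgM mulgA mulgV mul1g.
by rewrite mulrAC.
Qed.

(** The involution reverses products, by the left translation [y := x * y] in the integral. The
    modular factor is pulled out by linearity on integrable sections, hence equality almost
    everywhere only. *)
Lemma conv_inv f g : L1eq (L1inv (conv f g)) (conv (L1inv g) (L1inv f)).
Proof.
apply: L1eq_ae; apply: filterS (conv_ae_fin hG lcG (L1inv g) (L1inv f)) => x gx.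
rewrite L1invE !convE//; pose v := MkL1 (conv_section gx).
pose w : L1 := translate x v.
have wE y : w y = f y * g (y^-1 * x^-1)%g * ((Delta x)^-1)%:C%C.
  rewrite /w translateE /v /= !invgM !invgK mulKg mulgVK.
  rewrite mulrACA (mulrC (g _)) -rmorphM /=; congr (_ * _ * _%:C%C).
  by rewrite !(modularM mDelta) !(modularV mDelta); field; rewrite !(modular_neq0 mDelta).
have -> : cintegral mu (fun y => f y * g (y^-1 * x^-1)%g) = (Delta x)%:C%C * cintegral mu w.
  rewrite -cintegralZ; congr cintegral; apply/funext => y.
  rewrite L1valZ wE mulrCA -rmorphM /= mulfV ?mulr1//.
  exact: (modular_neq0 mDelta).
rewrite mulrAC -rmorphM /= mulfV ?mul1r; last exact: (modular_neq0 mDelta).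
have mull_change (h : borel G -> \bar R) : measurable_fun setT h -> (forall x, 0 <= h x)%E ->
    sigma_supp h -> (\int[mu]_y (h (x * y)%g * 1%:E) = \int[mu]_x h x)%E.
  by move=> mh h0 _; under eq_integral do rewrite mule1; exact: ge0_integral_mulgl.
rewrite -[RHS](cintegral_change (fun=> ltr01) mull_change (L1_cmeasurable v) (L1_sigma_supp hG lcG v)).
by congr cintegral; apply/funext => y; rewrite mulr1.
Qed.

Definition L1nonneg f := forall x, 0 <= f x.

Lemma nonneg_cintegral f : L1nonneg f -> cintegral mu f = (N f)%:C%C.
Proof.
move=> f0; rewrite /cintegral /L1norm; congr Complex.
  apply: eq_Rintegral => x _; apply: (@complexI R).
  by rewrite -/(cmod _) cmod_ge0E// RRe_real// ger0_real.
rewrite /Rintegral integral0_eq// => x _.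
by have /complex_ge0P[->] := f0 x.
Qed.

Lemma cintegral_ge0 (u : G -> C) : (forall x, 0 <= u x) -> 0 <= cintegral mu u.
Proof.
move=> u0; apply/complex_ge0P; split => /=.
  rewrite /Rintegral integral0_eq// => x _.
  by have /complex_ge0P[->] := u0 x.
by apply: Rintegral_ge0 => x _; have /complex_ge0P[] := u0 x.
Qed.

Lemma conv_nonneg f g : L1nonneg f -> L1nonneg g -> L1nonneg (conv f g).
Proof.
by move=> f0 g0 x; rewrite convE//; apply: cintegral_ge0 => y; exact: mulr_ge0.
Qed.

(** Without cancellation the factor 2 of [L1norm_conv] disappears, so that densities are closed
    under convolution. *)
Lemma L1norm_conv_nonneg f g : L1nonneg f -> L1nonneg g -> N (conv f g) = N f * N g.
Proof.
move=> f0 g0; apply: EFin_inj; rewrite -(integral_conv_kernel hG lcG f g) L1normE.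
have [S sS kS] := conv_kernel_supp hG lcG f g.
have [m1 _ _] := cmod_kernel_tonelli mu hG lcG sS (cmeasurable_conv_kernel f g) kS.
apply: ge0_ae_eq_integral => //.
- exact: L1_measurable_cmod.
- by move=> x _; rewrite lee_fin cmod_ge0.
- by move=> x _; apply: integral_ge0 => y _; rewrite lee_fin cmod_ge0.
apply: filterS (conv_ae_fin hG lcG f g) => x fx _.
rewrite convE// (nonneg_cintegral (f := MkL1 (conv_section fx))).
  by rewrite cmod_real ger0_norm ?L1norm_ge0// L1normE.
by move=> y /=; exact: mulr_ge0.
Qed.

Lemma L1nonneg_translate z f : L1nonneg f -> L1nonneg (translate z f).
Proof. by move=> f0 x; exact: f0. Qed.

Lemma L1nonneg_inv f : L1nonneg f -> L1nonneg (L1inv f).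
Proof.
move=> f0 x; rewrite L1invE mulr_ge0// ler0c invr_ge0 ltW//; exact: (modular_gt0 mDelta).
Qed.

(** Minkowski's integral inequality, via Tonelli: the left side is the integral over [y] of [g y]
    times the difference of the translates of [h] by [y^-1] and [d^-1]. The bound [b] is a function
    so that it can be small on a compact set and merely bounded off it. *)
Lemma conv_estimate g h d (b : G -> R) : measurable_fun setT (b : borel G -> R) ->
  (forall y, g y != 0 -> N (translate (y^-1)%g h - translate (d^-1)%g h) <= b y) ->
  ((N (conv g h - cintegral mu g *: translate (d^-1)%g h))%:E <=
    2%:E * \int[mu]_y (cmod (g y) * b y)%:E)%E.
Proof.
move=> mb gb; pose k (p : G * G) := g p.2 * (h (p.2^-1 * p.1)%g - h (d^-1 * p.1)%g).
have mk : cmeas2 k.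
  apply: cmeasurableM.
    apply: (cmeasurable_comp (L1_cmeasurable g)).
    by apply: measurable_fun_continuous2 => p; exact: cvg_snd.
  apply: cmeasurableD.
    apply: (cmeasurable_comp (L1_cmeasurable h)).
    exact: measurable_fun_continuous2 (@continuous_div21 G).
  apply: cmeasurableN; apply: (cmeasurable_comp (L1_cmeasurable h)).
  apply: measurable_fun_continuous2; apply: continuous_mulg => p; [exact: cvg_cst|exact: cvg_fst].
have [S [sS [S1 SM SV] Sd gS hS]] := L1_subgroup_supp hG lcG g h d.
have kS x y : k (x, y) != 0 -> S x /\ S y.
  rewrite /k /= mulf_eq0 negb_or => /andP[/gS Sy hh]; split => //.
  have [hy|hy] := eqVneq (h (y^-1 * x)%g) 0.
    move: hh; rewrite hy add0r oppr_eq0 => /hS Sdx.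
    by rewrite -(mulVKg d x); exact: SM.
  by rewrite -(mulVKg y x); apply: SM => //; exact: hS.
have [m1 m2 T] := cmod_kernel_tonelli mu hG lcG sS mk kS.
have i1 (x : borel G) : (0 <= \int[mu]_y (cmod (k (x, y)))%:E)%E.
  by apply: integral_ge0 => y _; rewrite lee_fin cmod_ge0.
have i2 (y : borel G) : (0 <= \int[mu]_x (cmod (k (x, y)))%:E)%E.
  by apply: integral_ge0 => x _; rewrite lee_fin cmod_ge0.
apply: (@le_trans _ _ (\int[mu]_x (2%:E * \int[mu]_y (cmod (k (x, y)))%:E))%E).
  apply: L1norm_le_integral; first exact: measurable_funeM.
    apply: filterS (conv_ae_fin hG lcG g h) => x gx.
    rewrite (_ : _ x = cintegral mu (fun y => k (x, y))); first exact: (cmod_kernel_le mu mk).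
    rewrite L1valB L1valZ translateE convE//.
    have -> : (fun y => k (x, y)) = (- h (d^-1 * x)%g) *: g + MkL1 (conv_section gx).
      by apply/funext => y; rewrite !(L1valD, L1valZ) /k /= mulrBr addrC mulNr (mulrC (g y) (h (d^-1 * x)%g)).
    by rewrite cintegral_linear mulNr mulrC addrC.
  by move=> x; rewrite mule_ge0.
rewrite ge0_integralZl; [|exact: measurableT|exact: m1|by move=> x _; exact: i1|by []].
rewrite T; apply: lee_wpmul2l; first by rewrite lee_fin.
move: m2 => mT; clear m1 T i1 i2 kS hS gS Sd sS mk.
have knorm y : (\int[mu]_x (cmod (k (x, y)))%:E =
    (cmod (g y) * N (translate (y^-1)%g h - translate (d^-1)%g h))%:E)%E.
  rewrite EFinM L1normE -ge0_integralZl; first last.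
  - by rewrite lee_fin cmod_ge0.
  - by move=> x _; rewrite lee_fin cmod_ge0.
  - exact: L1_measurable_cmod.
  - exact: measurableT.
  by apply: eq_integral => x _; rewrite /k cmodM EFinM.
have knorm_le y : cmod (g y) * N (translate (y^-1)%g h - translate (d^-1)%g h) <=
    cmod (g y) * b y.
  have [->|gy] := eqVneq (g y) 0; first by rewrite cmod0 !mul0r.
  by apply: ler_wpM2l; [exact: cmod_ge0|exact: gb].
apply: ge0_le_integral.
- exact: measurableT.
- by move=> y _; apply: integral_ge0 => x _; rewrite lee_fin cmod_ge0.
- exact: mT.
- apply/measurable_EFinP; apply: measurable_funM => //.
  exact: cmeasurable_cmod (L1_cmeasurable g).
- by move=> y _; rewrite knorm lee_fin knorm_le.
Qed.

End convolution_algebra.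

(** * Density of simple functions and continuity of translation *)

Section L1_density.
Context (G : topologicalGroupType) (R : realType) (mu : leftHaarMeasure G R).
Local Notation C := R[i].
Local Notation L1 := (L1 mu).
Local Notation N := (@L1norm G R mu).
Implicit Types (f g h : L1) (E : set G).
Local Notation mbl A := (measurable (A : set (borel G))).

Definition indL1 E : L1 := insubd (0 : L1) (fun x => (\1_E x : R)%:C%C).

Lemma cmeasurable_real (u : G -> R) : measurable_fun setT (u : borel G -> R) ->
  cmeasurable (@open G) (fun x => (u x)%:C%C).
Proof. by split => //=; exact: measurable_cst. Qed.

Lemma L1pred_real (u : G -> R) : mu.-integrable setT (EFin \o (u : borel G -> R)) ->
  (fun x => (u x)%:C%C) \in L1pred mu.
Proof. by move=> iu; rewrite inE; split => //=; exact: integrable0. Qed.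

Lemma indL1E E x : mbl E -> (mu E < +oo)%E -> indL1 E x = (\1_E x : R)%:C%C.
Proof.
move=> mE Eoo; rewrite /indL1; set u : G -> C := (fun x => _).
suff u1 : u \in L1pred mu by rewrite (insubdK (0 : L1) u1).
apply: L1pred_real; apply/integrableP; split.
  by apply/measurable_EFinP; exact: measurable_indic.
under eq_integral do rewrite /= ger0_norm//.
by rewrite integral_indic// setIT.
Qed.

Lemma L1norm_indic_le f E : mbl E -> (forall x, cmod (f x) <= \1_E x) -> ((N f)%:E <= mu E)%E.
Proof.
move=> mE fE; have -> : mu E = (\int[mu]_x (\1_E x : R)%:E)%E.
  by rewrite integral_indic// setIT.
apply: L1norm_le_integral; first by apply/measurable_EFinP; exact: measurable_indic.
  by apply: aeW => x; rewrite lee_fin.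
by move=> x; rewrite lee_fin.
Qed.

Lemma L1val_sum (I : Type) (r : seq I) (F : I -> L1) x :
  (\sum_(i <- r) F i) x = \sum_(i <- r) F i x.
Proof. by elim: r => [|i r IH]; rewrite ?big_nil// !big_cons L1valD IH. Qed.

Section density.
Variable P : L1 -> Prop.
Hypothesis P_lin : forall (a : C) f g, P f -> P g -> P (a *: f + g).
Hypothesis P_ind : forall E, mbl E -> (mu E < +oo)%E -> P (indL1 E).
Hypothesis P_lim : forall f, (forall e : R, 0 < e -> exists2 g, P g & N (f - g) <= e) -> P f.

Let P0 : P 0.
Proof.
have P00 : P (indL1 set0) by apply: P_ind => //; rewrite measure0.
by have := P_lin (-1) P00 P00; rewrite scaleN1r addNr.
Qed.

Let PZ (a : C) f : P f -> P (a *: f).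
Proof. by move=> Pf; have := P_lin a Pf P0; rewrite addr0. Qed.

Let PD f g : P f -> P g -> P (f + g).
Proof. by move=> Pf Pg; have := P_lin 1 Pf Pg; rewrite scale1r. Qed.

Import HBSimple.

Let P_sfun (s : {sfun borel G >-> R}) f : mu.-integrable setT (EFin \o s) ->
  (forall x, f x = (s x)%:C%C) -> P f.
Proof.
move=> si fs.
(* Markov's inequality. The level 0 is excluded: its set may have infinite measure, and its term
   vanishes. *)
have fin y : y != 0 -> (mu (s @^-1` [set y]) < +oo)%E.
  move=> y0; have ny : 0 < `|y| by rewrite normr_gt0.
  have mS : mbl (s @^-1` [set y]) by exact: measurable_sfunP.
  have [/measurable_EFinP ms foo] := integrableP _ _ _ si.
  move: foo; rewrite ltNge leye_eq => foo.
  have le : (`|y|%:E * mu (s @^-1` [set y]) <= \int[mu]_x `|(EFin \o s) x|)%E.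
    apply: le_trans (le_integral_abse mu measurableT (measurable_int _ si) ny).
    apply: lee_pmul => //; apply: le_measure; rewrite ?inE//.
      apply: emeasurable_fun_c_infty => //.
      by apply: measurableT_comp => //; exact/measurable_EFinP.
    by move=> x /= <-; split => //=; rewrite lee_fin.
  rewrite ltNge leye_eq; apply: contra foo => /eqP Eoo; move: le.
  by rewrite Eoo gt0_muley ?lte_fin// leye_eq.
rewrite (_ : f = \sum_(y <- finmap.enum_fset (fset_set (range s))) y%:C%C *: indL1 (s @^-1` [set y])).
  elim/big_ind : _ => // y _.
  have [->|y0] := eqVneq y 0; first by rewrite scale0r.
  by apply: PZ; apply: P_ind; [exact: measurable_sfunP|exact: fin].
apply: L1_ext => x; rewrite L1val_sum fs [in LHS]fimfunE fsbig_finite//=.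
rewrite rmorph_sum /=; apply: eq_bigr => y _.
transitivity (y%:C%C * indL1 (s @^-1` [set y]) x); last by [].
rewrite rmorphM /=; have [->|y0] := eqVneq y 0; first by rewrite !mul0r.
by rewrite indL1E//; exact: fin.
Qed.

Let P_real (u : G -> R) f : (forall x, f x = (u x)%:C%C) -> P f.
Proof.
move=> fu; apply: P_lim => e e0.
have iu : mu.-integrable setT (EFin \o (u : borel G -> R)).
  have [fr _] := L1P f; apply: (eq_integrable measurableT) fr => x _ /=.
  by rewrite fu.
have [s [si _ s0]] := approximation_sfun_integrable measurableT iu.
have se : (0 < e%:E)%E by rewrite lte_fin.
have [n _ /(_ _ (leqnn n)) ne] := s0 _ (open_ereal_lt' se).
have sn1 : (fun x => (s n x)%:C%C) \in L1pred mu by apply: L1pred_real; exact: si.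
exists (MkL1 sn1); first exact: (P_sfun (si n)).
rewrite -lee_fin L1normE; apply: ltW; apply: le_lt_trans ne.
have -> : (\int[mu]_x (cmod ((f - MkL1 sn1) x))%:E = \int[mu]_x `|(u x)%:E - (s n x)%:E|)%E.
  by apply: eq_integral => x _; rewrite L1valB fu -rmorphB /= cmod_real.
by [].
Qed.

(** An induction principle: split [f] into real and imaginary parts, approximate each by integrable
    simple functions, and write these as combinations of indicators. *)
Lemma L1_dense_ind f : P f.
Proof.
have [fr fi] := L1P f.
rewrite (_ : f = MkL1 (L1pred_real fr) + 'i%C *: MkL1 (L1pred_real fi)).
  by apply: PD; [exact: P_real|apply: PZ; exact: P_real].
by apply: L1_ext => x; rewrite L1valD L1valZ /= [LHS]complexE.
Qed.

End density.
End L1_density.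

Section L1_continuity.
Context (G : topologicalGroupType) (R : realType) (mu : leftHaarMeasure G R).
Hypothesis hG : hausdorff_space G.
Hypothesis lcG : locally_compact [set: G].
Local Notation C := R[i].
Local Notation L1 := (L1 mu).
Local Notation N := (@L1norm G R mu).
Local Notation indL1 := (@indL1 G R mu).
Implicit Types (f g h : L1) (E A K : set G) (e : R).
Local Notation mbl A := (measurable (A : set (borel G))).

Definition restrL1 A f : L1 := insubd (0 : L1) (fun x => f x * (\1_A x : R)%:C%C).

Lemma restrL1E A f x : mbl A -> restrL1 A f x = f x * (\1_A x : R)%:C%C.
Proof.
move=> mA; rewrite /restrL1; set u : G -> C := (fun x => _).
suff u1 : u \in L1pred mu by rewrite (insubdK (0 : L1) u1).
apply: (L1pred_le _ (L1_measurable_cmod f)).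
- apply: cmeasurableM; first exact: L1_cmeasurable.
  by apply: cmeasurable_real; exact: measurable_indic.
- move=> y; rewrite /u cmodM cmod_real lee_fin -[leRHS]mulr1 ler_wpM2l ?cmod_ge0//.
  by rewrite ger0_norm// indicE; case: (_ \in _).
- by rewrite -L1normE ltry.
Qed.

Lemma restrL1_linear A (a : C) f g : mbl A ->
  restrL1 A (a *: f + g) = a *: restrL1 A f + restrL1 A g.
Proof.
move=> mA; apply: L1_ext => x; rewrite !(L1valD, L1valZ, restrL1E)// mulrDl mulrA//.
Qed.

Lemma L1norm_restr A f : mbl A -> N (restrL1 A f) <= N f.
Proof.
move=> mA; apply: L1norm_le; apply: aeW => x; rewrite restrL1E// cmodM cmod_real.
rewrite -[leRHS]mulr1 ler_wpM2l ?cmod_ge0// ger0_norm// indicE; by case: (_ \in _).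
Qed.

Lemma L1norm_restrC A f : mbl A -> N (f - restrL1 A f) <= N f.
Proof.
move=> mA; apply: L1norm_le; apply: aeW => x; rewrite L1valB restrL1E//.
rewrite -[X in X - _]mulr1 -mulrBr -rmorphB /= cmodM cmod_real.
rewrite -[leRHS]mulr1 ler_wpM2l ?cmod_ge0// indicE; case: (_ \in _) => /=.
  by rewrite subrr normr0.
by rewrite subr0 normr1.
Qed.

Lemma L1norm_restrC_le A B f : mbl A -> mbl B -> A `<=` B ->
  N (f - restrL1 B f) <= N (f - restrL1 A f).
Proof.
move=> mA mB AB; apply: L1norm_le; apply: aeW => x; rewrite !L1valB !restrL1E// !indicE.
have [xA|_] := boolP (x \in A).
  by rewrite mem_set//; apply: AB; exact: set_mem.
by case: (_ \in _); rewrite /= ?mulr1 ?mulr0 ?subrr ?subr0 ?cmod0 ?cmod_ge0.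
Qed.

Lemma L1_tight f e : 0 < e -> exists2 Q, compact Q & N (f - restrL1 Q f) <= e.
Proof.
move: f e; apply: (L1_dense_ind (P := fun f => forall e, 0 < e ->
  exists2 Q, compact Q & N (f - restrL1 Q f) <= e)).
- move=> a f g Pf Pg e e0; have a0 := cmod_ge0 a.
  have [|Q1 cQ1 Q1e] := Pf (e / 2 / (cmod a + 1)).
    by rewrite !divr_gt0// ltr_wpDl.
  have [|Q2 cQ2 Q2e] := Pg (e / 2); first by rewrite divr_gt0.
  have m1 := compact_mbl hG cQ1; have m2 := compact_mbl hG cQ2.
  have mU : mbl (Q1 `|` Q2) by exact: measurableU.
  exists (Q1 `|` Q2); first exact: compactU.
  rewrite restrL1_linear// opprD addrACA -scalerBr.
  apply: (le_trans (L1normD _ _)); rewrite L1normZ [leRHS](splitr e); apply: lerD.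
    apply: (@le_trans _ _ (cmod a * (e / 2 / (cmod a + 1)))).
      apply: ler_wpM2l => //; apply: le_trans Q1e.
      exact: (L1norm_restrC_le f m1 mU (@subsetUl _ _ _)).
    rewrite mulrCA ler_piMr//; first by rewrite divr_ge0// ltW.
    by rewrite ler_pdivrMr ?mul1r ?lerDl// ltr_wpDl.
  by apply: le_trans Q2e; exact: (L1norm_restrC_le g m2 mU (@subsetUr _ _ _)).
- move=> E mE Eoo e e0; have [K [cK KE Ke]] := haar_inner_fin hG mE Eoo e0.
  have mK := compact_mbl hG cK; exists K => //.
  rewrite -lee_fin; apply: le_trans Ke; apply: L1norm_indic_le; first exact: measurableD.
  move=> x; rewrite L1valB restrL1E// indL1E// -rmorphM -rmorphB /= cmod_real.
  rewrite !indicE in_setD; case: (x \in E); case: (x \in K) => /=;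
    by rewrite ?(mulr0, mul0r, mulr1, subr0, subrr, normr0, normr1).
- move=> f Pf e e0; have e20 : 0 < e / 2 by rewrite divr_gt0.
  have [g Pg fg] := Pf _ e20; have [Q cQ Qe] := Pg _ e20.
  have mQ := compact_mbl hG cQ; exists Q => //.
  have -> : f - restrL1 Q f = (f - g - restrL1 Q (f - g)) + (g - restrL1 Q g).
    apply: L1_ext => x; rewrite !(L1valD, L1valN, restrL1E)//; ring.
  apply: (le_trans (L1normD _ _)); rewrite [leRHS](splitr e); apply: lerD => //.
  by apply: le_trans fg; exact: L1norm_restrC.
Qed.

Lemma translateB (w : G) f g : translate w (f - g) = translate w f - translate w g.
Proof. by apply: L1_ext. Qed.

(** For [w] near 1 the translate of [K] stays inside a tight open [O] around [K], which bounds one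
    half of the symmetric difference. Left invariance carries the other half to the first half for
    [w^-1], so the neighbourhood is made symmetric. *)
Lemma translate_ind_compact K e : compact K -> 0 < e ->
  exists W : set G, [/\ open W, W 1%g &
    forall w, W w -> N (translate w (indL1 K) - indL1 K) <= e].
Proof.
move=> cK e0; have mK := compact_mbl hG cK.
have Kf := haar_compact_fin mu cK; have Koo : (mu K < +oo)%E by exact: haar_compact.
have [ O [oO KO Oe]] : exists O, [/\ open O, K `<=` O & (mu O < mu K + (e / 2)%:E)%E].
  by apply: haar_outer_lt => //; rewrite lteDl// lte_fin divr_gt0.
have mO := open_mbl oO.
have OKe : (mu (O `\` K) <= (e / 2)%:E)%E.
  rewrite measureD ?setIidr//; last by rewrite (lt_trans Oe)// -(fineK Kf) -EFinD ltry.
  by rewrite leeBlDr// addeC ltW.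
have oE : open [set p : G * G | O (p.1^-1 * p.2)%g].
  apply: (@open_preimage _ _ (fun p : G * G => p.1^-1 * p.2)%g) => //.
  apply: continuous_mulg; last by move=> p; exact: cvg_snd.
  by apply: continuous_invg => p; exact: cvg_fst.
have [|V [V' [oV V1 _ KV VO]]] := tube_lemma (x := 1%g) oE cK.
  by move=> y /KO; rewrite /= invg1 mul1g.
have aux w : V w -> (mu ([set x | K (w * x)%g] `\` K) <= (e / 2)%:E)%E.
  move=> Vw; apply: le_trans OKe; apply: le_haar; [|exact: measurableD|].
    by apply: measurableD => //; exact: mbl_mull.
  move=> x [/= Kwx nKx]; split => //.
  by have := VO _ _ Vw (KV _ Kwx); rewrite /= mulKg.
exists (V `&` [set w | V (w^-1)%g]); split.
- by apply: openI => //; exact: open_inv.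
- by split => //=; rewrite invg1.
move=> w [Vw Vw1]; pose A := [set x | K (w * x)%g] `\` K; pose B := K `\` [set x | K (w * x)%g].
have mA : mbl A by apply: measurableD => //; exact: mbl_mull.
have mB : mbl B by apply: measurableD => //; exact: mbl_mull.
have Be : (mu B <= (e / 2)%:E)%E.
  pose B' := [set x | K (w^-1 * x)%g] `\` K.
  have mB' : mbl B' by apply: measurableD => //; exact: mbl_mull.
  apply: (@le_trans _ _ (mu [set x | B' (w * x)%g])).
    apply: le_haar => //; first exact: mbl_mull.
    by move=> x [Kx nKwx]; split => //=; rewrite mulKg.
  by rewrite haar_mull//; exact: aux.
rewrite -lee_fin; apply: (@le_trans _ _ (mu (A `|` B))).
  apply: L1norm_indic_le; first exact: measurableU.
  move=> x; rewrite L1valB translateE !indL1E// -rmorphB /= cmod_real !indicE.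
  rewrite in_setU !in_setD.
  have -> : (x \in [set x | K (w * x)%g]) = ((w * x)%g \in K) by apply/idP/idP; rewrite !inE.
  by case: (_ \in K); case: (_ \in K) => /=; rewrite ?subrr ?sub0r ?subr0 ?normrN ?normr0 ?normr1.
apply: (le_trans (haarU_le mu mA mB)); rewrite [X in (_ <= X%:E)%E](splitr e) EFinD leeD//.
exact: aux.
Qed.

Lemma translate_continuous h e : 0 < e ->
  exists W : set G, [/\ open W, W 1%g & forall w, W w -> N (translate w h - h) <= e].
Proof.
have lim f : (forall e, 0 < e -> exists2 g, (forall e, 0 < e ->
    exists W : set G, [/\ open W, W 1%g & forall w, W w -> N (translate w g - g) <= e]) &
    N (f - g) <= e) -> (forall e, 0 < e ->
    exists W : set G, [/\ open W, W 1%g & forall w, W w -> N (translate w f - f) <= e]).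
  move=> Pf {}e e0; have e30 : 0 < e / 3 by rewrite divr_gt0.
  have [g Pg fg] := Pf _ e30; have [W [oW W1 We]] := Pg _ e30.
  exists W; split => // w /We wg.
  have -> : translate w f - f = translate w (f - g) + (translate w g - g) + (g - f).
    rewrite translateB; apply: L1_ext => x; rewrite !(L1valD, L1valN); ring.
  have -> : e = e / 3 + e / 3 + e / 3 by field.
  apply: (le_trans (L1normD _ _)); rewrite L1norm_distC; apply: lerD => //.
  by apply: (le_trans (L1normD _ _)); rewrite L1norm_translate lerD.
move: h e; apply: (L1_dense_ind (P := fun h => forall e, 0 < e ->
  exists W : set G, [/\ open W, W 1%g & forall w, W w -> N (translate w h - h) <= e])) => //.
- move=> a f g Pf Pg e e0; have a0 := cmod_ge0 a.
  have [|W1 [oW1 W11 W1e]] := Pf (e / 2 / (cmod a + 1)).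
    by rewrite !divr_gt0// ltr_wpDl.
  have [|W2 [oW2 W21 W2e]] := Pg (e / 2); first by rewrite divr_gt0.
  exists (W1 `&` W2); split => //; first exact: openI.
  move=> w [/W1e w1 /W2e w2].
  have -> : translate w (a *: f + g) - (a *: f + g) =
      a *: (translate w f - f) + (translate w g - g).
    apply: L1_ext => x; rewrite !(L1valD, L1valN, L1valZ, translateE); ring.
  apply: (le_trans (L1normD _ _)); rewrite L1normZ [leRHS](splitr e); apply: lerD => //.
  apply: (@le_trans _ _ (cmod a * (e / 2 / (cmod a + 1)))); first exact: ler_wpM2l.
  rewrite mulrCA ler_piMr//; first by rewrite divr_ge0// ltW.
  by rewrite ler_pdivrMr ?mul1r ?lerDl// ltr_wpDl.
- move=> E mE Eoo; apply: lim => e e0.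
  have [K [cK KE Ke]] := haar_inner_fin hG mE Eoo e0; have mK := compact_mbl hG cK.
  have Koo : (mu K < +oo)%E by exact: haar_compact.
  exists (indL1 K); first by move=> e' e'0; exact: translate_ind_compact.
  rewrite -lee_fin; apply: le_trans Ke; apply: L1norm_indic_le; first exact: measurableD.
  move=> x; rewrite L1valB !indL1E// -rmorphB /= cmod_real !indicE in_setD.
  case: (boolP (x \in K)) => [/set_mem /KE /mem_set ->|_] /=; first by rewrite subrr normr0.
  by rewrite subr0 ger0_norm// andbT.
Qed.

End L1_continuity.

(** * Functionals and means *)

Section Linf_theory.
Context (G : topologicalGroupType) (R : realType) (mu : leftHaarMeasure G R).
Hypothesis hG : hausdorff_space G.
Hypothesis lcG : locally_compact [set: G].
Context (Delta : G -> R) (mDelta : modular_function mu Delta).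
Local Notation C := R[i].
Local Notation L1 := (L1 mu).
Local Notation Linf := (Linf mu).
Local Notation N := (@L1norm G R mu).
Local Notation conv := (@Defs.conv G R mu).
Local Notation L1inv := (L1inv hG lcG mDelta).
Local Notation L1rt := (L1rt hG lcG mDelta).
Implicit Types (f g h : L1) (S T L : Linf) (e : R) (A : set G).
Local Notation mbl A := (measurable (A : set (borel G))).

Lemma Linf_linear T (a : C) f g : T (a *: f + g) = a * T f + T g.
Proof. by have := valP T; rewrite inE => -[+ _]; exact. Qed.

Lemma LinfD T f g : T (f + g) = T f + T g.
Proof. by rewrite -[f]scale1r Linf_linear scale1r mul1r. Qed.

Lemma Linf0 T : T 0 = 0.
Proof. by apply: (addIr (T 0)); rewrite -LinfD addr0 add0r. Qed.

Lemma LinfZ T (a : C) f : T (a *: f) = a * T f.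
Proof. by have := Linf_linear T a f 0; rewrite !addr0 Linf0 addr0. Qed.

Lemma LinfB T f g : T (f - g) = T f - T g.
Proof. by rewrite LinfD -scaleN1r LinfZ mulN1r. Qed.

Lemma Linf_bound T : exists2 M, 0 < M & forall f, cmod (T f) <= M * N f.
Proof.
have := valP T; rewrite inE => -[_ [M MT]]; exists (`|M| + 1); first by rewrite ltr_wpDl.
move=> f; rewrite -lecR cmodE; apply: (le_trans (MT f)); rewrite lecR.
by rewrite ler_wpM2r ?L1norm_ge0// (le_trans (ler_norm _))// lerDl.
Qed.

Lemma Linf_eq T f g : L1eq f g -> T f = T g.
Proof.
move=> fg; have [M _ MT] := Linf_bound T.
apply/eqP; rewrite -subr_eq0 -LinfB -cmod_eq0 eq_le cmod_ge0 andbT.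
by apply: (le_trans (MT _)); rewrite fg mulr0.
Qed.

Lemma Linf_ext S T : (forall f, S f = T f) -> S = T.
Proof. by move=> ST; apply: val_inj; apply/funext. Qed.

Lemma Linfpred_comp (T : Linf) (A : L1 -> L1) (c : R) :
  (forall (a : C) f g, L1eq (A (a *: f + g)) (a *: A f + A g)) ->
  (forall f, N (A f) <= c * N f) -> (fun f => T (A f)) \in @Linfpred _ _ mu.
Proof.
move=> lA bA; have [M M0 MT] := Linf_bound T; rewrite inE; split.
  by move=> a f g; rewrite (Linf_eq T (lA a f g)) Linf_linear.
exists (M * c) => f; rewrite -cmodE lecR; apply: (le_trans (MT _)).
by rewrite -mulrA ler_wpM2l// ltW.
Qed.

Lemma lmodactE f T g : lmodact f T g = T (conv f g).
Proof.
rewrite /lmodact insubdK//; apply: (@Linfpred_comp T (conv f) (2 * N f)).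
  by move=> a g1 g2; exact: conv_linear_r.
by move=> g1; rewrite -mulrA; exact: L1norm_conv.
Qed.

Lemma rmodactE f T g : rmodact T f g = T (conv g f).
Proof.
rewrite /rmodact (insubdK (0 : Linf) (_ : (fun g => T (conv g f)) \in _))//.
apply: (@Linfpred_comp T (conv^~ f) (2 * N f)).
  by move=> a g1 g2; exact: conv_linear_l.
by move=> g1; rewrite -mulrA (mulrC (N f)); exact: L1norm_conv.
Qed.

Lemma L1norm_restr_split A O g : mbl A -> mbl O ->
  N (restrL1 A g) = N (restrL1 (A `&` O) g) + N (restrL1 (A `\` O) g).
Proof.
move=> mA mO; have m1 : mbl (A `&` O) by exact: measurableI.
have m2 : mbl (A `\` O) by exact: measurableD.
apply: EFin_inj; rewrite EFinD !L1normE -ge0_integralD//.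
- apply: eq_integral => x _; rewrite -EFinD; congr EFin.
  rewrite !restrL1E// !cmodM !cmod_real -mulrDr; congr (_ * _).
  rewrite !indicE in_setI in_setD; case: (_ \in A); case: (_ \in O) => /=;
  by rewrite ?normr0 ?normr1 ?addr0 ?add0r.
- by move=> x _; rewrite lee_fin cmod_ge0.
- exact: L1_measurable_cmod.
- by move=> x _; rewrite lee_fin cmod_ge0.
- exact: L1_measurable_cmod.
Qed.

(* [Linf] is the dual of [L1], with no representation by bounded functions: bounded
   functionals are localized by cutting integrable functions into small pieces. *)
Lemma Linf_local_eq0 S :
  (forall e, 0 < e -> forall x, exists O : set G, [/\ open O, O x &
    forall g, supported g O -> cmod (S g) <= e * N g]) -> forall g, S g = 0.
Proof.
move=> Sloc g; have [M M0 MS] := Linf_bound S.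
suff Sle : forall e, 0 < e -> cmod (S g) <= e * (N g + M).
  apply/eqP; rewrite -cmod_eq0 eq_le cmod_ge0 andbT; apply/ler_addgt0Pr => e e0; rewrite add0r.
  have NM : 0 < N g + M by rewrite ltr_wpDl// L1norm_ge0.
  by have := Sle (e / (N g + M)); rewrite divfK ?gt_eqF//; apply; rewrite divr_gt0.
move=> e e0; have [Q cQ Qe] := L1_tight hG g e0.
have /choice[ O OP] := Sloc e e0.
have [|x Qx|s _ Qs] := compact_cover_seq (D := setT) (f := O) cQ.
- by move=> x _; have [] := OP x.
- by exists x => //; have [] := OP x.
(* Induction on the finite cover, cutting [A] along [O y]. Norms add up over disjoint pieces, so the
   constant [e] does not grow with the number of pieces. *)
have key (t : seq G) A : mbl A -> (forall x, A x -> exists2 i, i \in t & O i x) ->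
    cmod (S (restrL1 A g)) <= e * N (restrL1 A g).
  elim: t A => [|y t IH] A mA At.
    rewrite (_ : restrL1 A g = 0) ?Linf0 ?cmod0 ?mulr_ge0 ?L1norm_ge0// ?ltW//.
    apply: L1_ext => x; rewrite restrL1E// indicE memNset ?mulr0// => /At[z].
    by rewrite in_nil.
  have [oO _ OS] := OP y; have mO := open_mbl oO.
  have m1 : mbl (A `&` O y) by exact: measurableI.
  have m2 : mbl (A `\` O y) by exact: measurableD.
  rewrite (L1norm_restr_split g mA mO) mulrDr.
  have -> : restrL1 A g = restrL1 (A `&` O y) g + restrL1 (A `\` O y) g.
    apply: L1_ext => x; rewrite L1valD !restrL1E// -mulrDr -rmorphD /=; congr (_ * _%:C%C).
    rewrite !indicE in_setI in_setD; case: (_ \in A); case: (_ \in O y) => /=;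
    by rewrite ?addr0 ?add0r.
  rewrite LinfD; apply: (le_trans (cmodD _ _)); apply: lerD.
    apply: OS => x; rewrite restrL1E// mulf_eq0 negb_or => /andP[_].
    rewrite indicE; case: (boolP (x \in _)) => [/set_mem[]//|_].
    by rewrite /= eqxx.
  apply: IH => // x [Ax nOx]; have [z] := At x Ax.
  by rewrite inE => /orP[/eqP ->//|zt Oz]; exists z.
have -> : S g = S (g - restrL1 Q g) + S (restrL1 Q g) by rewrite -LinfD subrK.
apply: (le_trans (cmodD _ _)); rewrite mulrDr addrC; apply: lerD.
  apply: (@le_trans _ _ (e * N (restrL1 Q g))).
    apply: (key s); first exact: compact_mbl.
    by move=> x /Qs[i si Oix]; exists i.
  by rewrite ler_wpM2l ?(ltW e0)//; apply: L1norm_restr; exact: compact_mbl.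
by apply: (le_trans (MS _)); rewrite mulrC ler_wpM2r// ltW.
Qed.

(** Near [x] the value [S g] is [T] of the error term of [conv_estimate], hence small relative to
    the norm of [g]. The centre [d] is [x] itself in [conv_invariant], but a point of a prescribed
    net in [lmodact_eq_net]. *)
Lemma conv_local_eq0 S T h :
  (forall e, 0 < e -> forall x, exists (O : set G) (d : G), [/\ open O, O x,
    forall y, O y -> N (translate (y^-1)%g h - translate (d^-1)%g h) <= e &
    forall g, S g = T (conv g h - cintegral mu g *: translate (d^-1)%g h)]) ->
  forall g, S g = 0.
Proof.
move=> Sh; have [M M0 MT] := Linf_bound T; apply: Linf_local_eq0 => e e0 x.
have [| O [d [oO Ox Oh ST]]] := Sh (e / (2 * M)) _ x; first by rewrite divr_gt0// mulr_gt0.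
exists O; split => // g gO; rewrite ST; apply: (le_trans (MT _)).
have : N (conv g h - cintegral mu g *: translate (d^-1)%g h) <= 2 * (N g * (e / (2 * M))).
  rewrite -lee_fin.
  apply: (le_trans (conv_estimate hG lcG (b := fun=> e / (2 * M)) _ _)).
  - exact: measurable_cst.
  - by move=> y /gO /Oh.
  rewrite EFinM; apply: lee_pmul => //.
    by apply: integral_ge0 => y _; rewrite lee_fin mulr_ge0 ?cmod_ge0// divr_ge0 ?mulr_ge0// ltW.
  under eq_integral do rewrite EFinM.
  rewrite ge0_integralZr//; first by rewrite -L1normE EFinM.
  - exact: L1_measurable_cmod.
  - by move=> y _; rewrite lee_fin cmod_ge0.
  - by rewrite lee_fin divr_ge0 ?mulr_ge0// ltW.
move=> /(ler_wpM2l (ltW M0)) /le_trans; apply.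
by rewrite le_eqVlt; apply/orP; left; apply/eqP; field; rewrite gt_eqF.
Qed.

Lemma translate_near h e : 0 < e -> exists W : set G, [/\ open W, W 1%g &
  forall y d, W (y^-1 * d)%g -> N (translate (y^-1)%g h - translate (d^-1)%g h) <= e].
Proof.
move=> e0; have [W [oW W1 We]] := translate_continuous hG h e0.
exists W; split => // y d /We; rewrite -(L1norm_translate (d^-1)%g) translateB translateM.
by rewrite mulgK.
Qed.

(** Formally [L] passes under the integral defining [conv g h], a superposition of left translates
    of [h]. Vector-valued integration is avoided: the difference of the two sides is a bounded
    functional of [g] that is locally 0. *)
Lemma conv_invariant L h : (forall c f, L (translate c f) = L f) ->
  forall g, L (conv g h) = cintegral mu g * L h.
Proof.
move=> Linv g; have [M M0 ML] := Linf_bound L.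
have S1 : (fun g => L (conv g h) - cintegral mu g * L h) \in @Linfpred _ _ mu.
  rewrite inE; split.
    move=> a f1 f2; rewrite (Linf_eq L (conv_linear_l hG lcG a f1 f2 h)) Linf_linear.
    rewrite cintegral_linear /GRing.scale /=; ring.
  exists (2 * (M * N h) + 2 * cmod (L h)) => f; rewrite -cmodE lecR mulrDl.
  apply: (le_trans (cmodD _ _)); rewrite cmodN; apply: lerD.
    apply: (le_trans (ML _)); rewrite -!mulrA mulrCA ler_wpM2l ?(ltW M0)//.
    by rewrite (mulrC (N h)); exact: L1norm_conv.
  by rewrite cmodM -mulrA (mulrC (cmod (L h))) mulrA ler_wpM2r ?cmod_ge0// cmod_cintegral.
suff : (MkLinf S1 : Linf) g = 0 by move/eqP; rewrite subr_eq0 => /eqP.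
apply: (conv_local_eq0 (T := L) (h := h)) => e e0 x.
have [W [oW W1 We]] := translate_near h e0.
exists [set y | W (y^-1 * x)%g], x; split => //.
- by apply: (@open_preimage _ _ (fun y => y^-1 * x)%g) => //; apply: continuous_mulg => y;
    [exact: invg_continuous|exact: cvg_cst].
- by rewrite /= mulVg.
- by move=> y; exact: We.
- by move=> g'; rewrite LinfB LinfZ Linv.
Qed.

(** Nonnegative at every point, unlike [P1]; [P1_density] supplies such a representative. *)
Definition density f := L1nonneg f /\ N f = 1.

Lemma density_P1 f : density f -> P1 f.
Proof. by move=> [f0 f1]; split => //; exact: aeW. Qed.

Lemma density_cintegral f : density f -> cintegral mu f = 1.
Proof. by move=> [f0 f1]; rewrite nonneg_cintegral// f1. Qed.

Lemma density_conv f g : density f -> density g -> density (conv f g).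
Proof.
move=> [f0 f1] [g0 g1]; split; first exact: conv_nonneg.
by rewrite L1norm_conv_nonneg// f1 g1 mulr1.
Qed.

Lemma density_inv f : density f -> density (L1inv f).
Proof. by move=> [f0 f1]; split; [exact: L1nonneg_inv|rewrite L1norm_inv]. Qed.

Lemma density_translate z f : density f -> density (translate z f).
Proof. by move=> [f0 f1]; split; [exact: L1nonneg_translate|rewrite L1norm_translate]. Qed.

Lemma density_indicator (U : set G) : open U -> U !=set0 -> (mu U < +oo)%E ->
  density (((fine (mu U))^-1)%:C%C *: indL1 mu U).
Proof.
move=> oU [u Uu] Uoo; have mU := open_mbl oU.
have U0 : 0 < fine (mu U).
  by rewrite fine_gt0// Uoo andbT; exact: haar_open_gt0 Uu.
split.
  move=> x; rewrite L1valZ indL1E// mulr_ge0// ?ler0c// invr_ge0 ltW//.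
rewrite L1normZ cmod_real ger0_norm ?invr_ge0 ?ltW//.
have -> : N (indL1 mu U) = fine (mu U).
  apply: EFin_inj; rewrite L1normE fineK ?ge0_fin_numE//.
  have -> : mu U = (\int[mu]_x (\1_U x : R)%:E)%E by rewrite integral_indic// setIT.
  by apply: eq_integral => x _; rewrite indL1E// cmod_real ger0_norm.
by rewrite mulVf// gt_eqF.
Qed.

(** The normalized indicator of a small neighbourhood of 1. One kernel treats two functions, because
    [right_invariant_cst] compares [L] at two densities. *)
Lemma approximate_identity h1 h2 e : 0 < e -> exists2 g, density g &
  N (conv g h1 - h1) <= e /\ N (conv g h2 - h2) <= e.
Proof.
move=> e0; have e20 : 0 < e / 2 by rewrite divr_gt0.
have [W1 [oW1 W11 W1e]] := translate_near h1 e20.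
have [W2 [oW2 W21 W2e]] := translate_near h2 e20.
have [U [Q [oU U1 cQ UQ]]] := compact_nbhs1 lcG.
pose V := U `&` [set y | (W1 `&` W2) (y^-1)%g].
have oV : open V by apply: openI => //; apply: open_inv; exact: openI.
have V1 : V 1%g by split => //=; rewrite invg1.
have Voo : (mu V < +oo)%E.
  apply: le_lt_trans (haar_compact (s := mu) Q cQ).
  by apply: le_haar; [exact: open_mbl|exact: compact_mbl|move=> x [/UQ]].
have mV := open_mbl oV.
have dg := density_indicator oV (ex_intro _ _ V1) Voo.
set g := (X in density X) in dg; exists g => //.
have gV : supported g V.
  move=> x; rewrite /g L1valZ indL1E// mulf_eq0 negb_or => /andP[_].
  by rewrite indicE; case: (boolP (x \in V)) => [/set_mem//|_]; rewrite eqxx.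
have key h W : (forall y d, W (y^-1 * d)%g ->
    N (translate (y^-1)%g h - translate (d^-1)%g h) <= e / 2) ->
    (forall y, V y -> W (y^-1)%g) -> N (conv g h - h) <= e.
  move=> We VW; have := @conv_estimate _ _ mu hG lcG g h 1%g (fun=> e / 2) (measurable_cst _).
  rewrite density_cintegral// scale1r invg1 translate1 -lee_fin => le.
  apply: le_trans (le _) _.
    by move=> y /gV /VW Wy; have := We y 1%g; rewrite mulg1 invg1 translate1; apply.
  under eq_integral do rewrite EFinM.
  rewrite ge0_integralZr//; last 3 first.
  - exact: L1_measurable_cmod.
  - by move=> y _; rewrite lee_fin cmod_ge0.
  - by rewrite lee_fin ltW.
  by rewrite -L1normE dg.2 mul1e -EFinM lee_fin mulrC divfK.
split; first by apply: (key _ W1) => // y [_ []].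
by apply: (key _ W2) => // y [_ []].
Qed.

(* [L \o L1inv] is left invariant, so [L (f * g) = L f] by [conv_invariant]; take
   for [f] an approximate identity. *)
Lemma right_invariant_cst L : (forall x f, L (L1rt x f) = L f) ->
  forall g h, density g -> density h -> L g = L h.
Proof.
move=> Lrt g h dg dh.
have Lst1 : (fun f => L (L1inv f)) \in @Linfpred _ _ mu.
  apply: (@Linfpred_comp L L1inv 1) => [a f1 f2|f].
    by rewrite L1inv_linear; apply: L1eq_ae; exact: aeW.
  by rewrite L1norm_inv mul1r.
pose Lst : Linf := MkLinf Lst1.
have Lst_inv c f : Lst (translate c f) = Lst f by rewrite /= L1inv_translate Lrt.
have L_conv f1 f2 : density f2 -> L (conv f1 f2) = L f1.
  move=> d2; rewrite -[conv f1 f2](L1invK hG lcG mDelta) -[LHS]/(Lst (L1inv (conv f1 f2))).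
  rewrite (Linf_eq Lst (conv_inv hG lcG mDelta f1 f2)) (conv_invariant _ Lst_inv).
  by rewrite density_cintegral ?mul1r//= ?L1invK//; exact: density_inv.
have [M M0 ML] := Linf_bound L.
apply/eqP; rewrite -subr_eq0 -cmod_eq0 eq_le cmod_ge0 andbT; apply/ler_addgt0Pr => e e0.
rewrite add0r; have [|k dk [kg kh]] := approximate_identity g h (e := e / M / 2).
  by rewrite !divr_gt0.
have -> : L g - L h = L (conv k h - h) - L (conv k g - g).
  by rewrite !LinfB !L_conv//; ring.
apply: (le_trans (cmodD _ _)); rewrite cmodN.
apply: (@le_trans _ _ (M * (e / M / 2) + M * (e / M / 2))).
  by apply: lerD; apply: (le_trans (ML _)); rewrite ler_wpM2l ?(ltW M0).
by rewrite le_eqVlt; apply/orP; left; apply/eqP; field; rewrite gt_eqF.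
Qed.

End Linf_theory.

(** * The Hahn-Banach theorem and Reiter's condition *)

Section hahn_banach.
Context (R : realType) (V : lmodType R[i]).
Implicit Types (p q : V -> R) (x y : V) (r : R).

Definition sublinear p := (forall x y, p (x + y) <= p x + p y) /\
  forall r x, 0 < r -> p (r%:C%C *: x) <= r * p x.

Lemma realZA r s x : r%:C%C *: (s%:C%C *: x) = (r * s)%:C%C *: x.
Proof. by rewrite scalerA rmorphM. Qed.

Lemma sublinearZ p r x : sublinear p -> 0 < r -> p (r%:C%C *: x) = r * p x.
Proof.
move=> [_ pZ] r0; apply/eqP; rewrite eq_le pZ//=.
rewrite -ler_pdivlMl//; apply: le_trans (pZ _ _ _); last by rewrite invr_gt0.
by rewrite realZA mulVf ?gt_eqF// scale1r.
Qed.

Lemma sublinear0 p : sublinear p -> p 0 = 0.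
Proof.
move=> sp; have := @sublinearZ p 2 0 sp (ltr0n _ 2); rewrite scaler0; lra.
Qed.

(** The infimum of a family stable in this sense is sublinear even if its members are not. Used for
    the lower bound of a chain, for the minimality argument of Hahn-Banach and for
    [conv_separation]. *)
Lemma sublinear_inf (I : Type) (A : set I) (q : I -> V -> R) (b : V -> R) :
  A !=set0 -> (forall i x, A i -> b x <= q i x) ->
  (forall i j x y, A i -> A j -> exists2 k, A k & q k (x + y) <= q i x + q j y) ->
  (forall i r x, A i -> 0 < r -> exists2 k, A k & q k (r%:C%C *: x) <= r * q i x) ->
  exists p, [/\ sublinear p, forall x, b x <= p x & forall i x, A i -> p x <= q i x].
Proof.
move=> [i0 Ai0] bq qD qZ; pose E x := [set q i x | i in A].
have lbE x : has_lbound (E x) by exists (b x) => _ [i Ai <-]; exact: bq.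
have E0 x : E x !=set0 by exists (q i0 x), i0.
have leE i x : A i -> inf (E x) <= q i x by move=> Ai; apply: ge_inf => //; exists i.
exists (fun x => inf (E x)); split => [|x|//]; last first.
  by apply: lb_le_inf => // _ [i Ai <-]; exact: bq.
split=> [x y|r x r0].
  rewrite -lerBlDr; apply: lb_le_inf => // _ [i Ai <-].
  rewrite lerBlDr [leRHS]addrC -lerBlDr; apply: lb_le_inf => // _ [j Aj <-].
  have [k Ak kq] := qD i j x y Ai Aj; rewrite lerBlDr.
  by apply: le_trans (leE k _ Ak) _; rewrite (addrC (q j y)).
rewrite -ler_pdivrMl//; apply: lb_le_inf => // _ [i Ai <-].
have [k Ak kq] := qZ i r x Ai r0; rewrite ler_pdivrMl//.
by apply: le_trans (leE k _ Ak) _.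
Qed.

Definition real_linear p := (forall x y, p (x + y) = p x + p y) /\
  forall r x, p (r%:C%C *: x) = r * p x.

(** Zorn's lemma for the reversed order. A chain has a finite infimum, since a sublinear [s] below
    [p] satisfies [s x >= - s (- x) >= - p (- x)]. *)
Lemma minimal_sublinear p : sublinear p ->
  exists q, [/\ sublinear q, forall x, q x <= p x &
    forall q', sublinear q' -> (forall x, q' x <= q x) -> forall x, q x <= q' x].
Proof.
move=> sp; pose T := {q : V -> R | sublinear q /\ forall x, q x <= p x}.
pose le (s t : T) := `[< forall x, sval t x <= sval s x >].
have [||A Atot|[q [sq qp]] qmin] := @ZL_preorder T (exist _ p (conj sp (fun x => lexx _))) le.
- by move=> t; apply/asboolP => x.
- by move=> r s t /asboolP rs /asboolP st; apply/asboolP => x; exact: le_trans (st x) (rs x).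
- have [->|/set0P[t At]] := eqVneq A set0.
    by exists (exist _ p (conj sp (fun x => lexx _))).
  have [||s i x y As Ai|s r x As r0|q [sq bq qA]] :=
    @sublinear_inf T A (fun s => sval s) (fun x => - p (- x)).
  - by exists t.
  - move=> [s [ss sp']] x _ /=; have := sp' (- x); have := ss.1 x (- x).
    rewrite subrr (sublinear0 ss); lra.
  - have [/asboolP si|/asboolP is_] := Atot _ _ As Ai.
      exists i => //; case: i si {Ai} => [i [[iD _] _]] /= si.
      by apply: le_trans (iD _ _) _; rewrite lerD2r.
    exists s => //; case: s is_ {As} => [s [[sD _] _]] /= is_.
    by apply: le_trans (sD _ _) _; rewrite lerD2l.
  - by exists s => //; case: s {As} => [s [[_ sZ] _]] /=; exact: sZ.
  have qp x : q x <= p x by apply: le_trans (qA t x At) _; case: (t) => [s []].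
  by exists (exist _ q (conj sq qp)) => s As; apply/asboolP => x /=; exact: qA.
exists q; split=> // q' sq' q'q x.
have q'p y : q' y <= p y by apply: le_trans (q'q y) (qp y).
have := qmin (exist _ q' (conj sq' q'p)).
by move=> /(_ (asboolT q'q)) /asboolP /(_ x).
Qed.

(** A minimal sublinear [q] is linear: for fixed [y], the infimum over [l >= 0] of
    [q (z + l y) - l * q y] is sublinear in [z] and below [q], hence equal to it; the term [l = 1]
    gives [q x + q y <= q (x + y)]. *)
Theorem real_hahn_banach p : sublinear p ->
  exists2 t, real_linear t & forall x, t x <= p x.
Proof.
move=> /minimal_sublinear[q [sq qp qmin]]; exists q => //.
have [qD _] := sq; have q0 := sublinear0 sq.
have addq x y : q (x + y) = q x + q y.
  apply/eqP; rewrite eq_le qD /=.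
  have [|l z /= l0|l l' z z' /= l0 l0'|l r z /= l0 r0|q' [sq' _ q'q]] :=
    @sublinear_inf R [set l | 0 <= l]
    (fun l z => q (z + l%:C%C *: y) - l * q y) (fun z => - q (- z)).
  - by exists 0; rewrite /= lexx.
  - have -> : l * q y = q (l%:C%C *: y).
      move: l0; rewrite le_eqVlt => /predU1P[<-|l0]; first by rewrite scale0r q0 mul0r.
      by rewrite sublinearZ.
    have := qD (z + l%:C%C *: y) (- z); rewrite addrAC subrr add0r; lra.
  - exists (l + l'); first exact: addr_ge0.
    have := qD (z + l%:C%C *: y) (z' + l'%:C%C *: y).
    rewrite addrACA -scalerDl -rmorphD /=; lra.
  - exists (r * l); first by rewrite mulr_ge0// ltW.
    by rewrite -realZA -scalerDr sublinearZ// mulrBr mulrA.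
  have h1 := q'q 1 x ler01; have h0 := fun z => q'q 0 z (lexx 0).
  have := qmin q' sq' _ x; rewrite scale1r mul1r in h1.
  move=> H; have : q x <= q' x.
    by apply: H => z; have := h0 z; rewrite scale0r addr0 mul0r subr0.
  lra.
have oppq x : q (- x) = - q x by have := addq x (- x); rewrite subrr q0; lra.
split=> // r x; have [r0|r0|->] := ltgtP r 0; last by rewrite scale0r q0 mul0r.
  have := @sublinearZ q (- r) x sq; rewrite oppr_gt0 rmorphN scaleNr oppq mulNr.
  by move=> /(_ r0) /oppr_inj.
by rewrite sublinearZ.
Qed.

End hahn_banach.

Section real_linear_theory.
Context (R : realType) (V : lmodType R[i]).
Context (t : V -> R) (lt : real_linear t).

Lemma real_linear0 : t 0 = 0.
Proof. by have := lt.2 0 0; rewrite scale0r mul0r. Qed.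

Lemma real_linearN x : t (- x) = - t x.
Proof. by have := lt.2 (-1) x; rewrite rmorphN1 scaleN1r mulN1r. Qed.

Lemma real_linear_sum (I : Type) (r : seq I) (F : I -> V) :
  t (\sum_(i <- r) F i) = \sum_(i <- r) t (F i).
Proof. by elim/big_ind2: _ => [|x a y b <- <-|//]; [exact: real_linear0|rewrite lt.1]. Qed.

End real_linear_theory.

Section means.
Context (G : topologicalGroupType) (R : realType) (mu : leftHaarMeasure G R).
Hypothesis hG : hausdorff_space G.
Hypothesis lcG : locally_compact [set: G].
Context (Delta : G -> R) (mDelta : modular_function mu Delta).
Local Notation C := R[i].
Local Notation L1 := (L1 mu).
Local Notation Linf := (Linf mu).
Local Notation N := (@L1norm G R mu).
Local Notation conv := (@Defs.conv G R mu).
Local Notation L1inv := (L1inv hG lcG mDelta).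
Local Notation L1rt := (L1rt hG lcG mDelta).
Local Notation density := (@density G R mu).
Implicit Types (f g h F : L1) (S T L : Linf) (e : R) (A : set G) (m : Linf -> C).

Definition L1re f : L1 := MkL1 (L1pred_real (L1P f).1).
Definition L1im f : L1 := MkL1 (L1pred_real (L1P f).2).

Lemma L1reE f x : L1re f x = (complex.Re (f x))%:C%C. Proof. by []. Qed.
Lemma L1imE f x : L1im f x = (complex.Im (f x))%:C%C. Proof. by []. Qed.

Lemma L1norm_re f : N (L1re f) <= N f.
Proof. by apply: L1norm_le; apply: aeW => x; rewrite L1reE cmod_real cmod_Re. Qed.

Lemma L1norm_im f : N (L1im f) <= N f.
Proof. by apply: L1norm_le; apply: aeW => x; rewrite L1imE cmod_real cmod_Im. Qed.

Definition L1real f := forall x, complex.Im (f x) = 0.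

Lemma L1re_real f : L1real f -> L1re f = f.
Proof.
by move=> fr; apply: L1_ext => x; rewrite L1reE [RHS]complexE fr mulr0 addr0.
Qed.

Lemma L1im_real f : L1real f -> L1im f = 0.
Proof. by move=> fr; apply: L1_ext => x; rewrite L1imE fr. Qed.

Lemma L1real_nonneg f : L1nonneg f -> L1real f.
Proof. by move=> f0 x; have /complex_ge0P[] := f0 x. Qed.

Lemma L1re_im f : f = L1re f + 'i%C *: L1im f.
Proof.
by apply: L1_ext => x; rewrite L1valD L1valZ L1reE L1imE [LHS]complexE mulrC.
Qed.

(* The functional is real on real functions, which makes positivity meaningful. *)
Lemma complexify (t : L1 -> R) (M : R) : real_linear t -> (forall f, `|t f| <= M * N f) ->
  exists T : Linf, forall f, T f = Complex (t (L1re f)) (t (L1im f)).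
Proof.
move=> lt bt.
suff Tp : (fun f => Complex (t (L1re f)) (t (L1im f))) \in @Linfpred _ _ mu.
  by exists (MkLinf Tp).
rewrite inE; split=> [a f g|].
  have -> : L1re (a *: f + g) = (complex.Re a)%:C%C *: L1re f - (complex.Im a)%:C%C *: L1im f
      + L1re g.
    apply: L1_ext => x; rewrite !(L1valD, L1valN, L1valZ, L1reE, L1imE) cReD cReM.
    by rewrite rmorphD rmorphB !rmorphM.
  have -> : L1im (a *: f + g) = (complex.Re a)%:C%C *: L1im f + (complex.Im a)%:C%C *: L1re f
      + L1im g.
    apply: L1_ext => x; rewrite !(L1valD, L1valN, L1valZ, L1reE, L1imE) cImD cImM.
    by rewrite !rmorphD !rmorphM.
  rewrite !lt.1 !(real_linearN lt) !lt.2.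
  case: a => a b; apply/eqP; rewrite eq_complex /GRing.scale /=.
  by apply/andP; split; apply/eqP; ring.
exists (`|M| + `|M|) => f; rewrite -cmodE lecR; apply: (le_trans (cmod_le _)) => /=.
rewrite mulrDl; apply: lerD; apply: (le_trans (bt _)).
  by apply: le_trans (ler_wpM2l _ (L1norm_re f)) => //; rewrite ler_wpM2r ?L1norm_ge0// ler_norm.
by apply: le_trans (ler_wpM2l _ (L1norm_im f)) => //; rewrite ler_wpM2r ?L1norm_ge0// ler_norm.
Qed.

Lemma ae_nonnegP f : {ae mu, forall x, 0 <= f x} -> exists2 g, L1nonneg g & L1eq f g.
Proof.
move=> f0.
have gp : (fun x => (cmod (f x))%:C%C) \in L1pred mu.
  by apply: L1pred_real; exact: L1_cmod_integrable.
exists (MkL1 gp); first by move=> x /=; rewrite ler0c cmod_ge0.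
by apply: L1eq_ae; apply: filterS f0 => x /cmod_ge0E <-.
Qed.

Lemma Linf_nonnegP T : (forall f, L1nonneg f -> 0 <= T f) -> Linf_nonneg T.
Proof. by move=> T0 f /ae_nonnegP[g g0 /(Linf_eq T) ->]; exact: T0. Qed.

Lemma mean_linear m a S T : is_mean m -> m (a *: S + T) = a * m S + m T.
Proof. by move=> [lm _ _]; rewrite lm. Qed.

Lemma meanD m S T : is_mean m -> m (S + T) = m S + m T.
Proof. by move=> hm; rewrite -[S]scale1r mean_linear// mul1r scale1r. Qed.

Lemma mean0 m : is_mean m -> m 0 = 0.
Proof. by move=> hm; apply: (addIr (m 0)); rewrite -meanD// addr0 add0r. Qed.

Lemma meanZ m a T : is_mean m -> m (a *: T) = a * m T.
Proof. by move=> hm; rewrite -[a *: T]addr0 mean_linear// mean0// addr0. Qed.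

Lemma meanB m S T : is_mean m -> m (S - T) = m S - m T.
Proof. by move=> hm; rewrite addrC -scaleN1r mean_linear// mulN1r addrC. Qed.

Lemma mean_sum (I : Type) (r : seq I) (F : I -> Linf) m : is_mean m ->
  m (\sum_(i <- r) F i) = \sum_(i <- r) m (F i).
Proof. by move=> hm; elim/big_ind2: _ => [|x a y b <- <-|//]; [exact: mean0|rewrite meanD]. Qed.

Lemma LinfvalD S T f : (S + T) f = S f + T f. Proof. by []. Qed.
Lemma LinfvalZ a T f : (a *: T) f = a * T f. Proof. by []. Qed.
Lemma LinfvalN T f : (- T) f = - T f. Proof. by []. Qed.

Lemma Linfval_sum (I : Type) (r : seq I) (F : I -> Linf) f :
  (\sum_(i <- r) F i) f = \sum_(i <- r) F i f.
Proof. by elim/big_ind2: _ => // [S1 u S2 v <- <-]. Qed.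

Lemma one_nonneg f : L1nonneg f -> Linf_one mu f = (N f)%:C%C.
Proof. exact: nonneg_cintegral. Qed.

(** Boundedness of a mean follows from positivity, applied to [M] times the unit plus and minus [T];
    positivity also makes [m T] real. *)
Lemma mean_bound_real m T (M : R) : is_mean m ->
  (forall f, L1nonneg f -> complex.Im (T f) = 0 /\ `|complex.Re (T f)| <= M * N f) ->
  cmod (m T) <= M.
Proof.
move=> hm TM; have [_ m0 m1] := hm.
have key (s : R) : `|s| = 1 -> 0 <= m (M%:C%C *: Linf_one mu + s%:C%C *: T).
  move=> s1; apply: m0; apply: Linf_nonnegP => f f0; have [Ti Tr] := TM f f0.
  rewrite LinfvalD !LinfvalZ one_nonneg//; apply/complex_ge0P.
  rewrite !(cReD, cReM, cImD, cImM) /= Ti !mulr0 !mul0r !subr0 !addr0; split=> //.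
  rewrite -lerBlDr sub0r; apply: le_trans Tr; rewrite -[leRHS]mul1r -s1 -normrM.
  by rewrite lerNl; apply: le_trans (lerNnormlW _) _; rewrite // ler_norm.
have h1 := key 1 (normr1 _); have := key (-1).
rewrite normrN normr1 => /(_ erefl) h2.
move: h1 h2; rewrite !meanD// !meanZ// m1 mulr1 rmorphN1 mulN1r rmorph1 mul1r.
move=> /complex_ge0P[+ h1] /complex_ge0P[_ h2]; move: h1 h2.
rewrite !(cReD, cImD, cReN) /= add0r => h1 h2 h3.
apply: le_trans (cmod_le _) _; rewrite h3 normr0 addr0 ler_norml; lra.
Qed.

Lemma mean_bound m T (M : R) : is_mean m -> (forall f, cmod (T f) <= M * N f) ->
  cmod (m T) <= 2 * M.
Proof.
move=> hm TM.
have lre : real_linear (fun f => complex.Re (T f)).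
  by split=> [f g|r f]; rewrite ?LinfD ?LinfZ ?cReD ?cReM//= mul0r subr0.
have lim : real_linear (fun f => complex.Im (T f)).
  by split=> [f g|r f]; rewrite ?LinfD ?LinfZ ?cImD ?cImM//= mul0r addr0.
have [|T1 T1E] := complexify (M := M) lre; first by move=> f; exact: le_trans (cmod_Re _) (TM f).
have [|T2 T2E] := complexify (M := M) lim; first by move=> f; exact: le_trans (cmod_Im _) (TM f).
have -> : T = 'i%C *: T2 + T1.
  apply: Linf_ext => f; rewrite LinfvalD LinfvalZ T1E T2E {1}(L1re_im f) LinfD LinfZ.
  by apply/eqP; rewrite eq_complex /= !(cReD, cReM, cImD, cImM) /=; apply/andP; split; apply/eqP; ring.
rewrite mean_linear//; apply: (le_trans (cmodD _ _)); rewrite cmodM.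
have -> : cmod ('i%C : C) = 1 by rewrite /cmod normc_def /= expr0n add0r expr1n sqrtr1.
rewrite mul1r mulr_natl mulr2n; apply: lerD; apply: mean_bound_real => // f f0.
  rewrite T2E L1im_real ?L1re_real /= ?Linf0; [|exact: L1real_nonneg..].
  by split=> //; exact: le_trans (cmod_Im _) (TM f).
rewrite T1E L1im_real ?L1re_real /= ?Linf0; [|exact: L1real_nonneg..].
by split=> //; exact: le_trans (cmod_Re _) (TM f).
Qed.

Lemma mean_lmodact m T : is_mean m -> exists L : Linf, forall h, L h = m (lmodact h T).
Proof.
move=> hm; have [M M0 MT] := Linf_bound T.
suff Lp : (fun h => m (lmodact h T)) \in @Linfpred _ _ mu by exists (MkLinf Lp).
rewrite inE; split=> [a f g|].
  rewrite (_ : lmodact _ T = a *: lmodact f T + lmodact g T) ?mean_linear//.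
  apply: Linf_ext => h; rewrite LinfvalD LinfvalZ !lmodactE//.
  by rewrite (Linf_eq T (conv_linear_l hG lcG a f g h)) Linf_linear.
exists (2 * (M * 2)) => f; rewrite -cmodE lecR -!mulrA; apply: mean_bound => // g.
rewrite lmodactE//; apply: (le_trans (MT _)); rewrite -!mulrA ler_wpM2l ?(ltW M0)//.
exact: L1norm_conv.
Qed.

(** From points to densities: by [conv_rt], [lmodact (L1rt x h) T] is the translate by [x] of
    [lmodact h T]. So [h |-> m (lmodact h T)] is invariant under right translations, and
    [right_invariant_cst] applies. *)
Lemma invariant_mean_density m T f g : is_mean m ->
  (forall x S, m (Linf_translate x S) = m S) -> density f -> density g ->
  m (lmodact f T) = m (lmodact g T).
Proof.
move=> hm minv df dg; have [L LE] := mean_lmodact T hm; rewrite -!LE.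
apply: (@right_invariant_cst _ _ _ hG lcG _ mDelta L _ f g df dg) => x h; rewrite !LE -[RHS](minv x).
by congr (m _); apply: Linf_ext => k; rewrite /= !lmodactE// conv_rt.
Qed.

End means.

Section reiter.
Context (G : topologicalGroupType) (R : realType) (mu : leftHaarMeasure G R).
Hypothesis hG : hausdorff_space G.
Hypothesis lcG : locally_compact [set: G].
Local Notation C := R[i].
Local Notation L1 := (L1 mu).
Local Notation Linf := (Linf mu).
Local Notation N := (@L1norm G R mu).
Local Notation conv := (@Defs.conv G R mu).
Local Notation density := (@density G R mu).
Implicit Types (f g h F : L1) (S T L : Linf) (e : R) (A : set G) (m : Linf -> C).

Lemma L1eq_normDl f g g' : L1eq g g' -> N (f + g) = N (f + g').
Proof.
move=> gg'; apply: L1eq_norm; rewrite /L1eq.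
by rewrite (_ : _ - _ = g - g')//; rewrite opprD addrACA subrr add0r.
Qed.

Lemma L1normD_nonneg f g : L1nonneg f -> L1nonneg g -> N (f + g) = N f + N g.
Proof.
move=> f0 g0; have fg0 : L1nonneg (f + g) by move=> x; rewrite L1valD addr_ge0.
have := cintegral_linear 1 f g; rewrite scale1r mul1r !nonneg_cintegral//.
by rewrite -rmorphD => /complexI.
Qed.

Lemma L1normB_conv_l f g h : N (conv f h - conv g h) <= 2 * (N (f - g) * N h).
Proof.
have := L1eq_normDl 0 (conv_linear_l hG lcG (-1) g f h).
rewrite !scaleN1r !add0r ![- _ + _]addrC => <-; exact: L1norm_conv.
Qed.

Lemma L1normB_conv_r f g h : N (conv h f - conv h g) <= 2 * (N h * N (f - g)).
Proof.
have := L1eq_normDl 0 (conv_linear_r hG lcG (-1) h g f).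
rewrite !scaleN1r !add0r ![- _ + _]addrC => <-; exact: L1norm_conv.
Qed.

Section finite.
Context (I : finType) (psi : L1) (D : I -> L1).
Hypotheses (dpsi : density psi) (dD : forall i, density (D i)).

Local Notation Phi := (fun F i => conv (D i) F - conv psi F).
Local Notation snorm := (fun x : I -> L1 => \sum_i N (x i)).

Lemma conv_diff_linear (a : C) F1 F2 i :
  L1eq (Phi (a *: F1 + F2) i) (a *: Phi F1 i + Phi F2 i).
Proof.
have h1 := conv_linear_r hG lcG a (D i) F1 F2; have h2 := conv_linear_r hG lcG a psi F1 F2.
set u := conv (D i) _ in h1 *; set v := conv psi (a *: _ + _) in h2 *.
rewrite /L1eq; set w := (X in N X).
have -> : w = (u - (a *: conv (D i) F1 + conv (D i) F2)) - (v - (a *: conv psi F1 + conv psi F2)).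
  apply: L1_ext => x; rewrite /w; rewrite !(L1valD, L1valN, L1valZ); ring.
apply/eqP; rewrite eq_le L1norm_ge0 andbT; apply: (le_trans (L1normD _ _)).
by rewrite L1normN h1 h2 addr0.
Qed.

(* Hahn-Banach for [p x = inf_F (|x + Phi F| - e |F|)]. *)
Lemma conv_separation e : (forall F, L1nonneg F -> e * N F <= snorm (Phi F)) ->
  exists t : (I -> L1) -> R, [/\ real_linear t, forall x, `|t x| <= snorm x &
    forall F, L1nonneg F -> e * N F <= t (Phi F)].
Proof.
move=> hPhi.
have NPhi0 i : N (Phi 0 i) = 0.
  have := conv_diff_linear 0 0 0 i; rewrite scale0r addr0 => /L1eq_norm ->.
  have c0 h : N (conv h 0) = 0.
    by apply/eqP; rewrite eq_le L1norm_ge0 andbT (le_trans (L1norm_conv _ _ _ _))// L1norm0 !mulr0.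
  apply/eqP; rewrite eq_le L1norm_ge0 andbT scale0r add0r; apply: (le_trans (L1normD _ _)).
  by rewrite L1normN !c0 addr0.
have [||F1 F2 x y F10 F20|F r x F0 r0|p [sp _ pq]] :=
  @sublinear_inf R (I -> L1) L1 (@L1nonneg G R mu)
    (fun F x => snorm (x + Phi F) - e * N F) (fun x => - snorm x).
- by exists 0 => x; rewrite lexx.
- move=> F x F0; rewrite lerBrDr addrC lerBlDr -big_split /=.
  apply: (le_trans (hPhi F F0)); apply: ler_sum => i _.
  have := L1normD (x i + (conv (D i) F - conv psi F)) (- x i).
  by rewrite addrAC subrr add0r L1normN.
- exists (F1 + F2); first by move=> z; rewrite L1valD addr_ge0.
  rewrite L1normD_nonneg// mulrDr opprD [leRHS]addrACA lerD2r -big_split /=.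
  apply: ler_sum => i _; have := conv_diff_linear 1 F1 F2 i.
  rewrite !scale1r => /(L1eq_normDl (x i + y i)) ->; rewrite addrACA; exact: L1normD.
- exists (r%:C%C *: F); first by move=> z; rewrite L1valZ mulr_ge0// ler0c ltW.
  rewrite L1normZ cmod_real gtr0_norm// mulrBr mulrCA lerD2r mulr_sumr.
  apply: ler_sum => i _; have := conv_diff_linear r%:C%C F 0 i; rewrite addr0.
  move=> /(L1eq_normDl (r%:C%C *: x i)) ->.
  rewrite addrA -scalerDr; apply: (le_trans (L1normD _ _)).
  by rewrite NPhi0 addr0 L1normZ cmod_real gtr0_norm.
have [t lt tp] := real_hahn_banach sp; exists t.
have tb x : t x <= snorm x.
  apply: (le_trans (tp x)); apply: (le_trans (pq 0 x _)); first by move=> z; rewrite lexx.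
  rewrite L1norm0 mulr0 subr0; apply: ler_sum => i _; apply: (le_trans (L1normD _ _)).
  by rewrite NPhi0 addr0.
split=> // [x|F F0].
  rewrite ler_norml tb andbT lerNl -(real_linearN lt); apply: (le_trans (tb _)).
  by apply: ler_sum => i _; rewrite L1normN.
have := le_trans (tp (- Phi F)) (pq F (- Phi F) F0); rewrite (real_linearN lt).
rewrite big1; first by rewrite sub0r lerN2.
by move=> i _; rewrite addNr L1norm0.
Qed.

(* Otherwise, with [t] as in [conv_separation], the functional [Theta] below dominates
   [e] times the unit while the mean vanishes on it. *)
Lemma finite_reiter m e : is_mean m -> (forall x S, m (Linf_translate x S) = m S) ->
  0 < e -> exists2 F, L1nonneg F & snorm (Phi F) < e * N F.
Proof.
move=> hm minv e0; apply: contrapT => noF.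
have [|t [lt tb tPhi]] := @conv_separation e.
  by move=> F F0; rewrite leNgt; apply/negP => ltF; apply: noF; exists F.
pose delta (i : I) f : I -> L1 := fun j => if j == i then f else 0.
have sdelta i f : snorm (delta i f) = N f.
  rewrite (bigD1 i)//= /delta eqxx big1 ?addr0// => j /negPf ->; exact: L1norm0.
have /choice[T TE] : forall i, exists T : Linf, forall f,
    T f = Complex (t (delta i (L1re f))) (t (delta i (L1im f))).
  move=> i; apply: (complexify (t := fun f => t (delta i f)) (M := 1)).
    split=> [f g|r f]; [rewrite -lt.1|rewrite -lt.2]; congr t; apply/funext => j;
    by rewrite /delta !fctE; case: (j == i); rewrite ?addr0 ?scaler0.
  by move=> f; rewrite mul1r; apply: le_trans (tb _) _; rewrite sdelta.
have [Delta mDelta] := exists_modular_function mu hG lcG.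
pose Theta := \sum_i (lmodact (D i) (T i) - lmodact psi (T i)).
have Theta0 : m Theta = 0.
  rewrite mean_sum// big1// => i _; rewrite meanB//.
  by rewrite (invariant_mean_density hG lcG mDelta _ hm minv (dD i) dpsi) subrr.
have ThetaE F : L1nonneg F -> Theta F = (t (Phi F))%:C%C.
  move=> F0; rewrite Linfval_sum.
  have -> : Phi F = \sum_i delta i (Phi F i).
    apply/funext => j; rewrite fct_sumE (bigD1 j)//= /delta eqxx big1 ?addr0// => i.
    by rewrite eq_sym => /negPf ->.
  rewrite (real_linear_sum lt) rmorph_sum; apply: eq_bigr => i _.
  have n1 : L1nonneg (conv (D i) F) by apply: conv_nonneg => //; case: (dD i).
  have n2 : L1nonneg (conv psi F) by apply: conv_nonneg => //; case: dpsi.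
  rewrite LinfvalD LinfvalN !lmodactE// -LinfB TE.
  have r : L1real (conv (D i) F - conv psi F).
    by move=> x; rewrite L1valB cImD cImN !L1real_nonneg// subr0.
  rewrite L1re_real// L1im_real// (_ : delta i 0 = 0) ?(real_linear0 lt)//.
  by apply/funext => j; rewrite /delta; case: ifP.
have : 0 <= m (Theta - e%:C%C *: Linf_one mu).
  case: hm => _ m0 _; apply: m0; apply: Linf_nonnegP => F F0.
  rewrite LinfvalD LinfvalN LinfvalZ ThetaE// one_nonneg// -rmorphM -rmorphB ler0c.
  by rewrite subr_ge0; exact: tPhi.
rewrite meanB// meanZ// Theta0; case: hm => _ _ ->.
by rewrite mulr1 sub0r -rmorphN ler0c oppr_ge0 leNgt e0.
Qed.

End finite.

Lemma exists_density : exists f, density f.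
Proof.
have [U [Q [oU U1 cQ UQ]]] := compact_nbhs1 lcG.
have Uoo : (mu U < +oo)%E.
  apply: le_lt_trans (haar_compact (s := mu) Q cQ).
  by apply: le_haar => //; [exact: open_mbl|exact: compact_mbl].
by eexists; exact: (density_indicator hG oU (ex_intro _ _ U1) Uoo).
Qed.

Lemma density_normalize f : L1nonneg f -> 0 < N f -> density ((N f)^-1%:C%C *: f).
Proof.
move=> f0 Nf; split=> [x|].
  by rewrite L1valZ mulr_ge0// ler0c invr_ge0 ltW.
by rewrite L1normZ cmod_real gtr0_norm ?invr_gt0// mulVf// gt_eqF.
Qed.

Lemma translateZ (c : G) (a : C) f : translate c (a *: f) = a *: translate c f.
Proof. exact: L1_ext. Qed.

(** [finite_reiter], for finitely many translates of [psi], makes [F2 = psi * F0] almost invariant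
    under finitely many points. These suffice for all of [A], as a small further translation hardly
    changes the factor [psi]. Truncation to a compact set and normalization follow. *)
Lemma compact_reiter A e : amenable mu -> compact A -> 0 < e ->
  exists F Q, [/\ density F, compact Q, supported F Q &
    forall c, A c -> N (translate c F - F) <= e].
Proof.
move=> [m hm minv] cA e0; have [psi dpsi] := exists_density.
(* In units of [d * N F0], translating [F2] by a point of [A] costs 3 and truncating costs 2;
   [d <= 1/2] ensures [N F0 <= 2 * N F3], so normalization turns the total 5 into [10 * d <= e]. *)
pose d := Num.min (e / 10) (2^-1).
have d0 : 0 < d by rewrite lt_min divr_gt0//= invr_gt0.
have de : d <= e / 10 by rewrite ge_min lexx.
have d2 : d <= 2^-1 by rewrite ge_min lexx orbT.
have [W [oW W1 We]] := translate_continuous hG psi d0.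
pose O (c0 : G) := [set c | W (c * c0^-1)%g].
have oO c0 : open (O c0) by exact: open_mulr.
have [|c Ac|s _ sA] := compact_cover_seq (D := setT) (f := O) cA.
- by move=> c0 _; exact: oO.
- by exists c => //; rewrite /O /= mulgV.
pose c (i : 'I_(size s)) := nth 1%g s i.
have [F0 F00 sF] := finite_reiter dpsi (fun i => density_translate (c i) dpsi) hm minv d0.
have NF0 : 0 < N F0.
  rewrite -(pmulr_rgt0 _ d0); apply: le_lt_trans sF.
  by apply: sumr_ge0 => i _; exact: L1norm_ge0.
pose F2 := conv psi F0.
have F2c x : A x -> N (translate x F2 - F2) <= 3 * d * N F0.
  move=> /sA[c0 c0s Wx].
  have ilt : (index c0 s < size s)%N by rewrite index_mem.
  have ci : c (Ordinal ilt) = c0 by rewrite /c /= nth_index.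
  apply: (le_trans (L1norm_triangle (translate c0 F2) _ _)).
  rewrite (_ : 3 * d * N F0 = 2 * (d * N F0) + d * N F0); last by ring.
  apply: lerD.
    rewrite !translate_conv//; apply: (le_trans (L1normB_conv_l _ _ _)).
    rewrite ler_wpM2l// ler_wpM2r ?L1norm_ge0//.
    rewrite -[x](mulgVK c0) -translateM -translateB L1norm_translate; exact: We.
  apply: le_trans (ltW sF); rewrite (bigD1 (Ordinal ilt))//= ci translate_conv//.
  by rewrite lerDl; apply: sumr_ge0 => i _; exact: L1norm_ge0.
have [Q cQ QF] := L1_tight hG F2 (mulr_gt0 d0 NF0).
have mQ := compact_mbl hG cQ.
pose F3 := restrL1 Q F2.
have F20 : L1nonneg F2 by apply: conv_nonneg => //; case: dpsi.
have F30 : L1nonneg F3.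
  by move=> x; rewrite /F3 restrL1E// mulr_ge0// ler0c indicE.
have NF2 : N F2 = N F0 by rewrite L1norm_conv_nonneg//; case: dpsi => // _ ->; rewrite mul1r.
have NF3 : N F0 <= 2 * N F3.
  have := L1normD (F2 - F3) F3; rewrite subrK NF2 => h.
  have : d * N F0 <= 2^-1 * N F0 by rewrite ler_wpM2r// ltW.
  move: QF; rewrite -/F3; lra.
have NF3_gt0 : 0 < N F3 by lra.
exists ((N F3)^-1%:C%C *: F3), Q; split=> //.
- exact: density_normalize.
- move=> x; rewrite L1valZ /F3 restrL1E// !mulf_eq0 !negb_or => /and3P[_ _].
  by rewrite indicE; case: (boolP (x \in Q)) => [/set_mem//|_]; rewrite eqxx.
move=> x Ax; rewrite translateZ -scalerBr L1normZ cmod_real gtr0_norm ?invr_gt0//.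
rewrite ler_pdivrMl//.
have F3x : N (translate x F3 - F3) <= 5 * (d * N F0).
  rewrite (_ : translate x F3 - F3 =
    - translate x (F2 - F3) + (translate x F2 - F2) + (F2 - F3)); last first.
    by apply: L1_ext => y; rewrite !(L1valD, L1valN, translateE); ring.
  apply: (le_trans (L1normD _ _)); apply: (@le_trans _ _ (4 * (d * N F0) + d * N F0)).
    apply: lerD => //; apply: (le_trans (L1normD _ _)).
    rewrite L1normN L1norm_translate; have := F2c x Ax; move: QF; rewrite -/F3; lra.
  lra.
apply: (le_trans F3x); have : d * N F0 <= e / 10 * (2 * N F3).
  by apply: ler_pM => //; exact: ltW.
rewrite (_ : N F3 * e = 5 * (e / 10 * (2 * N F3))); last by field.
by rewrite ler_pM2l.
Qed.

End reiter.

(** * Cardinal arithmetic *)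

Section cardinals.

Definition embeds (T U : Type) := exists f : T -> U, injective f.

Lemma embedsP (T U : Type) : [set: T] #<= [set: U] <-> embeds T U.
Proof.
elim/Ppointed: U => U; last first.
  split=> [/pcard_injP[f fi]|[f fi]].
    by exists f => x y; apply: fi; rewrite inE.
  by apply/pcard_injP; exists f => x y _ _; exact: fi.
rewrite (_ : [set: U] = set0) ?card_le0; last by rewrite emptyE.
split=> [/eqP T0|[f _]].
  have noT (x : T) : False by have : [set: T] x by []; rewrite T0.
  by exists (fun x => False_rect _ (noT x)) => x; case: (noT x).
by apply/eqP/seteqP; split => // x _; have := @in_setT _ (f x); rewrite emptyE inE.
Qed.

Lemma embeds_trans (T U V : Type) : embeds T U -> embeds U V -> embeds T V.
Proof. by move=> [f fi] [g gi]; exists (g \o f); exact: inj_comp. Qed.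

Lemma embeds_prod (T T' U U' : Type) : embeds T T' -> embeds U U' -> embeds (T * U) (T' * U').
Proof.
move=> [f fi] [g gi]; exists (fun p => (f p.1, g p.2)) => -[x y] [x' y'] /=.
by case=> /fi -> /gi ->.
Qed.

Lemma embeds_set (T U : Type) : embeds T U -> embeds (set T) (set U).
Proof.
move=> [f fi]; exists (fun A => f @` A) => A B /seteqP[AB BA]; apply/seteqP; split=> x Ax.
  by have [|y By /fi <-] := AB (f x); first by exists x.
by have [|y By /fi <-] := BA (f x); first by exists x.
Qed.

Lemma sval_inj (T : Type) (P : T -> Prop) : injective (@sval T P).
Proof. by move=> [x Px] [y Py] /=; exact: eq_exist. Qed.

(* Zorn's lemma on partial injections. *)
Lemma embeds_total (T U : Type) : embeds T U \/ embeds U T.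
Proof.
pose P (Y : set (T * U)) := forall p q, Y p -> Y q -> p.1 = q.1 <-> p.2 = q.2.
have [|Y [PY Ymax]] := @Zorn_bigcup _ P.
  move=> F FP Ftot p q [A FA Ap] [B FB Bq].
  by have [AB|BA] := Ftot A B FA FB; [apply: (FP B) => //; exact: AB|apply: (FP A) => //; exact: BA].
have [domT|] := pselect (forall x, exists y, Y (x, y)).
  have [f fY] := choice domT; left; exists f => x x' fxx'.
  by apply/(PY _ _ (fY x) (fY x')).
move=> /existsNP[x0 nx0].
have [ranT|] := pselect (forall y, exists x, Y (x, y)).
  have [f fY] := choice ranT; right; exists f => y y' fyy'.
  by apply/(PY _ _ (fY y) (fY y')).
move=> /existsNP[y0 ny0]; exfalso; apply: (Ymax (Y `|` [set (x0, y0)])).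
  split; first exact: subsetUl.
  by move=> /(_ (x0, y0) (or_intror erefl)) Y0; apply: nx0; exists y0.
move=> [x y] [x' y'] [Yp|[-> ->]] [Yq|[-> ->]] //=; first exact: (PY _ _ Yp Yq).
  by split=> E; exfalso; [apply: nx0; exists y|apply: ny0; exists x]; rewrite -E.
by split=> E; exfalso; [apply: nx0; exists y'|apply: ny0; exists x']; rewrite E.
Qed.

(* Zorn's lemma on the pairs [(D, phi)] where [phi] maps [D * D] injectively into [D]. *)
Lemma embeds_square (K : Type) : embeds nat K -> embeds (K * K) K.
Proof.
move=> [n ni].
(* The domain contains the range of [n], so that the two labels [n 0] and [n 1] are always
   available. *)
pose good (t : set K * (K * K -> K)) := [/\ forall i, t.1 (n i),
  forall p, t.1 p.1 -> t.1 p.2 -> t.1 (t.2 p) &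
  forall p q, t.1 p.1 -> t.1 p.2 -> t.1 q.1 -> t.1 q.2 -> t.2 p = t.2 q -> p = q].
pose T := {t | good t}.
pose le (s t : T) := `[< (sval s).1 `<=` (sval t).1 /\
  forall p, (sval s).1 p.1 -> (sval s).1 p.2 -> (sval s).2 p = (sval t).2 p >].
have [ninv nK] : exists g : K -> nat, cancel n g.
  have /choice[g gP] : forall x, exists i, (exists i', n i' = x) -> n i = x.
    move=> x; have [[i ix]|nx] := pselect (exists i, n i = x); first by exists i.
    by exists 0%N => /nx.
  by exists g => i; apply: ni; apply: gP; exists i.
have good0 : good (range n, fun p => n (pickle (ninv p.1, ninv p.2))).
  split=> /=.
  - by move=> i; exists i.
  - by move=> p _ _; exists (pickle (ninv p.1, ninv p.2)).
  - move=> [x y] [x' y'] /= [i _ <-] [j _ <-] [i' _ <-] [j' _ <-] /ni.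
    by rewrite !nK => /(pcan_inj pickleK)[-> ->].
have [||A Atot|[[D phi] [Dn Dphi phi_inj]] tmax] := @ZL_preorder T (exist _ _ good0) le.
- by move=> t; apply/asboolP; split.
- move=> r s t /asboolP[rs1 rs2] /asboolP[st1 st2]; apply/asboolP; split.
    exact: subset_trans st1.
  by move=> p p1 p2; rewrite rs2// st2//; exact: rs1.
- have [->|/set0P[t0 At0]] := eqVneq A set0; first by exists (exist _ _ good0).
  pose D := \bigcup_(t in A) (sval t).1.
  have common x y : D x -> D y -> exists t, [/\ A t, (sval t).1 x & (sval t).1 y].
    move=> [s As sx] [t At ty]; have [/asboolP[st _]|/asboolP[ts _]] := Atot _ _ As At.
      by exists t; split=> //; exact: st.
    by exists s; split=> //; exact: ts.
  have agree s t p : A s -> A t -> (sval s).1 p.1 -> (sval s).1 p.2 ->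
      (sval t).1 p.1 -> (sval t).1 p.2 -> (sval s).2 p = (sval t).2 p.
    move=> As At s1 s2 t1 t2.
    have [/asboolP[_ st]|/asboolP[_ ts]] := Atot _ _ As At; first exact: st.
    by rewrite ts.
  have /choice[phi phiP] : forall p : K * K, exists z, D p.1 -> D p.2 ->
      forall t, A t -> (sval t).1 p.1 -> (sval t).1 p.2 -> z = (sval t).2 p.
    move=> p.
    have [[D1 D2]|nD] := pselect (D p.1 /\ D p.2); last by exists p.1 => D1 D2; case: nD.
    have [s [As s1 s2]] := common _ _ D1 D2.
    by exists ((sval s).2 p) => _ _ t At t1 t2; exact: agree.
  have gD : good (D, phi).
    split=> /=.
    + by move=> i; exists t0 => //; case: (svalP t0).
    + move=> p D1 D2; have [s [As s1 s2]] := common _ _ D1 D2; rewrite (phiP p D1 D2 s As s1 s2).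
      by exists s => //; case: (svalP s) => _ + _; apply.
    + move=> p q Dp1 Dp2 Dq1 Dq2.
      have [s [As s1 s2]] := common _ _ Dp1 Dp2; have [t [At t1 t2]] := common _ _ Dq1 Dq2.
      rewrite (phiP p Dp1 Dp2 s As s1 s2) (phiP q Dq1 Dq2 t At t1 t2).
      have [/asboolP[st1 st2]|/asboolP[ts1 ts2]] := Atot _ _ As At.
        rewrite st2//; case: (svalP t) => _ _ /(_ p q); apply => //; exact: st1.
      rewrite ts2//; case: (svalP s) => _ _ /(_ p q); apply => //; exact: ts1.
  exists (exist _ _ gD) => s As; apply/asboolP; split=> /= [x sx|p s1 s2]; first by exists s.
  by rewrite (phiP p _ _ s)//; exists s.
have {}tmax D' phi' : good (D', phi') -> D `<=` D' ->
    (forall p, D p.1 -> D p.2 -> phi p = phi' p) -> D' `<=` D.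
  move=> gD DD' pp; have /(_ _)/asboolP[|//] := tmax (exist _ _ gD).
  by apply/asboolP; split.
move: Dn Dphi phi_inj => /= Dn Dphi phi_inj.
suff [f [fi fD]] : exists f : K -> K, injective f /\ forall x, D (f x).
  exists (fun p => phi (f p.1, f p.2)) => -[x y] [x' y'] /= E.
  by have [] := phi_inj (f x, f y) (f x', f y') (fD _) (fD _) (fD _) (fD _) E => /fi -> /fi ->.
(* If the complement of [D] embeds in [D], then [D] holds two disjoint copies of itself, labelled by
   [n 0] and [n 1]: one receives [D], the other its complement. *)
have [[h hi]|[h hi]] := embeds_total {x | ~ D x} {x | D x}.
  have d01 : n 0%N <> n 1%N by move=> /ni.
  pose f (x : K) : K := match pselect (D x) with
    | left _ => phi (x, n 0%N) | right nDx => phi (sval (h (exist _ x nDx)), n 1%N) end.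
  exists f; split=> [x y|x]; rewrite /f; last first.
    by case: pselect => Dx; apply: Dphi => //=; exact: proj2_sig.
  case: pselect => Dx; case: pselect => Dy E; have := phi_inj _ _ _ _ _ _ E => /=.
  + by move=> /(_ Dx (Dn _) Dy (Dn _))[].
  + by move=> /(_ Dx (Dn _) (proj2_sig (h _)) (Dn _))[_ /d01].
  + by move=> /(_ (proj2_sig (h _)) (Dn _) Dy (Dn _))[_ /esym /d01].
  by move=> /(_ (proj2_sig (h _)) (Dn _) (proj2_sig (h _)) (Dn _))[] /sval_inj /hi [].
(* Otherwise [hh] places a copy of [D] outside [D]. The union [D'] of both embeds in [D] by [beta],
   so the new pairs can be sent injectively into the copy. This extends [phi] and contradicts
   maximality. *)
exfalso.
pose hh x := if pselect (D x) is left Dx then sval (h (exist _ x Dx)) else x.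
have hhN x : D x -> ~ D (hh x).
  by rewrite /hh; case: pselect => // Dx _; exact: (proj2_sig (h _)).
have hhI x y : D x -> D y -> hh x = hh y -> x = y.
  by rewrite /hh; case: pselect => // Dx _; case: pselect => // Dy _ /sval_inj /hi [].
have /choice[g gP] : forall y, exists z, forall x, D x -> hh x = y -> z = x.
  move=> y.
  have [[x [Dx xy]]|nx] := pselect (exists x, D x /\ hh x = y).
    by exists x => x' Dx' x'y; apply: hhI => //; rewrite xy.
  by exists y => x Dx xy; case: nx; exists x.
pose D' := D `|` hh @` D.
pose beta x := if pselect (D x) is left _ then phi (x, n 0%N) else phi (g x, n 1%N).
have betaD x : D' x -> D (beta x).
  rewrite /beta; case: pselect => [Dx _|nDx [//|[y Dy yx]]]; first exact: (Dphi (_, _) Dx (Dn _)).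
  by apply: Dphi => //=; rewrite (gP _ y).
have beta_inj x y : D' x -> D' y -> beta x = beta y -> x = y.
  have d01 : n 0%N <> n 1%N by move=> /ni.
  rewrite /beta; case: pselect => [Dx _|nDx [//|[x' Dx' xx']]];
    case: pselect => [Dy _|nDy [//|[y' Dy' yy']]] /phi_inj /=.
  + by move=> /(_ Dx (Dn _) Dy (Dn _))[].
  + by rewrite (gP _ y')// => /(_ Dx (Dn _) Dy' (Dn _))[_ /d01].
  + by rewrite (gP _ x')// => /(_ Dx' (Dn _) Dy (Dn _))[_ /esym /d01].
  by rewrite (gP _ x')// (gP _ y')// => /(_ Dx' (Dn _) Dy' (Dn _))[E]; rewrite -xx' -yy' E.
pose phi' (p : K * K) := if pselect (D p.1 /\ D p.2) is left _ then phi p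
  else hh (phi (beta p.1, beta p.2)).
have gD : good (D', phi').
  split=> /=.
  - by move=> i; left.
  - move=> p p1 p2; rewrite /phi'; case: pselect => [[D1 D2]|_]; first by left; exact: Dphi.
    by right; exists (phi (beta p.1, beta p.2)) => //; apply: Dphi; exact: betaD.
  move=> p q p1 p2 q1 q2; rewrite /phi'.
  have dp : D (phi (beta p.1, beta p.2)) by apply: Dphi; exact: betaD.
  have dq : D (phi (beta q.1, beta q.2)) by apply: Dphi; exact: betaD.
  case: pselect => [[Dp1 Dp2]|_]; case: pselect => [[Dq1 Dq2]|_] E.
  - exact: phi_inj.
  - by case: (hhN _ dq); rewrite -E; exact: Dphi.
  - by case: (hhN _ dp); rewrite E; exact: Dphi.
  have [] := phi_inj (beta p.1, beta p.2) (beta q.1, beta q.2) (betaD _ p1) (betaD _ p2)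
    (betaD _ q1) (betaD _ q2) (hhI _ _ dp dq E).
  case: p q {E dp dq} p1 p2 q1 q2 => [x y] [x' y'] /= p1 p2 q1 q2.
  by move=> /(beta_inj _ _ p1 q1) -> /(beta_inj _ _ p2 q2) ->.
have D'D : D' `<=` D.
  apply: tmax gD _ _ => [x Dx|p D1 D2]; first by left.
  by rewrite /phi'; case: pselect => // -[].
apply: (hhN _ (Dn 0%N)); apply: D'D; right.
by exists (n 0%N).
Qed.

Lemma embeds_seq (K : Type) : embeds nat K -> embeds (seq K) K.
Proof.
move=> nK; have [phi phi_inj] := embeds_square nK; have [n ni] := nK.
pose code := fix code (s : seq K) := if s is x :: s' then phi (x, code s') else n 0%N.
(* The length is recorded because codes of lists of different lengths may collide. *)
exists (fun s => phi (n (size s), code s)) => s t /phi_inj[/ni].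
elim: s t => [|x s IH] [|y t] //= [st] /phi_inj[-> E].
by rewrite (IH t).
Qed.

(* Pull a well-order of [I] back along an embedding of [I] into its least initial segment
   (if any) that admits one. *)
Lemma initial_order (I : Type) : exists lt : I -> I -> Prop,
  [/\ well_founded lt, forall x y, x <> y -> lt x y \/ lt y x &
    forall x, ~ exists2 f : I -> I, injective f & forall y, lt (f y) x].
Proof.
elim/Peq: I => I; have [R woR] := wochoice.well_ordering_principle I.
have Rmin (A : set I) : A !=set0 -> exists z, [/\ A z, forall x, A x -> R z x &
      forall z', A z' -> (forall x, A x -> R z' x) -> z = z'].
  move=> [a Aa]; have [|z [[zA zmin] zuniq]] := woR [pred x | `[< A x >]].
    by exists a; exact/asboolP.
  exists z; split; first exact/asboolP.
    by move=> x Ax; apply: zmin; exact/asboolP.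
  move=> z' Az' z'min; apply: zuniq; split; first exact/asboolP.
  by move=> x /asboolP; exact: z'min.
have Rtot x y : R x y \/ R y x.
  have [|z [[->|->] zm _]] := Rmin [set x; y]; first by exists x; left.
    by left; apply: zm; right.
  by right; apply: zm; left.
pose lt0 x y := ~ R y x.
have wf0 : well_founded lt0.
  move=> x; apply: contrapT => nx.
  have [|z [nz zmin _]] := Rmin [set y | ~ Acc lt0 y]; first by exists x.
  apply: nz; constructor => y yz; apply: contrapT => ny.
  by apply: yz; exact: zmin.
have lt0_tot x y : x <> y -> lt0 x y \/ lt0 y x.
  move=> xy; have [yx|] := pselect (R y x); last by left.
  right=> xy'; apply: xy; have [|z [_ _ zu]] := Rmin [set x; y]; first by exists x; left.
  have Rxx u : R u u by have [] := Rtot u u.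
  rewrite -(zu x); [apply: zu|by left|]; first by right.
    by move=> u [->|->].
  by move=> u [->|->].
pose big x := exists2 f : I -> I, injective f & forall y, lt0 (f y) x.
have [[x bx]|nbig] := pselect (exists x, big x); last first.
  by exists lt0; split=> // x bx; apply: nbig; exists x.
elim/(well_founded_ind wf0): x bx => x IH [f fi fx].
have [[y yx by_]|nbig] := pselect (exists2 y, lt0 y x & big y); first exact: IH yx by_.
exists (fun y z => lt0 (f y) (f z)); split.
- suff acc u y : f y = u -> Acc (fun y z => lt0 (f y) (f z)) y by move=> y; exact: acc.
  elim/(well_founded_ind wf0): u y => u IHu y yu; constructor => z zy.
  by apply: (IHu (f z)) => //; rewrite -yu.
- by move=> y z yz; apply: lt0_tot => /fi.
- move=> y [g gi gy]; apply: nbig; exists (f y) => //.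
  by exists (f \o g) => //; exact: inj_comp.
Qed.

(** Well-founded recursion. The step is chosen for total families, so the part already built is
    completed by [t0]; the condition on step [i] only looks below [i]. *)
Lemma wf_choice (I T : Type) (t0 : T) (lt : I -> I -> Prop) (P : I -> T -> I -> T -> Prop) :
  well_founded lt ->
  (forall i (z : I -> T), exists t, forall j, lt j i -> P i t j (z j)) ->
  exists z : I -> T, forall i j, lt j i -> P i (z i) j (z j).
Proof.
move=> wf Pex.
have /choice[step stepP] : forall p : I * (I -> T), exists t,
    forall j, lt j p.1 -> P p.1 t j (p.2 j).
  by move=> [i z]; exact: Pex.
pose F i (rec : forall j, lt j i -> T) :=
  step (i, fun j => if pselect (lt j i) is left ji then rec j ji else t0).
have FixE i : Fix wf (fun=> T) F i = F i (fun j _ => Fix wf (fun=> T) F j).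
  apply: Fix_eq => {}i u v uv; rewrite /F; congr (step (i, _)); apply/funext => j.
  by case: pselect.
exists (Fix wf (fun=> T) F) => i j ji; rewrite FixE /F.
have := stepP (i, fun j => if pselect (lt j i) is left ji then Fix wf (fun=> T) F j else t0) j ji.
by rewrite /=; case: pselect.
Qed.

End cardinals.

(** * The lower bound *)

Section net.
Context (G : topologicalGroupType) (R : realType) (mu : leftHaarMeasure G R).
Hypothesis hG : hausdorff_space G.
Hypothesis lcG : locally_compact [set: G].
Context (Delta : G -> R) (mDelta : modular_function mu Delta).
Local Notation C := R[i].
Local Notation L1 := (L1 mu).
Local Notation N := (@L1norm G R mu).
Local Notation conv := (@Defs.conv G R mu).
Local Notation L1inv := (L1inv hG lcG mDelta).
Local Notation density := (@density G R mu).
Implicit Types (f g h F phi : L1) (e : R) (A Q S : set G).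

Lemma compact_bigcup_seq (I : eqType) (s : seq I) (A : I -> set G) :
  (forall i, compact (A i)) -> compact (\bigcup_(i in [set` s]) A i).
Proof.
move=> cA; elim: s => [|i s IH].
  by rewrite (_ : [set` [::]] = set0) ?bigcup_set0; [exact: compact0|apply/seteqP; split].
rewrite (_ : [set` i :: s] = i |` [set` s]); last first.
  apply/seteqP; split=> [j|j]; rewrite /= inE.
    by move=> /orP[/eqP ->|js]; [left|right].
  by move=> [->|js]; rewrite ?eqxx// js orbT.
by rewrite bigcup_setU1; apply: compactU.
Qed.

Lemma covering_infinite (K : Type) : ~ compact [set: G] -> compact_covering G K ->
  embeds nat K.
Proof.
move=> ncG [A cA AG]; apply/embedsP/infiniteP => fK; apply: ncG; move: K A cA AG fK.
elim/Peq => K A cA AG /finite_seqP[s sE].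
by rewrite -AG sE; exact: compact_bigcup_seq.
Qed.

(** [conv_estimate] at [d = 1], with bound [e] on [Q] and, off [Q], where [phi] should have little
    mass, the trivial bound 2 for the distance of two densities. *)
Lemma conv_almost_invariant phi h Q e : 0 <= e -> density phi -> density h -> compact Q ->
  (forall y, Q y -> N (translate (y^-1)%g h - h) <= e) ->
  N (conv phi h - h) <= 2 * (e + 2 * N (phi - restrL1 Q phi)).
Proof.
move=> e0 dphi dh cQ hQ; have mQ := compact_mbl hG cQ.
pose b (y : G) : R := e + 2 * \1_(~` Q) y.
have mb : measurable_fun setT (b : borel G -> R).
  apply: measurable_funD; first exact: measurable_cst.
  apply: measurable_funM; first exact: measurable_cst.
  by apply: measurable_indic; exact: measurableC.
have := conv_estimate hG lcG (g := phi) (h := h) (d := 1%g) mb.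
rewrite density_cintegral// scale1r invg1 translate1 -lee_fin => /(_ _)/le_trans; apply.
  move=> y _; rewrite /b indicE in_setC; case: (boolP (y \in Q)) => [/set_mem Qy|_] /=.
    by rewrite mulr0 addr0; exact: hQ.
  rewrite mulr1; apply: (le_trans (L1normD _ _)).
  by rewrite L1normN L1norm_translate dh.2; lra.
rewrite EFinM lee_pmul2l//=.
rewrite (_ : (fun y => (cmod (phi y) * b y)%:E) = (fun y => e%:E * (cmod (phi y))%:E +
    2%:E * (cmod ((phi - restrL1 Q phi) y))%:E)%E); last first.
  apply/funext => y; rewrite -!EFinM -EFinD L1valB restrL1E// /b; congr EFin.
  rewrite mulrDr mulrC; congr (_ + _); rewrite mulrCA; congr (_ * _).
  rewrite !indicE in_setC; case: (y \in Q) => /=.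
    by rewrite mulr0 mulr1 subrr cmod0.
  by rewrite mulr1 mulr0 subr0.
have m0 f : forall x : borel G, [set: borel G] x -> (0 <= (cmod (f x))%:E)%E.
  by move=> x _; rewrite lee_fin cmod_ge0.
rewrite ge0_integralD//; last 4 first.
- by move=> x _; rewrite -EFinM lee_fin mulr_ge0// cmod_ge0.
- by apply: measurable_funeM; exact: L1_measurable_cmod.
- by move=> x _; rewrite -EFinM lee_fin mulr_ge0// cmod_ge0.
- by apply: measurable_funeM; exact: L1_measurable_cmod.
rewrite !ge0_integralZl ?lee_fin//; try exact: L1_measurable_cmod; try exact: m0.
by rewrite -!L1normE dphi.2 mule1 -EFinM -EFinD.
Qed.

Definition spread x F := conv F (translate x (L1inv F)).

Lemma density_spread x F : density F -> density (spread x F).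
Proof. by move=> dF; apply: density_conv => //; apply: density_translate; exact: density_inv. Qed.

Lemma spread_supported x F Q : supported F Q ->
  supported (spread x F) (mulset (mulset Q [set x^-1%g]) (invset Q)).
Proof.
move=> FQ y; rewrite /spread convE// => /eqP ny.
have [z zn] : exists z, F z * translate x (L1inv F) (z^-1 * y)%g != 0.
  apply: contrapT => nz; apply: ny.
  rewrite (_ : (fun _ => _) = ((0 : L1) : G -> C)).
    by have := @cintegralZ _ _ mu 0 0; rewrite scale0r mul0r.
  by apply/funext => z; apply/eqP; apply/negPn/negP => zn; apply: nz; exists z.
move: zn; rewrite mulf_eq0 negb_or => /andP[/FQ Qz].
rewrite translateE L1invE mulf_eq0 negb_or => /andP[/FQ Qw _].
exists (z * x^-1)%g; first by exists z => //; exists x^-1%g.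
exists (x * (z^-1 * y))%g; last by rewrite mulgA mulgVK mulVKg.
by exists ((x * (z^-1 * y))^-1)%g => //; rewrite invgK.
Qed.

(** Left translation acts on the first factor [F]. The involution of the product has as first factor
    a right translate of [F], which commutes with left translation, so the same bound holds whatever
    [x] is. Left invariance of the involution amounts to right invariance of the product. *)
Lemma spread_invariant x F c e : density F -> N (translate c F - F) <= e ->
  N (translate c (spread x F) - spread x F) <= 2 * e /\
  N (translate c (L1inv (spread x F)) - L1inv (spread x F)) <= 2 * e.
Proof.
move=> dF Fe; have [_ NF] := dF; rewrite /spread; set h := translate x (L1inv F).
have Nh : N h = 1 by rewrite L1norm_translate L1norm_inv.
split.
  rewrite translate_conv//; apply: (le_trans (L1normB_conv_l hG lcG _ _ _)).
  by rewrite Nh mulr1 ler_pM2l.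
have hE := conv_inv hG lcG mDelta F h; set u := L1inv (conv F h) in hE *.
set v := conv _ _ in hE.
have -> : N (translate c u - u) = N (translate c v - v).
  apply: L1eq_norm; rewrite /L1eq; set w := (X in N X).
  have -> : w = translate c (u - v) - (u - v).
    by apply: L1_ext => y; rewrite /w !(L1valD, L1valN, translateE); ring.
  apply/eqP; rewrite eq_le L1norm_ge0 andbT; apply: (le_trans (L1normD _ _)).
  by rewrite L1normN L1norm_translate hE addr0.
rewrite /v translate_conv//; apply: (le_trans (L1normB_conv_l hG lcG _ _ _)).
rewrite L1norm_inv NF mulr1 ler_pM2l// /h L1inv_translate L1invK translate_L1rt.
rewrite (_ : _ - _ = L1rt hG lcG mDelta (x^-1)%g (translate c F - F)) ?L1norm_rt//.
by apply: L1_ext => y; rewrite !(L1valD, L1valN, L1rtE); ring.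
Qed.

(** [base i] lists the pieces of a compact cover on which [f i] is made almost invariant, and its
    length sets the accuracy; [s] and [n] thus describe a tail of the net. The sets [O i] around the
    supports are open so that the union of any subfamily is Borel. *)
Lemma disjoint_net (K : choiceType) (I : Type) (base : I -> seq K) :
  compact_covering_number G K -> amenable mu -> embeds I K ->
  exists (f : I -> L1) (O : I -> set G), [/\ forall i, density (f i),
    forall i, open (O i), forall i, supported (f i) (O i),
    forall i j x, i <> j -> O i x -> ~ O j x &
    forall phi e, density phi -> 0 < e -> exists (s : seq K) n, forall i, {subset s <= base i} ->
      (n <= size (base i))%N -> N (conv phi (f i) - f i) <= e /\ N (conv (f i) phi - f i) <= e].
Proof.
move=> [[A cA AG] Kmin] am IK.
(* The pieces of the cover are thickened so that their interiors cover [G]: then every compact set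
   lies in finitely many of them ([Qcover]). *)
have /choice[OQ OQP] : forall k, exists p : set G * set G,
    [/\ open p.1, A k `<=` p.1, compact p.2 & p.1 `<=` p.2].
  move=> k; have [V [Q [oV AV cQ VQ _]]] := compact_open_nbhs lcG (cA k) openT Logic.I.
  by exists (V, Q).
pose Q k := (OQ k).2.
have cQ k : compact (Q k) by case: (OQP k).
have Qcover S : compact S -> exists s : seq K, forall x, S x -> exists2 k, k \in s & Q k x.
  move=> cS; have [|x Sx|s _ sS] := compact_cover_seq (D := setT) (f := fun k => (OQ k).1) cS.
  - by move=> k _; case: (OQP k).
  - have : [set: G] x by []; rewrite -AG => -[k _ Akx]; exists k => //.
    by case: (OQP k) => _ + _ _; apply.
  - exists s => x /sS[k ks kx]; exists k => //; by case: (OQP k) => _ _ _; apply.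
pose eps i : R := (size (base i)).+1%:R^-1.
have eps0 i : 0 < eps i by rewrite invr_gt0.
have /choice[FS FSP] : forall i, exists p : L1 * set G, [/\ density p.1, compact p.2,
    supported p.1 p.2 & forall k y, k \in base i -> Q k y ->
      N (translate (y^-1)%g p.1 - p.1) <= eps i].
  (* Inverses of the pieces, because [conv_estimate] translates by [y^-1]. *)
  move=> i; have [F [S [dF cS FS Fe]]] := compact_reiter hG lcG am
    (compact_bigcup_seq (s := base i) (fun k => compact_invset (cQ k))) (eps0 i).
  exists (F, S); split=> //= k y ki Qy; apply: Fe; exists k => //.
  by exists y.
pose F i := (FS i).1.
have /choice[PP PPP] : forall i, exists p : set G * set G,
    [/\ open p.1, (FS i).2 `<=` p.1, compact p.2 & p.1 `<=` p.2].
  move=> i; have cS : compact (FS i).2 by case: (FSP i).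
  have [V [S [oV AV cS' VS _]]] := compact_open_nbhs lcG cS openT Logic.I.
  by exists (V, S).
pose P i := (PP i).1; pose P' i := (PP i).2.
have oP i : open (P i) by case: (PPP i).
have cP' i : compact (P' i) by case: (PPP i).
have PP' i : P i `<=` P' i by case: (PPP i).
have [lt [wf lt_tot small]] := initial_order I.
(* The forbidden values for the parameter at [i]: with [O i = P i z_i (P i)^-1], a common point of
   [O i] and [O j] puts [z_i] in [(P i)^-1 P j z_j (P j)^-1 P i]. *)
pose B i j (z : G) := mulset (mulset (invset (P' i))
  (mulset (mulset (P' j) [set z]) (invset (P' j)))) (P' i).
have cB i j z : compact (B i j z).
  apply: compact_mulset => //; apply: compact_mulset; first exact: compact_invset.
  apply: compact_mulset; last exact: compact_invset.
  by apply: compact_mulset => //; exact: compact_set1.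
have [|z zP] := @wf_choice I G 1%g lt (fun i t j w => ~ B i j w t) wf.
  (* If the forbidden sets of the earlier indices covered [G], then [K], and with it [I], would
     embed in the initial segment below [i], against the choice of the order. *)
  move=> i z; apply: contrapT => noz; apply: (small i).
  have /Kmin/embedsP[g gi] : compact_covering G {j | lt j i}.
    exists (fun j => B i (sval j) (z (sval j))) => //.
    apply/seteqP; split=> // t _; apply: contrapT => nt; apply: noz; exists t => j ji Bt.
    by apply: nt; exists (exist _ j ji).
  have [g' gi'] := IK; exists (fun j => sval (g (g' j))) => [x y|y].
    by move=> /sval_inj /gi /gi'.
  exact: (proj2_sig (g (g' y))).
pose f i := spread (z i)^-1%g (F i).
pose O i := mulset (mulset (P i) [set z i]) (invset (P i)).
have OB i j x : O i x -> O j x -> B i j (z j) (z i).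
  move=> [_ [a Pa [_ -> <-]] [_ [b Pb <-] <-]] [u [a' Pa' [_ -> ua]] [v [b' Pb' vb] uv]].
  exists (a^-1 * (u * v))%g; last first.
    by exists b; [exact: PP'|rewrite uv !mulgA mulgVK mulVg mul1g].
  exists a^-1%g; first by exists a => //; exact: PP'.
  exists (u * v)%g => //; exists u.
    by rewrite -ua; exists a'; [exact: PP'|exists (z j)].
  by exists v => //; rewrite -vb; exists b' => //; exact: PP'.
exists f, O; split.
- by move=> i; apply: density_spread; case: (FSP i).
- by move=> i; apply: open_mulset_l; apply: open_mulset_l.
- move=> i x /(spread_supported (Q := P i)); rewrite invgK; apply.
  by move=> y Fy; case: (PPP i) => _ + _ _; apply; case: (FSP i) => _ _ + _; apply.
- move=> i j x /lt_tot[ij|ji] Oi Oj.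
    exact: (zP j i ij (OB _ _ _ Oj Oi)).
  exact: (zP i j ji (OB _ _ _ Oi Oj)).
move=> phi e dphi e0.
(* With tails and [eps i] at most [e / 8], [spread_invariant] gives [2 * (e / 8)] and
   [conv_almost_invariant] gives [2 * (2 * (e / 8) + 2 * (e / 8)) = e]. *)
have [S1 cS1 S1e] := L1_tight hG phi (e := e / 8) (divr_gt0 e0 (ltr0Sn _ _)).
have [S2 cS2 S2e] := L1_tight hG (L1inv phi) (e := e / 8) (divr_gt0 e0 (ltr0Sn _ _)).
have [s sS] := Qcover (S1 `|` S2) (compactU cS1 cS2).
have [n ne] : exists n : nat, n.+1%:R^-1 <= e / 8.
  have e80 : 0 < e / 8 by rewrite divr_gt0.
  have h : 0 <= (e / 8)^-1 by rewrite invr_ge0 ltW.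
  exists (Num.bound (e / 8)^-1); rewrite invf_ple ?posrE//.
  by apply: le_trans (ltW (archi_boundP h)) _; rewrite ler_nat.
exists s, n => i si ni.
have epsi : eps i <= e / 8.
  by apply: le_trans ne; rewrite lef_pV2 ?posrE// ler_nat.
have e20 : 0 <= 2 * (e / 8) by rewrite mulr_ge0// divr_ge0// ltW.
have dF : density (F i) by case: (FSP i).
have inv y : (S1 `|` S2) y -> N (translate (y^-1)%g (f i) - f i) <= 2 * (e / 8) /\
    N (translate (y^-1)%g (L1inv (f i)) - L1inv (f i)) <= 2 * (e / 8).
  move=> /sS[k ks Qky]; apply: spread_invariant => //.
  apply: le_trans epsi; case: (FSP i) => _ _ _ /(_ k); apply => //; exact: si.
have df : density (f i) by exact: density_spread.
split.
  have := conv_almost_invariant e20 dphi df cS1 (fun y S1y => (inv y (or_introl S1y)).1).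
  by move=> /le_trans; apply; move: S1e; lra.
(* The isometry [L1inv] turns [f i * phi] into [L1inv phi * L1inv (f i)], which reduces the bound on
   the right to the one on the left; hence the set [S2], chosen for [L1inv phi]. *)
rewrite -(L1norm_inv hG lcG mDelta).
have -> : N (L1inv (conv (f i) phi - f i)) = N (conv (L1inv phi) (L1inv (f i)) - L1inv (f i)).
  apply: L1eq_norm; rewrite /L1eq; set w := (X in N X).
  rewrite (_ : w = L1inv (conv (f i) phi) - conv (L1inv phi) (L1inv (f i))); last first.
    by apply: L1_ext => y; rewrite /w !(L1valD, L1valN, L1invE); ring.
  exact: conv_inv.
have := conv_almost_invariant e20 (density_inv hG lcG mDelta dphi)
  (density_inv hG lcG mDelta df) cS2 (fun y S2y => (inv y (or_intror S2y)).2).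
by move=> /le_trans; apply; move: S2e; lra.
Qed.

End net.

(** * An independent family of sets and its filters *)

Section independent_family.
Context (K : choiceType).
Local Notation I := (seq K * seq (seq K))%type.
Implicit Types (A B : set K) (chi : set (set K)) (i : I).

Definition trace A (s : seq K) : seq K := [seq k <- s | `[< A k >]].

(* The sets [hits A], [A : set K], form an independent family of subsets of [I],
   even relative to every tail of [I]. *)
Definition hits A : set I := [set i : I | trace A i.1 \in i.2].

(** The filter generated by the tails of the index set together with [hits A] for [A] in [chi] and
    the complement of [hits A] for the other [A]. *)
Definition pattern_filter chi : set_system I := [set Y | exists (l : seq (set K)) (s : seq K) n,
  forall i, {subset s <= i.1} -> (n <= size i.1)%N ->
    (forall A, A \in l -> hits A i <-> chi A) -> Y i].

(** Independence: if [F] contains a point separating any two distinct members of [l], their traces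
    on [F] are distinct, and listing the traces of those in [chi] gives an index that hits exactly
    these. The copies of [k0] supply the required length. *)
Lemma pattern_filter_proper chi (k0 : K) : ProperFilter (pattern_filter chi).
Proof.
apply: Build_ProperFilter_ex => [Y [l [s [n Yl]]]|].
  have /choice[d dP] : forall p : set K * set K, exists k, p.1 <> p.2 -> ~ (p.1 k <-> p.2 k).
    move=> [A B]; have [->|AB] := pselect (A = B); first by exists k0.
    have /existsNP[k nk] : ~ forall k, A k <-> B k.
      by move=> h; apply: AB; apply/seteqP; split=> k /h.
    by exists k.
  pose F := s ++ nseq n k0 ++ [seq d (A, B) | A <- l, B <- l].
  pose SS := [seq trace A F | A <- l & `[< chi A >]].
  exists (F, SS); apply: Yl => /=.
  - by move=> k ks; rewrite mem_cat ks.
  - by rewrite !size_cat size_nseq addnCA leq_addr.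
  move=> B Bl; split=> [|chiB].
    move=> /mapP[A]; rewrite mem_filter => /andP[/asboolP chiA Al] BA.
    suff -> : B = A by [].
    apply: contrapT => nBA; apply: (dP (B, A) nBA) => /=.
    have dF : d (B, A) \in F.
      by rewrite !mem_cat (_ : d (B, A) \in flatten _) ?orbT//; apply/allpairsP; exists (B, A).
    have := congr1 (fun t => d (B, A) \in t) BA.
    rewrite /= !mem_filter dF !andbT => E.
    by split=> /asboolP; [rewrite E|rewrite -E] => /asboolP.
  by apply/mapP; exists B => //; rewrite mem_filter Bl andbT; exact/asboolP.
split.
- by exists [::], [::], 0%N.
- move=> Y Z [l [s [n Yl]]] [l' [s' [n' Zl]]]; exists (l ++ l'), (s ++ s'), (maxn n n').
  move=> i ssi; rewrite geq_max => /andP[ni n'i] li; split.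
    by apply: Yl => // [k ks|A Al]; [apply: ssi|apply: li]; rewrite mem_cat ?ks ?Al.
  by apply: Zl => // [k ks|A Al]; [apply: ssi|apply: li]; rewrite mem_cat ?ks ?Al orbT.
- by move=> Y Z YZ [l [s [n Yl]]]; exists l, s, n => i h1 h2 h3; apply: YZ; exact: Yl.
Qed.

End independent_family.

(** * Limits of densities along ultrafilters *)

Section ultralimits.
Context (R : realType) (I : Type) (U : set_system I) (hU : UltraFilter U).
Local Notation C := R[i].

Lemma ultra_lim_real (u : I -> R) (M : R) : (forall i, `|u i| <= M) ->
  exists l, forall e, 0 < e -> U [set i | `|u i - l| < e].
Proof.
move=> uM; pose E := [set r | U [set i | r <= u i]].
have E0 : E !=set0.
  exists (- M); apply: filterS filterT => i _ /=.
  by have := uM i; rewrite ler_norml => /andP[].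
have ubE : has_ubound E.
  exists M => r /filter_ex[i /= ri]; apply: (le_trans ri).
  exact: le_trans (ler_norm _) (uM i).
exists (sup E) => e e0.
have [r Er re] := sup_adherent e0 (conj E0 ubE).
have [h|h] := in_ultra_setVsetC [set i | sup E + e / 2 <= u i] hU.
  by have := ub_le_sup ubE h; lra.
apply: filterS (filterI Er h) => i [/= ri /negP]; rewrite -ltNge => ui.
rewrite ltr_norml; apply/andP; split; lra.
Qed.

Lemma ultra_lim (u : I -> C) (M : R) : (forall i, cmod (u i) <= M) ->
  exists l, forall e, 0 < e -> U [set i | cmod (u i - l) < e].
Proof.
move=> uM.
have [a ha] := ultra_lim_real (fun i => le_trans (cmod_Re (u i)) (uM i)).
have [b hb] := ultra_lim_real (fun i => le_trans (cmod_Im (u i)) (uM i)).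
exists (Complex a b) => e e0; have e20 : 0 < e / 2 by rewrite divr_gt0.
apply: filterS (filterI (ha _ e20) (hb _ e20)) => i [/= hr hi].
apply: le_lt_trans (cmod_le _) _; rewrite cReD cImD cReN cImN /=; lra.
Qed.

(** The set does not depend on its index, so membership in [U] just means that the inequality holds.
    In this form it can be derived from estimates valid for most indices. *)
Lemma ultra_eq (a b : C) (c : R) : 0 <= c ->
  (forall e, 0 < e -> U [set _ | cmod (a - b) <= c * e]) -> a = b.
Proof.
move=> c0 ab; apply/eqP; rewrite -subr_eq0 -cmod_eq0 eq_le cmod_ge0 andbT.
apply/ler_addgt0Pr => e e0; rewrite add0r.
have c1 : 0 < c + 1 by rewrite ltr_wpDl.
have [_ /= /le_trans] := filter_ex (ab _ (divr_gt0 e0 c1)); apply.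
by rewrite mulrA ler_pdivrMr// mulrC ler_wpM2l ?(ltW e0)// lerDl.
Qed.

End ultralimits.

Section ultra_means.
Context (G : topologicalGroupType) (R : realType) (mu : leftHaarMeasure G R).
Hypothesis hG : hausdorff_space G.
Hypothesis lcG : locally_compact [set: G].
Context (Delta : G -> R) (mDelta : modular_function mu Delta).
Local Notation C := R[i].
Local Notation L1 := (L1 mu).
Local Notation Linf := (Linf mu).
Local Notation N := (@L1norm G R mu).
Local Notation conv := (@Defs.conv G R mu).
Local Notation density := (@density G R mu).
Implicit Types (f g h F phi : L1) (S T : Linf) (e : R) (A Q : set G).

Lemma P1_density f : P1 f -> exists2 g, density g & L1eq f g.
Proof.
move=> [/ae_nonnegP[g g0 fg] Nf]; exists g => //; split=> //.
by rewrite -(L1eq_norm fg).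
Qed.

Lemma L1eq_conv_l f g h : L1eq f g -> L1eq (conv f h) (conv g h).
Proof.
move=> fg; apply/eqP; rewrite eq_le L1norm_ge0 andbT.
by apply: le_trans (L1normB_conv_l hG lcG _ _ _) _; rewrite fg mul0r mulr0.
Qed.

Lemma L1eq_conv_r f g h : L1eq f g -> L1eq (conv h f) (conv h g).
Proof.
move=> fg; apply/eqP; rewrite eq_le L1norm_ge0 andbT.
by apply: le_trans (L1normB_conv_r hG lcG _ _ _) _; rewrite fg !mulr0.
Qed.

(** [m] is the weak-star limit of the densities along [U]. Each property of a mean is the limit of
    the same property of [T |-> T (f i)], exact or approximate. *)
Lemma ultra_mean (I : Type) (U : set_system I) (f : I -> L1) : UltraFilter U ->
  (forall i, density (f i)) ->
  (forall phi e, density phi -> 0 < e ->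
    U [set i | N (conv phi (f i) - f i) <= e /\ N (conv (f i) phi - f i) <= e]) ->
  exists2 m, TIM mu m & forall T e, 0 < e -> U [set i | cmod (T (f i) - m T) < e].
Proof.
move=> hU df inv.
have /choice[m mE] : forall T, exists l, forall e, 0 < e -> U [set i | cmod (T (f i) - l) < e].
  move=> T; have [M M0 MT] := Linf_bound T.
  by apply: (ultra_lim hU (M := M)) => i; have := MT (f i); rewrite (df i).2 mulr1.
have close S T (c : R) : 0 <= c ->
    (forall e, 0 < e -> U [set i | cmod (S (f i) - T (f i)) <= c * e]) -> m S = m T.
  move=> c0 ST; apply: (ultra_eq hU (c := c + 2)); first by rewrite addr_ge0.
  move=> e e0; apply: filterS (filterI (ST e e0) (filterI (mE S e e0) (mE T e e0))).
  move=> i /= [h1 [h2 h3]].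
  rewrite (_ : m S - m T = - (S (f i) - m S) + (S (f i) - T (f i)) + (T (f i) - m T)); last by ring.
  apply: (le_trans (cmodD _ _)); rewrite mulrDl.
  have := cmodD (- (S (f i) - m S)) (S (f i) - T (f i)); rewrite cmodN; lra.
exists m => //; split; [split|..].
- move=> a S T; suff : m (a *: S + T) = a * m S + m T by [].
  apply: (ultra_eq hU (c := cmod a + 2)); first by rewrite addr_ge0// cmod_ge0.
  move=> e e0.
  apply: filterS (filterI (mE (a *: S + T) e e0) (filterI (mE S e e0) (mE T e e0))).
  move=> i /= [h1 [h2 h3]].
  rewrite (_ : _ - _ = - ((a *: S + T) (f i) - m (a *: S + T)) + a * (S (f i) - m S) +
    (T (f i) - m T)); last by rewrite LinfvalD LinfvalZ; ring.
  apply: (le_trans (cmodD _ _)).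
  have := cmodD (- ((a *: S + T) (f i) - m (a *: S + T))) (a * (S (f i) - m S)).
  rewrite cmodN cmodM.
  have := ler_wpM2l (cmod_ge0 a) (ltW h2); rewrite mulrDl; lra.
- move=> T T0; have Tf i : 0 <= T (f i) by apply: T0; apply: aeW; exact: (df i).1.
  have key e : 0 < e -> `|complex.Im (m T)| <= e /\ - e <= complex.Re (m T).
    move=> e0; have [i /= hi] := filter_ex (mE T e e0).
    have /complex_ge0P[Ti Tr] := Tf i.
    have := le_lt_trans (cmod_Im _) hi; rewrite cImD cImN Ti add0r normrN => h.
    have := le_lt_trans (cmod_Re _) hi; rewrite cReD cReN ltr_norml => /andP[h1 h2].
    by split; [exact: ltW|lra].
  apply/complex_ge0P; split; last by apply/ler_addgt0Pr => e /key[_]; lra.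
  apply/eqP; rewrite -normr_eq0 eq_le normr_ge0 andbT; apply/ler_addgt0Pr => e /key[+ _].
  by rewrite add0r.
- apply: (ultra_eq hU (c := 1)) => // e e0; apply: filterS (mE (Linf_one mu) e e0) => i /=.
  by rewrite (density_cintegral (df i)) -cmodN opprB mul1r => /ltW.
- move=> phi T /P1_density[psi dpsi pp]; have [M M0 MT] := Linf_bound T.
  apply: (close _ _ M (ltW M0)) => e e0; apply: filterS (inv psi e dpsi e0) => i /= [h _].
  rewrite lmodactE// (Linf_eq T (L1eq_conv_l (f i) pp)) -LinfB.
  by apply: (le_trans (MT _)); rewrite ler_wpM2l// ltW.
- move=> phi T /P1_density[psi dpsi pp]; have [M M0 MT] := Linf_bound T.
  apply: (close _ _ M (ltW M0)) => e e0; apply: filterS (inv psi e dpsi e0) => i /= [_ h].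
  rewrite rmodactE// (Linf_eq T (L1eq_conv_r (f i) pp)) -LinfB.
  by apply: (le_trans (MT _)); rewrite ler_wpM2l// ltW.
Qed.

(** The indicator function of [A] as an element of [Linf]; such functionals separate the means. *)
Lemma restr_functional A : measurable (A : set (borel G)) ->
  exists T : Linf, forall g, T g = cintegral mu (restrL1 A g).
Proof.
move=> mA; suff Tp : (fun g => cintegral mu (restrL1 A g)) \in @Linfpred _ _ mu.
  by exists (MkLinf Tp).
rewrite inE; split=> [a f g|]; first by rewrite restrL1_linear// cintegral_linear.
exists 2 => f; rewrite -cmodE lecR; apply: (le_trans (cmod_cintegral _)).
by rewrite ler_pM2l// L1norm_restr.
Qed.

Lemma card_TIM_ge (K : choiceType) : compact_covering_number G K -> ~ compact [set: G] ->
  amenable mu -> [set: set (set K)] #<= TIM mu.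
Proof.
move=> cK ncG am; have natK := covering_infinite ncG cK.1.
pose I := (seq K * seq (seq K))%type.
(* An infinite [K] absorbs finite lists, lists of lists and pairs. *)
have IK : embeds I K.
  apply: embeds_trans (embeds_square natK); apply: embeds_prod; first exact: embeds_seq.
  have [c ci] := embeds_seq natK; apply: embeds_trans (embeds_seq natK).
  by exists (map c); exact: inj_map.
have [f [ O [df oO fO dO inv]]] :=
  disjoint_net hG lcG mDelta (fun i : I => i.1) cK am IK.
have [k0 _] := natK.
(* What is retained of the ultrafilter: [m T = 1] if [A] is in [chi] and [T] is 1 at the [f i] with
   [i] in [hits A]; [m T = 0] if [A] is not in [chi] and [T] is 0 at the remaining [f i]. *)
have /choice[m mP] : forall chi : set (set K), exists m, TIM mu m /\
    forall T, (forall A : set K, chi A -> (forall i, hits A i -> T (f i) = 1) -> m T = 1) /\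
      (forall A : set K, ~ chi A -> (forall i, ~ hits A i -> T (f i) = 0) -> m T = 0).
  move=> chi; have [U [hU FU]] := ultraFilterLemma (pattern_filter_proper chi (k0 0%N)).
  have [|m mTIM mE] := ultra_mean hU df.
    move=> phi e dphi e0; have [s [n sn]] := inv phi e dphi e0.
    by apply: FU; exists [::], s, n => i si ni _; exact: sn.
  exists m; split=> // T; split=> A chiA TA.
    apply: (ultra_eq hU (c := 1)) => // e e0.
    have UA : U (hits A).
      by apply: FU; exists [:: A], [::], 0%N => i _ _ h; apply/h => //; rewrite mem_head.
    apply: filterS (filterI UA (mE T e e0)) => i [/TA /= ->].
    by rewrite -cmodN opprB mul1r => /ltW.
  apply: (ultra_eq hU (c := 1)) => // e e0.
  have UA : U (~` hits A).
    by apply: FU; exists [:: A], [::], 0%N => i _ _ h /h; rewrite mem_head => /(_ isT).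
  apply: filterS (filterI UA (mE T e e0)) => i [/TA /= ->].
  by rewrite -cmodN opprB mul1r => /ltW.
have m_inj : injective m.
  move=> chi chi' mm; suff sub c c' : m c = m c' -> c `<=` c'.
    by apply/seteqP; split; apply: sub.
  move=> {}mm A cA; apply: contrapT => nc'A.
  (* As the [O i] are disjoint, the indicator of this union is 1 at the [f i] with [i] in [hits A]
     and 0 at the others, so it tells [m c] from [m c']. *)
  have mE : measurable (\bigcup_(i in hits A) O i : set (borel G)).
    by apply: open_mbl; apply: bigcup_open => i _; exact: oO.
  have [T TE] := restr_functional mE.
  have m1 : m c T = 1.
    apply: ((mP c).2 T).1 cA _ => i Ai; rewrite TE.
    rewrite (_ : restrL1 _ _ = f i) ?density_cintegral//.
    apply: L1_ext => x; rewrite restrL1E// indicE.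
    have [->|/fO Ox] := eqVneq (f i x) 0; first by rewrite mul0r.
    by rewrite mem_set ?mulr1//; exists i.
  have m0 : m c' T = 0.
    apply: ((mP c').2 T).2 nc'A _ => i nAi; rewrite TE.
    rewrite (_ : restrL1 _ _ = 0); first by have := cintegralZ (mu := mu) 0 0; rewrite scale0r mul0r.
    apply: L1_ext => x; rewrite restrL1E// indicE.
    have [->|/fO Ox] := eqVneq (f i x) 0; first by rewrite mul0r.
    rewrite memNset ?mulr0// => -[j Aj]; apply: (dO i) Ox.
    by move=> ij; apply: nAi; rewrite ij.
  by have := m1; rewrite mm m0 => /eqP; rewrite eq_sym oner_eq0.
apply: (@card_le_trans _ _ _ (range m)).
  by have /card_eqPle[] : range m #= [set: set (set K)] by apply: inj_card_eq; exact: in2W.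
by apply: subset_card_le => _ [chi _ <-]; case: (mP chi).
Qed.

End ultra_means.

(** * The upper bound *)

Lemma embeds_countable (T : countType) (K : Type) : embeds nat K -> embeds T K.
Proof. by apply: embeds_trans; exists pickle; exact: pcan_inj pickleK. Qed.

(** Each value is recorded by the rational cuts of its real and imaginary parts. *)
Lemma embeds_complex_fun (R : realType) (X : Type) :
  embeds (X -> R[i]) (set (X * (bool * rat))).
Proof.
pose part (b : bool) (z : R[i]) := if b then complex.Re z else complex.Im z.
exists (fun u => [set p | ratr p.2.2 < part p.2.1 (u p.1)]) => u v /seteqP[uv vu].
have eq_part b x : part b (u x) = part b (v x).
  have [lt|lt|//] := ltgtP (part b (u x)) (part b (v x)).
    have [q] := rat_in_itvoo lt; rewrite in_itv /= => /andP[q1 q2].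
    by have := vu (x, (b, q)) q2; rewrite /= ltNge (ltW q1).
  have [q] := rat_in_itvoo lt; rewrite in_itv /= => /andP[q1 q2].
  by have := uv (x, (b, q)) q2; rewrite /= ltNge (ltW q1).
apply/funext => x; have := eq_part true x; have := eq_part false x.
by rewrite /part; case: (u x) => a b; case: (v x) => c d /= -> ->.
Qed.

(** A disjoint union inside [K * K]: the label [n 0] marks the elements of the set, [n 1] the code
    of the point of [T]. *)
Lemma embeds_set_prod (K T : Type) : embeds nat K -> embeds T K ->
  embeds (set K * T) (set K).
Proof.
move=> natK [c ci]; have [n ni] := natK.
apply: embeds_trans (embeds_set (embeds_square natK)).
exists (fun p => [set q | (p.1 q.1 /\ q.2 = n 0%N) \/ (q.1 = c p.2 /\ q.2 = n 1%N)]).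
have d01 : n 0%N <> n 1%N by move=> /ni.
move=> [A t] [B t'] /seteqP[/= AB BA]; congr (_, _).
  apply/seteqP; split=> x Ax.
    by have [|[]//|[_ /= /d01]] := AB (x, n 0%N); first by left.
  by have [|[]//|[_ /= /d01]] := BA (x, n 0%N); first by left.
apply: ci; have [|[_ /= /esym /d01]//|[]//] := AB (c t, n 1%N); first by right.
Qed.

Section upper_bound.
Context (G : topologicalGroupType) (R : realType) (mu : leftHaarMeasure G R).
Hypothesis hG : hausdorff_space G.
Hypothesis lcG : locally_compact [set: G].
Context (Delta : G -> R) (mDelta : modular_function mu Delta).
Local Notation C := R[i].
Local Notation L1 := (L1 mu).
Local Notation Linf := (Linf mu).
Local Notation N := (@L1norm G R mu).
Local Notation conv := (@Defs.conv G R mu).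
Local Notation L1inv := (L1inv hG lcG mDelta).
Local Notation density := (@density G R mu).
Implicit Types (f g h F phi : L1) (S T : Linf) (e : R).

(** At accuracy [1 / (n + 1)] each compact piece needs finitely many centres; an index gives the
    piece, the accuracy and the position in the list of centres. *)
Lemma translate_net (K : Type) h : compact_covering G K ->
  exists d : K * nat * nat -> G, forall e x, 0 < e -> exists j (O : set G), [/\ open O, O x &
    forall y, O y -> N (translate (y^-1)%g h - translate ((d j)^-1)%g h) <= e].
Proof.
move=> [A cA AG].
have /choice[W WP] : forall n : nat, exists W : set G, [/\ open W, W 1%g &
    forall y d, W (y^-1 * d)%g ->
      N (translate (y^-1)%g h - translate (d^-1)%g h) <= n.+1%:R^-1].
  by move=> n; apply: translate_near; rewrite // invr_gt0.
pose O n d := [set x | W n (x^-1 * d)%g].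
have oO n d : open (O n d).
  apply: (@open_preimage _ _ (fun y => y^-1 * d)%g); last by case: (WP n).
  by apply: continuous_mulg => y; [exact: invg_continuous|exact: cvg_cst].
have /choice[s sP] : forall p : K * nat, exists s : seq G,
    forall x, A p.1 x -> exists2 d, d \in s & O p.2 d x.
  move=> [k n]; have [|x Ax|s _ sA] := compact_cover_seq (D := setT) (f := O n) (cA k).
  - by move=> d _; exact: oO.
  - by exists x => //; rewrite /O /= mulVg; case: (WP n).
  - by exists s.
exists (fun j => nth 1%g (s j.1) j.2) => e x e0.
have [n ne] : exists n : nat, n.+1%:R^-1 <= e.
  have h0 : 0 <= e^-1 by rewrite invr_ge0 ltW.
  exists (Num.bound e^-1); rewrite invf_ple ?posrE//.
  by apply: le_trans (ltW (archi_boundP h0)) _; rewrite ler_nat.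
have : [set: G] x by []; rewrite -AG => -[k _ Akx].
have [d ds Od] := sP (k, n) x Akx.
exists (k, n, index d (s (k, n))), (O n d); rewrite /= nth_index//; split=> // y Oy.
by apply: le_trans ne; case: (WP n) => _ _; apply.
Qed.

(** The test elements are right translates of [f]. The involution writes [f * g] as a product with
    second factor [L1inv f], to which [conv_local_eq0] applies; the main term there vanishes because
    [S] and [T] agree on the net. *)
Lemma lmodact_eq_net (J : Type) (d : J -> G) f S T :
  (forall e x, 0 < e -> exists j (O : set G), [/\ open O, O x & forall y, O y ->
    N (translate (y^-1)%g (L1inv f) - translate ((d j)^-1)%g (L1inv f)) <= e]) ->
  (forall j, S (L1inv (translate ((d j)^-1)%g (L1inv f))) =
             T (L1inv (translate ((d j)^-1)%g (L1inv f)))) ->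
  lmodact f S = lmodact f T.
Proof.
move=> dnet ST; apply: Linf_ext => g; rewrite !lmodactE//.
apply/eqP; rewrite -subr_eq0; apply/eqP.
have T1p : (fun h => (S - T) (L1inv h)) \in @Linfpred _ _ mu.
  apply: (@Linfpred_comp _ _ _ (S - T) L1inv 1) => [a f1 f2|f1].
    by rewrite L1inv_linear; apply: L1eq_ae; exact: aeW.
  by rewrite L1norm_inv mul1r.
pose T1 : Linf := MkLinf T1p.
have S1p : (fun g => T1 (conv g (L1inv f))) \in @Linfpred _ _ mu.
  apply: (@Linfpred_comp _ _ _ T1 (conv^~ (L1inv f)) (2 * N (L1inv f))) => [a f1 f2|f1].
    exact: conv_linear_l.
  by rewrite -mulrA (mulrC (N (L1inv f))); exact: L1norm_conv.
have S10 : forall g, (MkLinf S1p : Linf) g = 0.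
  apply: (conv_local_eq0 hG lcG (T := T1) (h := L1inv f)) => e e0 x.
  have [j [ O [ oO Ox Oy]]] := dnet e x e0; exists O, (d j); split=> // g'.
  rewrite LinfB LinfZ (_ : T1 (translate _ _) = 0) ?mulr0 ?subr0//.
  by rewrite -[LHS]/(S (L1inv _) - T (L1inv _)) ST subrr.
have E := conv_inv hG lcG mDelta (L1inv g) (L1inv f); rewrite !L1invK in E.
have := S10 (L1inv g); rewrite -[LHS]/((S - T) (L1inv (conv (L1inv g) (L1inv f)))).
by rewrite (Linf_eq (S - T) E).
Qed.

Lemma card_TLIM_le (K : Type) : compact_covering_number G K -> ~ compact [set: G] ->
  TLIM mu #<= [set: set (set K)].
Proof.
move=> cK ncG; have natK := covering_infinite ncG cK.1.
have [f df] := exists_density mu hG lcG.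
have [d dnet] := translate_net (L1inv f) cK.1.
pose J := (K * nat * nat)%type.
pose val T : J -> C := fun j => T (L1inv (translate ((d j)^-1)%g (L1inv f))).
(* [J] embeds in [K] and complex functions on it are coded by cuts, so [J -> C] embeds in [set K];
   repeating the coding one level up gives [set (set K)]. *)
have [c ci] : embeds ((J -> C) -> C) (set (set K)).
  have JK : embeds (J * (bool * rat)) K.
    apply: embeds_trans (embeds_square natK); apply: embeds_prod; last exact: embeds_countable.
    apply: embeds_trans (embeds_square natK); apply: embeds_prod => //.
    by apply: embeds_trans (embeds_square natK); apply: embeds_prod => //; exists id.
  apply: embeds_trans (@embeds_complex_fun R _) _.
  apply: embeds_set; apply: embeds_trans (embeds_set_prod natK (@embeds_countable (bool * rat)%type K natK)).
  apply: embeds_prod; last by exists id.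
  apply: embeds_trans (@embeds_complex_fun R _) _; exact: embeds_set.
(* One representative functional per table [u] of values on the net, so that [m] is encoded by
   [u |-> m (lmodact f (sec u))]. *)
have /choice[sec secP] : forall u : J -> C, exists T, forall T', val T' = u -> val T = u.
  by move=> u; have [[T' T'u]|nT] := pselect (exists T', val T' = u);
    [exists T'|exists 0 => T' T'u; case: nT; exists T'].
apply/pcard_injP; exists (fun m => c (fun u => m (lmodact f (sec u)))) => m m'.
rewrite !inE => -[_ inv] [_ inv'] /ci mm'; apply/funext => T.
(* [T] and its representative agree on the net, so multiplication by [f] identifies them, and an
   invariant [m] takes the same value on [T] and on [lmodact f T]. *)
have fT : lmodact f (sec (val T)) = lmodact f T.
  apply: (lmodact_eq_net dnet) => j.
  by have := congr1 (fun u => u j) (secP (val T) T erefl).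
rewrite -(inv f T (density_P1 df)) -(inv' f T (density_P1 df)) -fT.
exact: (congr1 (fun F : (J -> C) -> C => F (val T)) mm').
Qed.

End upper_bound.

Theorem theorem4p16 (R : realType) (G : topologicalGroupType)
    (mu : leftHaarMeasure G R) (K : Type) :
  hausdorff_space G -> locally_compact [set: G] -> ~ compact [set: G] ->
  amenable mu -> compact_covering_number G K ->
  TIM mu #= TLIM mu /\ TLIM mu #= [set: set (set K)].
Proof.
move=> hG lcG ncG am; elim/Pchoice: K => K cK.
have [Delta mDelta] := exists_modular_function mu hG lcG.
have lower : [set: set (set K)] #<= TIM mu by exact: card_TIM_ge mDelta _ cK ncG am.
have upper : TLIM mu #<= [set: set (set K)] by exact: card_TLIM_le mDelta _ cK ncG.
have sub : TIM mu #<= TLIM mu by apply: subset_card_le => m [].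
split; apply/card_eqPle; split=> //; first exact: card_le_trans upper lower.
exact: card_le_trans lower sub.
Qed.
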